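(* Let $N\ge2$, $\lambda\le\frac{N(N-2)}{4}$, and $1<p\le\frac{N+2}{N-2}$ (with $1<p<\infty$ if $N=2$). If $u\in H^1(\mathbb{B}^N)$ is a solution of $$-\Delta_{\mathbb{B}^N}u-\lambda u=|u|^{p-1}u\quad\text{in }\mathbb{B}^N,$$ then there is a constant $C>0$ such that $$u(x)\le C\left(\frac{1-|x|^2}{2}\right)^{\frac{N-2}{2}}\quad\text{for all }x\in\mathbb{B}^N.$$
   Context: $\mathbb{B}^N=\{x\in\mathbb{R}^N:|x|<1\}$ is the ball model of hyperbolic space, with metric $g_{ij}=\left(\frac{2}{1-|x|^2}\right)^2\delta_{ij}$, volume $dV_{\mathbb{B}^N}=\left(\frac{2}{1-|x|^2}\right)^N dx$, and Laplace-Beltrami operator $\Delta_{\mathbb{B}^N}=\left(\frac{1-|x|^2}{2}\right)^2\Delta+(N-2)\frac{1-|x|^2}{2}\langle x,\nabla\cdot\rangle$. $H^1(\mathbb{B}^N)$ is the Sobolev space of this Riemannian manifold, with squared norm $\int_{\mathbb{B}^N}(|\nabla_{\mathbb{B}^N}u|^2_{\mathbb{B}^N}+u^2)\,dV_{\mathbb{B}^N}$, where $|\nabla_{\mathbb{B}^N}u|^2_{\mathbb{B}^N}=\left(\frac{1-|x|^2}{2}\right)^2|\nabla u|^2$. Solutions are understood in the weak sense; by standard elliptic theory they are in $C^2(\mathbb{B}^N)$. The constant $C$ may depend on $u$. *)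

(* Defs.v *)
From HB Require Import structures.
From mathcomp Require Import all_boot all_order all_algebra.
From mathcomp Require Import all_classical all_reals all_analysis.

Set Implicit Arguments.
Unset Strict Implicit.
Unset Printing Implicit Defensive.

Import Order.TTheory GRing.Theory Num.Theory.
Import numFieldTopology.Exports numFieldNormedType.Exports.

Local Open Scope classical_set_scope.
Local Open Scope ring_scope.

(* R^n is 'rV[R]_n.  Its sigma-algebra is generated by the coordinates, as the
   library does for n.-tuple. *)
Definition measure_rV_display : measure_display.
Proof. exact: measure_tuple_display default_measure_display. Qed.

Section measurable_rV.
Context {R : realType} (n : nat).

Let coors : 'I_n -> 'rV[R]_n -> measurableTypeR R := fun i x => x 0 i.

Let rV_set0 : g_sigma_preimage coors set0.
Proof. exact: sigma_algebra0. Qed.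

Let rV_setC A : g_sigma_preimage coors A -> g_sigma_preimage coors (~` A).
Proof. exact: sigma_algebraC. Qed.

Let rV_bigcup (F : _^nat) : (forall i, g_sigma_preimage coors (F i)) ->
  g_sigma_preimage coors (\bigcup_i (F i)).
Proof. exact: sigma_algebra_bigcup. Qed.

HB.instance Definition _ := @isMeasurable.Build measure_rV_display
  'rV[R]_n (g_sigma_preimage coors) rV_set0 rV_setC rV_bigcup.

Lemma measurable_coord (i : 'I_n) :
  measurable_fun [set: 'rV[R]_n] (fun x : 'rV[R]_n => x 0 i : measurableTypeR R).
Proof.
move=> _ Y mY; rewrite setTI; apply: sub_sigma_algebra => /=.
rewrite -bigcup_seq/=; exists i => /=; first by rewrite mem_index_enum.
by exists Y => //; rewrite setTI.
Qed.

Lemma measurable_fun_rV d (T : measurableType d) (f : T -> 'rV[R]_n) :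
  (forall i, measurable_fun [set: T] (fun x => f x 0 i : measurableTypeR R)) ->
  measurable_fun [set: T] f.
Proof.
move=> mf _ A; rewrite setTI => mA.
suff : g_sigma_preimage coors `<=` [set A | measurable (f @^-1` A)] by exact.
apply: smallest_sub => /=.
  split => /=.
  - by rewrite preimage_set0.
  - by move=> B mB; rewrite setTD preimage_setC; exact: measurableC.
  - by move=> F mF; rewrite preimage_bigcup; exact: bigcup_measurable.
move=> B; rewrite -bigcup_seq => -[i _ [C mC <-]] /=.
by have := mf i measurableT C mC; rewrite !setTI.
Qed.

End measurable_rV.

Section lebesgue_rV.
Context {R : realType}.

Definition cons_rV n (z : measurableTypeR R * 'rV[R]_n) : 'rV[R]_n.+1 :=
  row_mx (z.1%:M : 'M[R]_1) z.2.

Definition uncons_rV n (x : 'rV[R]_n.+1) : measurableTypeR R * 'rV[R]_n :=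
  (x 0 0, \row_i x 0 (lift ord0 i)).

Lemma cons_rVK n : cancel (@cons_rV n) (@uncons_rV n).
Proof.
move=> [a y]; congr pair.
  have -> : (0 : 'I_n.+1) = @lshift 1 n 0 by apply/val_inj.
  by rewrite (row_mxEl (a%:M : 'M[R]_1) y) mxE.
apply/rowP => i; rewrite mxE.
have -> : lift ord0 i = @rshift 1 n i by apply/val_inj.
by rewrite (row_mxEr (a%:M : 'M[R]_1) y).
Qed.

Lemma measurable_cons_rV n : measurable_fun setT (@cons_rV n).
Proof.
apply: measurable_fun_rV => i.
have [j ->|j ->] := @split_ordP 1 n i.
  under eq_fun do rewrite /cons_rV (row_mxEl (_ : 'M[R]_1)) ord1 mxE eqxx mulr1n.
  exact: measurable_fst.
under eq_fun do rewrite /cons_rV (row_mxEr (_ : 'M[R]_1)).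
exact: (measurableT_comp (measurable_coord j) measurable_snd).
Qed.

Lemma measurable_uncons_rV n : measurable_fun setT (@uncons_rV n).
Proof.
apply: measurable_fun_pair; first exact: measurable_coord.
apply: measurable_fun_rV => i.
under eq_fun do rewrite mxE.
exact: measurable_coord.
Qed.

(* The library's instance of this fact is not found by inference: a later
   instance on product_measure1, for subprobabilities, hides it. *)
Lemma product_sigma_finite d1 d2 (T1 : measurableType d1)
    (T2 : measurableType d2) (m1 : {sigma_finite_measure set T1 -> \bar R})
    (m2 : {sigma_finite_measure set T2 -> \bar R}) :
  sigma_finite setT (m1 \x m2)%E.
Proof.
have /sigma_finiteP[F [TF ndF Foo]] := sigma_finiteT m1.
have /sigma_finiteP[G [TG ndG Goo]] := sigma_finiteT m2.
exists (fun k => F k `*` G k).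
  rewrite -setXTT TF TG predeqE => -[x y]; split.
    move=> [/= [k _ Fkx] [l _ Gly]]; exists (maxn k l) => //; split.
    - by move: x Fkx; exact/subsetPset/ndF/leq_maxl.
    - by move: y Gly; exact/subsetPset/ndG/leq_maxr.
  by move=> [k _ []/= ? ?]; split; exists k.
move=> k; have [? ?] := Foo k; have [? ?] := Goo k.
split; first exact: measurableX.
by rewrite product_measure1E// lte_mul_pinfty// ge0_fin_numE.
Qed.

Lemma pushforward_sigma_finite d d' (T : measurableType d)
    (T' : measurableType d') (m : set T -> \bar R)
    (f : T -> T') (f' : T' -> T) :
  sigma_finite setT m -> measurable_fun setT f' -> cancel f f' ->
  sigma_finite setT (pushforward m f).
Proof.
move=> [F FT Foo] mf' fK.
exists (fun k => f' @^-1` F k); first by rewrite -preimage_bigcup -FT preimage_setT.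
move=> k; have [mFk Fkoo] := Foo k; split.
  by rewrite -[X in measurable X]setTI; exact: mf'.
rewrite /pushforward (_ : f @^-1` _ = F k)//.
by apply/seteqP; split => x /=; rewrite fK.
Qed.

Section step.
Variables (n : nat) (mu : {sigma_finite_measure set 'rV[R]_n -> \bar R}).

Definition lebesgue_cons : set 'rV[R]_n.+1 -> \bar R :=
  pushforward (lebesgue_measure \x mu)%E (@cons_rV n).

Let mcons := @measurable_cons_rV n.

Let lebesgue_cons0 : lebesgue_cons set0 = 0%E.
Proof. exact: measure0. Qed.

Let lebesgue_cons_ge0 A : (0 <= lebesgue_cons A)%E.
Proof. exact: measure_ge0. Qed.

Let lebesgue_cons_sigma_additive : semi_sigma_additive lebesgue_cons.
Proof. exact: measure_semi_sigma_additive. Qed.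

HB.instance Definition _ := isMeasure.Build _ _ _ lebesgue_cons
  lebesgue_cons0 lebesgue_cons_ge0 lebesgue_cons_sigma_additive.

Let lebesgue_cons_sigma_finite : sigma_finite setT lebesgue_cons.
Proof.
apply: pushforward_sigma_finite (@measurable_uncons_rV n) (@cons_rVK n).
exact: product_sigma_finite.
Qed.

HB.instance Definition _ := Measure_isSigmaFinite.Build _ _ _ lebesgue_cons
  lebesgue_cons_sigma_finite.

End step.

Fixpoint lebesgue_rV n : {sigma_finite_measure set 'rV[R]_n -> \bar R} :=
  match n with
  | 0 => \d_(0 : 'rV[R]_0)
  | m.+1 => lebesgue_cons (lebesgue_rV m)
  end.

End lebesgue_rV.

Section calculus.
Context {R : realType} (n : nat).
Implicit Types (Om : set 'rV[R]_n) (f u phi : 'rV[R]_n -> R) (x y : 'rV[R]_n).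

(* The library's norm on 'rV is the sup norm, hence a separate Euclidean one. *)
Definition edot x y : R := \sum_i x 0 i * y 0 i.

Definition enorm x : R := Num.sqrt (edot x x).

Definition partial (i : 'I_n) f : 'rV[R]_n -> R := 'D_(delta_mx 0 i) f.

Definition grad f x : 'rV[R]_n := \row_i partial i f x.

Fixpoint Ck (k : nat) Om f : Prop :=
  (forall x, Om x -> {for x, continuous f}) /\
  if k is k'.+1 then forall i : 'I_n,
    (forall x, Om x -> derivable f x (delta_mx 0 i)) /\ Ck k' Om (partial i f)
  else True.

Definition test_function Om phi : Prop :=
  [/\ forall k, Ck k setT phi,
      compact (closure [set x | phi x != 0]) &
      closure [set x | phi x != 0] `<=` Om].

Definition loc_integrable Om f : Prop :=
  measurable_fun Om f /\
  forall K, compact K -> K `<=` Om -> (lebesgue_rV n).-integrable K (EFin \o f).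

Definition weak_gradient Om u (g : 'rV[R]_n -> 'rV[R]_n) : Prop :=
  [/\ loc_integrable Om u,
      forall i, loc_integrable Om (fun x => g x 0 i) &
      forall phi, test_function Om phi -> forall i,
        (\int[lebesgue_rV n]_(x in Om) (u x * partial i phi x)%:E =
         - \int[lebesgue_rV n]_(x in Om) (g x 0 i * phi x)%:E)%E].

End calculus.

Section hyperbolic_ball.
Context {R : realType} (n : nat).
Implicit Types (f u phi : 'rV[R]_n -> R) (x v w : 'rV[R]_n).

Definition hball : set 'rV[R]_n := [set x | enorm x < 1].

(* The metric is g_ij = rho^-2 delta_ij. *)
Definition rho x : R := (1 - enorm x ^+ 2) / 2.

Definition hintegral f : \bar R :=
  (\int[lebesgue_rV n]_(x in hball) (f x * rho x ^- n)%:E)%E.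

(* The metric paired with the hyperbolic gradients rho^2 (Euclidean gradient):
   <rho^2 v, rho^2 w>_g = rho^2 <v, w>, for Euclidean gradients v and w. *)
Definition hgrad_dot x v w : R := rho x ^+ 2 * edot v w.

Definition H1 u : Prop := exists g, weak_gradient hball u g /\
  (hintegral (fun x => hgrad_dot x (g x) (g x) + u x ^+ 2)%R < +oo)%E.

(* Weak form of - Delta u - lambda u = |u|^(p-1) u for the Laplace-Beltrami
   operator Delta: the pairing of - Delta u with phi is the integral of
   <grad u, grad phi> in the metric, against the hyperbolic volume. *)
Definition weak_solution (lambda p : R) u : Prop :=
  exists g, weak_gradient hball u g /\
  forall phi, test_function hball phi ->
    hintegral (fun x => hgrad_dot x (g x) (grad phi x) - lambda * u x * phi x) =
    hintegral (fun x => `|u x| `^ (p - 1) * u x * phi x).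

End hyperbolic_ball.

(* Main.v *)
(** The conformal change u = rho^s v turns the equation into
    sum_i d_i (rho^(2s-N+2) d_i v) = rho^(2s-N) (s (N-1-s) + (2s-N+2) s rho - lambda - |u|^(p-1)) v.
    For s = (N-2)/2 it is a Euclidean equation for the Laplacian of v.  If |u| did not
    tend to 0 at the boundary, point picking would give points x1 arbitrarily near it
    such that |u| is bounded by a multiple of |u(x1)| at the length scale of the
    equation; Brandt's interior gradient estimate (maximum principle on a half cube)
    keeps |u| comparable to |u(x1)| on a smaller cube, and testing the weak equation
    with a bump there bounds the H^1 energy of the cube from below.  This uses
    p <= (N+2)/(N-2), and contradicts the smallness of the energy near the boundary.
    For s = (N-1)/2, and |u|^(p-1) small, v is a strict subsolution near the boundary
    wherever it is positive, since lambda <= (N-1)^2/4 - 1/4.  Testing its equation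
    with a function of v - M times a cutoff that varies slowly in log rho gives
    v <= M, because the integral of v^2 / rho is at most the H^1 energy.  Hence
    u <= M rho^((N-1)/2), which is stronger than the claim. *)
Require Import Defs.
From mathcomp Require Import all_boot all_order all_algebra.
From mathcomp Require Import all_classical all_reals all_analysis.
From mathcomp Require Import measurable_realfun ring lra.

Set Implicit Arguments.
Unset Strict Implicit.
Unset Printing Implicit Defensive.

Import Order.TTheory GRing.Theory Num.Theory.
Import numFieldTopology.Exports numFieldNormedType.Exports.

Local Open Scope classical_set_scope.
Local Open Scope ring_scope.

(** The two exponents [s] serve different purposes. With s = (n-2)/2 the weight disappears and a
    gradient estimate for the plain Laplacian applies, but the linear coefficient n(n-2)/4 - lambda
    may be 0 and then cannot absorb the nonlinear term. With s = (n-1)/2 that coefficient is at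
    least 1/4, which absorbs |u|^(p-1) once this is at most 1/16; that is the smallness the first
    half provides. The critical exponent comes from scaling. A value of size b = |u|^((p-1)/2)
    persists on a cube of radius y rho with y of order 1/b. There the hyperbolic integral of |u|^p
    has order b^(2p/(p-1)) y^n, and Young's inequality in the tested equation gives an energy of
    order at least b^(4p/(p-1)) y^(n+2), that is b^(4p/(p-1)-(n+2)). The exponent is nonnegative
    exactly when p(n-2) <= n+2, and then b >= 1/4 bounds the energy from below. The weak gradient is
    never identified with the classical gradient of u: it enters only through its energy and through
    integration by parts against test functions. The decay step relies on the classical divergence
    theorem and on the integrability of u^2 rho^-n. *)

Section line.
Context {R : realType} {n : nat}.
Implicit Types (f g : 'rV[R]_n -> R) (x v : 'rV[R]_n).

(** Both difference quotients are the same function of the increment. [Ck] provides only directional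
    derivatives, and this reduction to one variable yields a chain rule without total
    differentiability. *)
Lemma is_derive_line f x v (t df : R) :
  is_derive (t *: v + x) v f df <->
  is_derive t (1 : R) (fun s : R => f (s *: v + x)) df.
Proof.
set q1 := fun h : R => h^-1 *: ((f \o shift (t *: v + x)) (h *: v) - f (t *: v + x)).
set q2 := fun h : R => h^-1 *:
  (((fun s : R => f (s *: v + x)) \o shift t) (h *: (1 : R)) - f (t *: v + x)).
have q12 : q1 = q2.
  apply/funext => h; rewrite /q1 /q2 /=; congr (_ *: (f _ - _)).
  by rewrite addrA -scalerDl [_%:A]mulr1.
split=> -[].
- rewrite /derivable /derive -/q1 q12 => d1 d2.
  by apply: DeriveDef; rewrite /derivable /derive -/q2.
- rewrite /derivable /derive -/q2 -q12 => d1 d2.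
  by apply: DeriveDef; rewrite /derivable /derive -/q1.
Qed.

Lemma is_derive_compr (h : R -> R) f x v (dh df : R) :
  is_derive (f x) 1 h dh -> is_derive x v f df ->
  is_derive x v (h \o f) (dh * df).
Proof.
have -> : x = 0 *: v + x by rewrite scale0r add0r.
move=> Dh /is_derive_line Df; apply/is_derive_line.
exact: (@is_derive1_comp _ h (fun s => f (s *: v + x))).
Qed.

Lemma is_derive_mul f g x v (df dg : R) :
  is_derive x v f df -> is_derive x v g dg ->
  is_derive x v (fun y => f y * g y) (f x * dg + g x * df).
Proof. exact: is_deriveM. Qed.

Lemma is_derive_add f g x v (df dg : R) :
  is_derive x v f df -> is_derive x v g dg ->
  is_derive x v (fun y => f y + g y) (df + dg).
Proof. exact: is_deriveD. Qed.

Lemma is_derive_coord x v i : is_derive x v (fun y : 'rV[R]_n => y 0 i) (v 0 i).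
Proof.
have -> : x = 0 *: v + x by rewrite scale0r add0r.
apply/is_derive_line.
have -> : (fun s : R => (s *: v + x) 0 i) = (fun s => s * v 0 i + x 0 i).
  by apply/funext => s; rewrite !mxE.
have d1 : is_derive (0 : R) 1 (id : R -> R) 1 by exact: is_derive_id.
have d2 : is_derive (0 : R) 1 (cst (v 0 i) : R -> R) 0 by exact: is_derive_cst.
have d3 : is_derive (0 : R) 1 (cst (x 0 i) : R -> R) 0 by exact: is_derive_cst.
apply: (is_derive_eq (is_deriveD (is_deriveM d1 d2) d3)).
by rewrite scaler0 add0r addr0 /cst; exact: mulr1.
Qed.

End line.

(** * Calculus of C^k functions on open sets *)

Section Ck.
Context {R : realType} {n : nat}.
Implicit Types (Om : set 'rV[R]_n) (f g h : 'rV[R]_n -> R) (x : 'rV[R]_n).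

Lemma partialP i f x (d : R) :
  is_derive x (delta_mx 0 i) f d -> partial i f x = d.
Proof. by move=> ?; rewrite /partial derive_val. Qed.

Lemma Ck_continuous k Om f x : Ck k Om f -> Om x -> {for x, continuous f}.
Proof. by case: k => [|k] [fc _]; exact: fc. Qed.

Lemma Ck_is_derive k Om f x i : Ck k.+1 Om f -> Om x ->
  is_derive x (delta_mx 0 i) f (partial i f x).
Proof. by move=> [_ /(_ i)[d _]] Omx; apply/derivableP/d. Qed.

Lemma Ck_partial k Om f i : Ck k.+1 Om f -> Ck k Om (partial i f).
Proof. by move=> [_ /(_ i)[]]. Qed.

Lemma CkW k Om f : Ck k.+1 Om f -> Ck k Om f.
Proof.
elim: k f => [|k ih] f Cf; split=> [x|]; try exact: Ck_continuous Cf.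
  by [].
move=> i; split; first by move=> x; have [_ /(_ i)[+ _]] := Cf; exact.
exact/ih/Ck_partial/Cf.
Qed.

Lemma Ck_subset k Om Om' f : Om' `<=` Om -> Ck k Om f -> Ck k Om' f.
Proof.
move=> sub; elim: k f => [|k ih] f [fc fp]; (split; first by move=> x /sub; exact: fc) => //.
move=> i; have [d C] := fp i; split; last exact: ih.
by move=> x /sub; exact: d.
Qed.

Lemma CkU k Om Om' f : Ck k Om f -> Ck k Om' f -> Ck k (Om `|` Om') f.
Proof.
elim: k f => [|k ih] f [fc fp] [fc' fp'];
  (split; first by move=> x []; [exact: fc|exact: fc']) => //.
move=> i; have [d C] := fp i; have [d' C'] := fp' i; split; last exact: ih.
by move=> x []; [exact: d|exact: d'].
Qed.

Lemma near_eq_continuous f g x : (\forall y \near x, f y = g y) ->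
  {for x, continuous f} -> {for x, continuous g}.
Proof.
move=> fg fx; have E : f x = g x := nbhs_singleton fg.
have fgx : f @ x --> g x by rewrite -E.
exact: (cvg_trans (near_eq_cvg fg) fgx).
Qed.

Lemma Ck_ext k Om f g : open Om -> (forall x, Om x -> f x = g x) ->
  Ck k Om f -> Ck k Om g.
Proof.
move=> oOm; elim: k f g => [|k ih] f g fg [fc fp]; (split; first (
  by move=> x Omx; apply: near_eq_continuous (fc x Omx);
  near=> y; apply: fg; near: y; exact: open_nbhs_nbhs)) => //.
move=> i; have [d C] := fp i.
have dg x : Om x -> is_derive x (delta_mx 0 i) g (partial i f x).
  move=> Omx; apply: near_eq_is_derive; last exact/derivableP/d.
  by near=> y; apply: fg; near: y; exact: open_nbhs_nbhs.
split; first by move=> x /dg[].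
by apply: ih C => x /dg dgx; rewrite (partialP dgx).
Unshelve. all: by end_near. Qed.

(** Lets explicit formulas [df] stand in for [partial]. Openness matters because a partial
    derivative at a point depends on nearby values. *)
Lemma Ck_intro k Om f (df : 'I_n -> 'rV[R]_n -> R) : open Om ->
  (forall x, Om x -> {for x, continuous f}) ->
  (forall i x, Om x -> is_derive x (delta_mx 0 i) f (df i x)) ->
  (forall i, Ck k Om (df i)) -> Ck k.+1 Om f.
Proof.
move=> oOm fc fd dfC; split=> // i; split; first by move=> x /(fd i)[].
by apply: Ck_ext (dfC i) => // x /(fd i) dx; rewrite (partialP dx).
Qed.

Lemma Ck_cst k Om (c : R) : Ck k Om (fun=> c).
Proof.
have cc (a : R) x : {for x, continuous (fun _ : 'rV[R]_n => a)} by exact: cst_continuous.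
elim: k c => [|k ih] c; (split; first by move=> x _; exact: cc) => //.
move=> i; split=> [x _|].
  exact: derivable_cst.
have -> : partial i (fun=> c) = fun=> 0.
  by apply/funext => x; apply: partialP; exact: is_derive_cst.
exact: ih.
Qed.

Lemma CkD k Om f g : open Om -> Ck k Om f -> Ck k Om g ->
  Ck k Om (fun x => f x + g x).
Proof.
move=> oOm; elim: k f g => [|k ih] f g Cf Cg.
  by split=> // x Omx; exact: (cvgD (Ck_continuous Cf Omx) (Ck_continuous Cg Omx)).
apply: (@Ck_intro _ _ _ (fun i x => partial i f x + partial i g x)) => //.
- by move=> x Omx; exact: (cvgD (Ck_continuous Cf Omx) (Ck_continuous Cg Omx)).
- by move=> i x Omx; apply: is_derive_add; [exact: (Ck_is_derive _ Cf Omx)|exact: (Ck_is_derive _ Cg Omx)].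
- by move=> i; apply: ih; exact: Ck_partial.
Qed.

Lemma CkM k Om f g : open Om -> Ck k Om f -> Ck k Om g ->
  Ck k Om (fun x => f x * g x).
Proof.
move=> oOm; elim: k f g => [|k ih] f g Cf Cg.
  by split=> // x Omx; exact: (cvgM (Ck_continuous Cf Omx) (Ck_continuous Cg Omx)).
apply: (@Ck_intro _ _ _ (fun i x => f x * partial i g x + g x * partial i f x)) => //.
- by move=> x Omx; exact: (cvgM (Ck_continuous Cf Omx) (Ck_continuous Cg Omx)).
- by move=> i x Omx; apply: is_derive_mul; [exact: (Ck_is_derive _ Cf Omx)|exact: (Ck_is_derive _ Cg Omx)].
- by move=> i; apply: CkD => //; apply: ih; (exact: Ck_partial || exact: CkW).
Qed.

Lemma CkN k Om f : open Om -> Ck k Om f -> Ck k Om (fun x => - f x).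
Proof.
move=> oOm Cf; rewrite (_ : (fun x => - f x) = (fun x => -1 * f x)).
  by apply: CkM => //; exact: Ck_cst.
by apply/funext => x; rewrite mulN1r.
Qed.

Lemma CkB k Om f g : open Om -> Ck k Om f -> Ck k Om g ->
  Ck k Om (fun x => f x - g x).
Proof. by move=> oOm Cf Cg; apply: CkD => //; exact: CkN. Qed.

Lemma Ck_sum k Om (I : Type) (r : seq I) (F : I -> 'rV[R]_n -> R) : open Om ->
  (forall i, Ck k Om (F i)) -> Ck k Om (fun x => \sum_(i <- r) F i x).
Proof.
move=> oOm CF; elim: r => [|a r ih].
  by rewrite (_ : (fun _ => _) = fun=> 0); [exact: Ck_cst|apply/funext => x; rewrite big_nil].
rewrite (_ : (fun _ => _) = fun x => F a x + \sum_(i <- r) F i x); first exact: CkD.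
by apply/funext => x; rewrite big_cons.
Qed.

Lemma Ck_coord k Om i : open Om -> Ck k Om (fun x : 'rV[R]_n => x 0 i).
Proof.
have cc x : {for x, continuous (fun x : 'rV[R]_n => x 0 i)}.
  exact/differentiable_continuous/differentiable_coord.
move=> oOm; case: k => [|k]; first by split.
apply: (@Ck_intro _ _ _ (fun j x => (delta_mx 0 j : 'rV[R]_n) 0 i)) => //.
- by move=> j x _; exact: is_derive_coord.
- by move=> j; exact: Ck_cst.
Qed.

(** Composition with a smooth function of one variable involves all its derivatives. Listing them as
    a sequence lets the induction in [Ck_comp] pass from [H j] to [H j.+1]. *)
Definition derive_seq (D : set R) (H : nat -> R -> R) :=
  forall k t, D t -> is_derive t 1 (H k) (H k.+1 t).

Lemma Ck_comp k Om (D : set R) (H : nat -> R -> R) j f : open Om ->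
  derive_seq D H -> (forall x, Om x -> D (f x)) -> Ck k Om f ->
  Ck k Om (fun x => H j (f x)).
Proof.
move=> oOm HD fD; have cc l x : Om x -> Ck l Om f -> {for x, continuous (fun x => H j (f x))}.
  move=> Omx Cf; apply: (@continuous_comp _ _ _ f (H j)); first exact: Ck_continuous Cf Omx.
  by apply/differentiable_continuous/derivable1_diffP; have [] := HD j _ (fD x Omx).
elim: k j cc => [|k ih] j cc Cf; first by split=> // x Omx; exact: cc Cf.
apply: (@Ck_intro _ _ _ (fun i x => H j.+1 (f x) * partial i f x)) => //.
- by move=> x Omx; exact: cc Cf.
- by move=> i x Omx; apply: is_derive_compr; [exact/HD/fD|exact: (Ck_is_derive _ Cf Omx)].
- move=> i; apply: CkM => //; last exact: Ck_partial.
  apply: ih; last exact: CkW.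
  move=> l x Omx Cf'; apply: (@continuous_comp _ _ _ f (H j.+1)); first exact: Ck_continuous Cf' Omx.
  by apply/differentiable_continuous/derivable1_diffP; have [] := HD j.+1 _ (fD x Omx).
Qed.

Lemma partial_ext Om f g x i : open Om -> (forall x, Om x -> f x = g x) -> Om x ->
  partial i f x = partial i g x.
Proof.
move=> oOm fg Omx; apply: near_eq_derive.
by near=> y; apply: fg; near: y; exact: open_nbhs_nbhs.
Unshelve. all: by end_near. Qed.

End Ck.

(** * The flat function exp(-1/t) and real powers, with all their derivatives *)

Section theta.
Context {R : realType}.
Implicit Types (p : {poly R}) (t y : R).

(** The exponential dominates each term of its power series, so each monomial times e^(-y) is
    bounded; the coefficients of [p] then add up. *)
Lemma horner_expRN_bounded p :
  exists2 C : R, 0 <= C & forall y, 0 <= y -> `|p.[y]| * expR (- y) <= C.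
Proof.
have pow i : exists2 C : R, 0 <= C & forall y, 0 <= y -> y ^+ i * expR (- y) <= C.
  case: i => [|i].
    exists 1 => // y y0; rewrite expr0 mul1r -expR0 ler_expR; lra.
  exists (i.+1)`!%:R => // y y0.
  rewrite expRN ler_pdivrMr ?expR_gt0// -ler_pdivrMl ?ltr0n ?fact_gt0//.
  have := expR_ge1Dxn i y0; rewrite mulrC; lra.
exists (\sum_(i < size p) `|p`_i| * projT1 (cid2 (pow i))).
  by apply: sumr_ge0 => i _; case: cid2 => C /= ? _; rewrite mulr_ge0.
move=> y y0; rewrite horner_coef.
apply: (@le_trans _ _ ((\sum_(i < size p) `|p`_i| * y ^+ i) * expR (- y))).
  rewrite ler_wpM2r ?expR_ge0//; apply: le_trans (ler_norm_sum _ _ _) _.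
  by apply: ler_sum => i _; rewrite normrM normrX (ger0_norm y0).
rewrite mulr_suml; apply: ler_sum => i _; rewrite -mulrA ler_wpM2l//.
by case: cid2 => C /= _; exact.
Qed.

Lemma is_derive_flat (h : R -> R) (C : R) : h 0 = 0 ->
  (forall t, `|h t| <= C * t ^+ 2) -> is_derive (0 : R) 1 h 0.
Proof.
move=> h0 hC; have C0 : 0 <= C.
  by have := hC 1; rewrite expr1n mulr1; apply: le_trans.
have lim0 : (fun s : R => s^-1 *: ((h \o shift 0) (s *: (1 : R)) - h 0)) @ 0^' --> (0 : R).
  apply/cvgr0Pnorm_le => e e0.
  have d0 : 0 < e / (C + 1) by rewrite divr_gt0 ?ltr_wpDl.
  near=> s; have s0 : s != 0 by near: s; exact: nbhs_dnbhs_neq.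
  rewrite /=.
  rewrite h0 subr0 addr0 [_%:A]mulr1 normrZ normfV.
  have ns : 0 < `|s| by rewrite normr_gt0.
  rewrite ler_pdivrMl//; apply: le_trans (hC s) _.
  have -> : C * s ^+ 2 = `|s| * (C * `|s|) by rewrite -(real_normK (num_real s)); ring.
  rewrite ler_pM2l//; apply: le_trans (_ : (C + 1) * `|s| <= _); first by rewrite ler_wpM2r// lerDl.
  rewrite mulrC -ler_pdivlMr ?ltr_wpDl//.
  near: s; exact: dnbhs0_le.
apply: DeriveDef; first by apply/cvg_ex; exists 0.
exact/cvg_lim.
Unshelve. all: by end_near. Qed.

(** With y = 1/t, the derivative in t of P(y) e^(-y) is y^2 (P - P')(y) e^(-y), which is the
    recursion used here. *)
Fixpoint theta_poly k : {poly R} :=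
  if k is k'.+1 then 'X^2 * (theta_poly k' - (theta_poly k')^`()) else 1.

Definition theta_seq k t : R :=
  if 0 < t then (theta_poly k).[t^-1] * expR (- t^-1) else 0.

(* The standard flat function exp(-1/t), extended by 0. *)
Definition theta : R -> R := theta_seq 0.
Definition dtheta : R -> R := theta_seq 1.

Lemma theta_seqP : derive_seq setT theta_seq.
Proof.
move=> k t _; rewrite /=; have [t0|] := ltP 0 t.
- have d1 : is_derive t 1 (fun s : R => s^-1) (- t ^- 2).
    apply: is_derive_eq; first exact: (is_deriveV (f := id) (lt0r_neq0 t0)).
    exact: mulr1.
  have d2 := is_derive1_comp (is_derive_poly (theta_poly k) t^-1) d1.
  have d3 : is_derive t 1 (fun s : R => - s^-1) (t ^- 2).
    by rewrite -[t ^- 2]opprK; exact: is_deriveN.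
  have d4 := @is_derive1_comp _ expR (fun s => - s^-1) _ _ _ (is_derive_expR (- t^-1)) d3.
  have d5 := is_deriveM d2 d4; apply: (near_eq_is_derive _ (is_derive_eq d5 _)).
    near=> s; rewrite /theta_seq ifT//; near: s; exact: lt_nbhsr.
  rewrite /theta_seq t0 /= !hornerE /=.
  have -> : t ^- 2 = t^-1 ^+ 2 by rewrite exprVn.
  rewrite /GRing.scale/=; ring.
- rewrite le_eqVlt => /predU1P[->|t0].
    (* The extra factor 'X^2 turns boundedness into a bound C t^2, which makes the derivative at 0
       vanish. *)
    have [C C0 hC] := horner_expRN_bounded ('X^2 * theta_poly k).
    rewrite {2}/theta_seq ltxx; apply: (@is_derive_flat _ C).
      by rewrite /theta_seq ltxx.
    move=> s; rewrite /theta_seq; case: ltP => s0; last by rewrite normr0 mulr_ge0// sqr_ge0.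
    have s2 : 0 < s ^+ 2 by rewrite exprn_gt0.
    rewrite -ler_pdivrMr//; have := hC s^-1 (ltW _).
    rewrite invr_gt0 s0 => /(_ isT); apply: le_trans.
    rewrite hornerM hornerXn 2!normrM (ger0_norm (expR_ge0 _)) normrX normfV exprVn real_normK ?num_real//.
    by rewrite mulrC mulrA.
  have -> : theta_seq k.+1 t = 0 by rewrite /theta_seq ltNge (ltW t0).
  apply: near_eq_is_derive (is_derive_cst 0 _ _).
  near=> s; have s0 : s < 0 by near: s; exact: lt_nbhsl.
  by rewrite /theta_seq ltNge (ltW s0).
Unshelve. all: by end_near. Qed.

Lemma theta_ge0 t : 0 <= theta t.
Proof. by rewrite /theta /theta_seq; case: ifP => // _; rewrite hornerC mul1r expR_ge0. Qed.

Lemma theta_gt0 t : 0 < t -> 0 < theta t.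
Proof. by move=> t0; rewrite /theta /theta_seq t0 hornerC mul1r expR_gt0. Qed.

Lemma theta_eq0 t : t <= 0 -> theta t = 0.
Proof. by rewrite /theta /theta_seq; case: ltP. Qed.

Lemma dtheta_eq0 t : t <= 0 -> dtheta t = 0.
Proof. by rewrite /dtheta /theta_seq; case: ltP. Qed.

Lemma theta_le1 t : theta t <= 1.
Proof.
rewrite /theta /theta_seq; case: ltP => // t0.
by rewrite hornerC mul1r -expR0 ler_expR oppr_le0 invr_ge0 ltW.
Qed.

Lemma theta_homo : {homo theta : s t / s <= t}.
Proof.
move=> s t st; have [s0|s0] := leP s 0; first by rewrite theta_eq0// theta_ge0.
rewrite /theta /theta_seq s0 (lt_le_trans s0 st) !hornerC !mul1r ler_expR lerN2.
by rewrite lef_pV2// posrE// (lt_le_trans s0 st).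
Qed.

(** This identity is the reason for using exp(-1/t) as truncation in the decay step: it controls
    [theta] by its derivative, so a cross term in [theta] can be absorbed into a square weighted by
    [dtheta]. *)
Lemma dthetaE t : 0 < t -> t ^+ 2 * dtheta t = theta t.
Proof.
move=> t0; rewrite /dtheta /theta /theta_seq t0 /= derivC subr0 mulr1 hornerXn hornerC mul1r mulrA.
by rewrite -exprMn mulfV ?gt_eqF// expr1n mul1r.
Qed.

Lemma dtheta_ge0 t : 0 <= dtheta t.
Proof.
have [t0|t0] := leP t 0; first by rewrite dtheta_eq0.
by rewrite -(pmulr_rge0 _ (exprn_gt0 2 t0)) dthetaE// theta_ge0.
Qed.

Lemma dtheta_bounded : exists2 C : R, 0 < C & forall t, dtheta t <= C.
Proof.
have [C C0 hC] := horner_expRN_bounded ('X^2).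
exists (C + 1) => [|t]; first by rewrite ltr_wpDl.
have [t0|t0] := leP t 0; first by rewrite dtheta_eq0// addr_ge0.
rewrite /dtheta /theta_seq t0 /= derivC subr0 mulr1.
apply: (@le_trans _ _ C); last by rewrite lerDl.
apply: le_trans (hC t^-1 _); last by rewrite invr_ge0 ltW.
by rewrite ler_wpM2r ?expR_ge0// ler_norm.
Qed.

End theta.

Section powR_seq.
Context {R : realType}.

Definition powR_seq (s : R) k t : R := (\prod_(i < k) (s - i%:R)) * t `^ (s - k%:R).

Lemma powR_seqP s : derive_seq [set t : R | 0 < t] (powR_seq s).
Proof.
move=> k t /= t0; have d := is_derive1_powR (s - k%:R) t0.
have c : is_derive t 1 (cst (\prod_(i < k) (s - i%:R)) : R -> R) 0.
  exact: is_derive_cst.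
apply: (is_derive_eq (is_deriveM c d)).
by rewrite /powR_seq big_ord_recr /= scaler0 addr0 /GRing.scale/= mulrA -natr1 opprD addrA.
Qed.

Lemma powR_seq0 s : powR_seq s 0 = fun t => t `^ s.
Proof. by apply/funext => t; rewrite /powR_seq big_ord0 mul1r subr0. Qed.

End powR_seq.

(** * Cubes, and the Borel structure they generate *)

Section cubes.
Context {R : realType} {n : nat}.
Implicit Types (a b x : 'rV[R]_n) (r s : R) (U : set 'rV[R]_n).

(** Cubes are the closed balls of the library's sup norm and also products of intervals, so they fit
    both the topology and the inductive definition of Lebesgue measure. *)
Definition cube a r : set 'rV[R]_n := [set x | forall i, `|x 0 i - a 0 i| <= r].

Lemma cube_center a r : 0 <= r -> cube a r a.
Proof. by move=> r0 i; rewrite subrr normr0. Qed.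

Lemma cube_subset a b r s : (forall i, `|b 0 i - a 0 i| + s <= r) ->
  cube b s `<=` cube a r.
Proof.
move=> h x bx i; apply: le_trans (h i).
have -> : x 0 i - a 0 i = (x 0 i - b 0 i) + (b 0 i - a 0 i) by ring.
by apply: le_trans (ler_normD _ _) _; rewrite addrC lerD2l; exact: bx.
Qed.

Lemma le_cube a r s : s <= r -> cube a s `<=` cube a r.
Proof. by move=> sr x xs i; apply: le_trans (xs i) sr. Qed.

Lemma nbhs_cubeP x U : nbhs x U <-> exists2 r : R, 0 < r & cube x r `<=` U.
Proof.
split.
  move=> /nbhs_ballP[e /= e0 eU]; exists (e / 2); first by rewrite divr_gt0.
  move=> y xy; apply: eU; split=> // i j; rewrite ord1 /ball /= distrC.
  by apply: le_lt_trans (xy j) _; rewrite ltr_pdivrMr// ltr_pMr// ltr1n.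
move=> [r r0 rU]; apply/nbhs_ballP; exists r => // y [_ xy]; apply: rU => i.
by have := xy 0 i; rewrite /ball /= distrC => /ltW.
Qed.

Lemma open_cubeP U :
  open U <-> forall x, U x -> exists2 r : R, 0 < r & cube x r `<=` U.
Proof.
rewrite openE; split=> h x Ux; first by apply/nbhs_cubeP/h.
by apply/nbhs_cubeP/h.
Qed.

Lemma cube_compact a r : compact (cube a r).
Proof.
rewrite (_ : cube a r = [set v : 'rV[R]_n |
    forall i, `[a 0 i - r, a 0 i + r]%classic (v ord0 i)]).
  by apply: (@rV_compact _ _ (fun i => `[a 0 i - r, a 0 i + r]%classic)) => i; exact: segment_compact.
apply/seteqP; split=> x /= xa i; have := xa i; rewrite /= in_itv /= ler_norml.
  by move=> /andP[h1 h2]; apply/andP; split; lra.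
by move=> /andP[h1 h2]; apply/andP; split; lra.
Qed.

Lemma cube_closed a r : closed (cube a r).
Proof. exact: (compact_closed (@norm_hausdorff R 'rV[R]_n) (@cube_compact a r)). Qed.

Lemma compact_subset_cube K : compact K -> exists2 r : R, 0 < r & K `<=` cube 0 r.
Proof.
move=> /compact_bounded[M [Mr hM]]; exists (`|M| + 1) => [|x Kx i].
  by rewrite ltr_wpDl.
have /hM/(_ x Kx) hx : M < `|M| + 1 by rewrite (le_lt_trans (ler_norm _))// ltrDl.
by rewrite mxE subr0; apply: le_trans hx; rewrite [`|x|]mx_normrE; exact: (le_bigmax _ _ (0, i)).
Qed.

Lemma measurable_cube a r : measurable (cube a r).
Proof.
rewrite (_ : cube a r = \bigcap_(i : 'I_n)
    ((fun x : 'rV[R]_n => x 0 i : measurableTypeR R) @^-1` `[a 0 i - r, a 0 i + r]%classic)).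
  apply: fin_bigcap_measurable; first exact: finite_finset.
  move=> i _; rewrite -[X in measurable X]setTI; apply: measurable_coord => //.
apply/seteqP; split=> x /= xa i; have := xa i; rewrite /= in_itv /= ler_norml.
  by move=> /andP[h1 h2] _; apply/andP; split; lra.
by move=> /(_ I) /andP[h1 h2]; apply/andP; split; lra.
Qed.

(** The sigma-algebra is generated by coordinates, so this needs an argument: an open set is the
    countable union of the cubes with rational centre and radius that it contains. *)
Lemma open_measurable_rV U : open U -> measurable U.
Proof.
move=> /open_cubeP oU.
pose c (q : 'rV[rat]_n * rat) : set 'rV[R]_n := cube (map_mx ratr q.1) (ratr q.2).
have -> : U = \bigcup_q (if `[< c q `<=` U >] then c q else set0).
  apply/seteqP; split=> [x Ux|x [q _]]; last by case: asboolP => // h /h.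
  have [r r0 rU] := oU _ Ux.
  have /rat_in_itvoo[s /[!in_itv]/= /andP[s0 sr]] : 0 < r / 2 by rewrite divr_gt0.
  have hq i : {q : rat | `|x 0 i - ratr q| <= ratr s}.
    have /rat_in_itvoo/cid[q /[!in_itv]/= /andP[q1 q2]] : x 0 i - ratr s < x 0 i + ratr s by lra.
    by exists q; rewrite ler_norml; apply/andP; split; lra.
  exists (\row_i projT1 (hq i), s) => //; rewrite ifT.
    by move=> i; rewrite !mxE /=; case: (hq i).
  apply/asboolP => y cy; apply: rU => i.
  have := cy i; rewrite !mxE /=; case: (hq i) => q /= h1 h2.
  have -> : y 0 i - x 0 i = (y 0 i - ratr q) - (x 0 i - ratr q) by ring.
  by apply: le_trans (ler_normB _ _) _; lra.
apply: countable_bigcupT_measurable; first exact: countableP.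
by move=> q; case: ifP => _; [exact: measurable_cube|exact: measurable0].
Qed.

Lemma closed_measurable_rV U : closed U -> measurable U.
Proof. by move=> /closed_openC/open_measurable_rV/measurableC; rewrite setCK. Qed.

Lemma continuous_measurable_rV U (f : 'rV[R]_n -> R) : open U ->
  (forall x, U x -> {for x, continuous f}) -> measurable_fun U f.
Proof.
move=> oU cf; apply: (measurability _ (RGenOInfty.measurableE R)).
move=> _ [_ [t ->] <-]; apply: open_measurable_rV.
rewrite openE => x [Ux /=]; rewrite in_itv /= andbT => tfx.
apply: filterI; first exact: open_nbhs_nbhs.
have tn : nbhs (f x) `]t, +oo[%classic.
  by apply: open_nbhs_nbhs; split; [exact: interval_open|rewrite /= in_itv/= tfx].
exact: (cf x Ux _ tn).
Qed.

End cubes.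

(** * Integration over R^n by slices, up to the divergence theorem *)

Section cons.
Context {R : realType} {n : nat}.

Lemma cons_rV_ord0 (t : R) (y : 'rV[R]_n) : cons_rV (t, y) 0 0 = t.
Proof. by have [] := cons_rVK (t, y). Qed.

Lemma cons_rV_lift (t : R) (y : 'rV[R]_n) i : cons_rV (t, y) 0 (lift ord0 i) = y 0 i.
Proof. by have [_ /rowP/(_ i)] := cons_rVK (t, y); rewrite mxE. Qed.

Definition tail_rV (x : 'rV[R]_n.+1) : 'rV[R]_n := (uncons_rV x).2.

Lemma cons_rV_cube (a : 'rV[R]_n.+1) (r t : R) y :
  cube a r (cons_rV (t, y)) <-> `|t - a 0 0| <= r /\ cube (tail_rV a) r y.
Proof.
split=> [h|[h0 h] i].
  split; first by have := h 0; rewrite cons_rV_ord0.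
  by move=> i; have := h (lift ord0 i); rewrite cons_rV_lift mxE.
have [j ->|->] := unliftP ord0 i; last by rewrite cons_rV_ord0.
by rewrite cons_rV_lift; have := h j; rewrite mxE.
Qed.

End cons.

Lemma lebesgue_rV_cube (R : realType) n (a : 'rV[R]_n) (r : R) : 0 <= r ->
  lebesgue_rV n (cube a r) = ((r *+ 2) ^+ n)%:E.
Proof.
elim: n a => [|n ih] a r0.
  by rewrite /= diracE expr0 mem_set// => -[].
rewrite /= /lebesgue_cons /pushforward.
have -> : cons_rV (n := n) @^-1` cube a r = `[a 0 0 - r, a 0 0 + r]%classic `*` cube (tail_rV a) r.
  apply/seteqP; split=> -[t y] /=.
    move=> /cons_rV_cube[h1 h2]; split=> //=; rewrite in_itv /=.
    by move: h1; rewrite ler_norml => /andP[h1 h3]; apply/andP; split; lra.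
  move=> [/= h1 h2]; apply/cons_rV_cube; split => //; move: h1; rewrite in_itv /= ler_norml.
  by move=> /andP[h1 h3]; apply/andP; split; lra.
rewrite product_measure1E//; last exact: measurable_cube.
have L : lebesgue_measure (`[a 0 0 - r, a 0 0 + r]%classic : set R) = (r *+ 2)%:E.
  rewrite lebesgue_measure_itv /= lte_fin.
  case: ltP => h; first by rewrite -EFinB; congr EFin; ring.
  have -> : r = 0 by lra.
  by rewrite mul0rn.
transitivity ((r *+ 2)%:E * lebesgue_rV n (cube (tail_rV a) r))%E.
  by congr (_ * _)%E; exact: L.
by rewrite ih// -EFinM exprS.
Qed.

Section support.
Context {R : realType} {n : nat}.
Implicit Types (f : 'rV[R]_n -> R) (K : set 'rV[R]_n).

Lemma continuous_compact_bounded K f : compact K ->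
  (forall x, K x -> {for x, continuous f}) ->
  exists2 C : R, 0 < C & forall x, K x -> `|f x| <= C.
Proof.
move=> cK cf; have : compact [set f x | x in K].
  by apply: continuous_compact => //; apply: continuous_in_subspaceT => x /[!inE] /cf.
move=> /compact_bounded[M [_ hM]]; exists (`|M| + 1) => [|x Kx]; first by rewrite ltr_wpDl.
by apply: (hM (`|M| + 1)); [rewrite (le_lt_trans (ler_norm _))// ltrDl|exists x].
Qed.

Lemma integrable_supp d (T : measurableType d) (mu : {measure set T -> \bar R})
    (A : set T) (f : T -> R) (C : R) : measurable A -> (mu A < +oo)%E ->
  measurable_fun setT f -> (forall x, ~ A x -> f x = 0) ->
  (forall x, A x -> `|f x| <= C) -> mu.-integrable setT (EFin \o f).
Proof.
move=> mA Aoo mf fA fC.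
have -> : EFin \o f = (EFin \o f) \_ A.
  apply/funext => x; rewrite patchE; case: ifPn => //; rewrite notin_setE => /fA.
  by rewrite /= => ->.
rewrite -integrable_mkcond//; apply: measurable_bounded_integrable => //.
  exact: measurable_funS mf.
exists C; split; first exact: num_real.
by move=> M CM x Ax; apply: le_trans (fC x Ax) (ltW CM).
Qed.

End support.

Section integral_line.
Context {R : realType}.

Lemma integral_derive_supp (h dh : R -> R) (M : R) :
  (forall t : R, is_derive t 1 h (dh t)) -> continuous dh ->
  (forall t, M < `|t| -> h t = 0) ->
  (\int[lebesgue_measure]_t (dh t)%:E = 0)%E.
Proof.
move=> hd cdh hM.
have dM (t : R) : `|M| < `|t| -> dh t = 0.
  move=> Mt; have : is_derive t 1 h 0.
    apply: near_eq_is_derive (is_derive_cst 0 _ _).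
    near=> s; apply/esym/hM; apply: le_lt_trans (ler_norm M) _.
    near: s; apply: (cvgr_gt `|t|) => //.
    exact: (@norm_continuous _ R^o t).
  by move=> [_ <-]; case: (hd t) => _ <-.
pose b : R := `|M| + 1.
have b0 : 0 < b by rewrite ltr_wpDl.
transitivity (\int[lebesgue_measure]_(t in `[(- b)%R, b]) (dh t)%:E)%E.
  rewrite [RHS]integral_mkcond; apply: eq_integral => t _.
  rewrite patchE; case: ifPn => //; rewrite notin_setE /= in_itv /= => tb.
  rewrite dM// ltNge; apply/negP => tM; apply: tb.
  by rewrite -ler_norml (le_trans tM)// lerDl.
have ch : continuous h by move=> t; apply/differentiable_continuous/derivable1_diffP; case: (hd t).
rewrite (@continuous_FTC2 _ dh h).
- rewrite !hM ?subee// ?normrN gtr0_norm// /b (le_lt_trans (ler_norm _))// ltrDl//.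
- by rewrite gtrN.
- by apply: continuous_subspaceT.
- split; first by move=> t _; case: (hd t).
  + by apply: cvg_at_right_filter; exact: ch.
  + by apply: cvg_at_left_filter; exact: ch.
- by move=> t _; rewrite derive1E; case: (hd t).
Unshelve. all: by end_near. Qed.

End integral_line.

Section integral_partial.
Context {R : realType}.

Lemma cons_rV_line0 n (s t : R) (y : 'rV[R]_n) :
  cons_rV (s + t, y) = s *: delta_mx 0 0 + cons_rV (t, y).
Proof.
apply/rowP => i; rewrite [RHS]mxE; have [j ->|->] := unliftP ord0 i.
  by rewrite !cons_rV_lift !mxE /= mulr0 add0r.
by rewrite !cons_rV_ord0 !mxE mulr1.
Qed.

Lemma cons_rV_line_lift n (s t : R) (y : 'rV[R]_n) j :
  cons_rV (t, s *: delta_mx 0 j + y) = s *: delta_mx 0 (lift ord0 j) + cons_rV (t, y).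
Proof.
apply/rowP => i; rewrite [RHS]mxE; have [k ->|->] := unliftP ord0 i.
  by rewrite !cons_rV_lift !mxE /= (inj_eq lift_inj).
by rewrite !cons_rV_ord0 !mxE /= mulr0 add0r.
Qed.

Lemma continuous_cons_rV n (z : R * 'rV[R]_n) : continuous_at z (@cons_rV R n).
Proof.
move=> U /nbhs_cubeP[r r0 rU].
have [t y] := (z.1, z.2).
exists (ball z.1 r, [set y | cube z.2 r y]) => /=.
  by split; [exact: nbhsx_ballx|apply/nbhs_cubeP; exists r].
move=> [s w] [/= h1 h2]; apply: rU => i; case: z h1 h2 => z1 z2 /= h1 h2.
have [k ->|->] := unliftP ord0 i; first by rewrite !cons_rV_lift.
by rewrite !cons_rV_ord0; move: h1; rewrite /ball/= distrC => /ltW.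
Qed.

Lemma Ck_slice n (F : 'rV[R]_n.+1 -> R) (t : R) : Ck 1 setT F ->
  (forall (j : 'I_n) (y : 'rV[R]_n), partial j (fun y => F (cons_rV (t, y))) y =
               partial (lift ord0 j) F (cons_rV (t, y))) /\
  Ck 1 setT (fun y : 'rV[R]_n => F (cons_rV (t, y))).
Proof.
move=> CF.
have d (j : 'I_n) (y : 'rV[R]_n) : is_derive y (delta_mx 0 j) (fun y => F (cons_rV (t, y)))
    (partial (lift ord0 j) F (cons_rV (t, y))).
  have -> : y = 0 *: delta_mx 0 j + y by rewrite scale0r add0r.
  apply/is_derive_line.
  under eq_fun do rewrite cons_rV_line_lift.
  apply/is_derive_line; rewrite cons_rV_line_lift !scale0r !add0r.
  exact: Ck_is_derive CF _.
have c (G : 'rV[R]_n.+1 -> R) y : {for cons_rV (t, y), continuous G} ->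
    {for y, continuous (fun y => G (cons_rV (t, y)))}.
  move=> cG; apply: (@continuous_comp _ _ _ (fun y => cons_rV (t, y)) G) => //.
  apply: (@continuous_comp _ _ _ (fun y => (t, y)) (@cons_rV R n)).
    have h1 : (fun _ : 'rV[R]_n => t) @ y --> t by exact: cst_continuous.
    have h2 : (fun y : 'rV[R]_n => y) @ y --> y by exact: cvg_id.
    exact: (cvg_pair h1 h2).
  exact: continuous_cons_rV.
split; first by move=> j y; exact: partialP.
apply: (@Ck_intro _ _ _ _ _ (fun j y => partial (lift ord0 j) F (cons_rV (t, y)))).
- exact: openT.
- by move=> y _; apply: c; exact: (Ck_continuous CF I).
- move=> j; split => // y _; apply: c.
  exact: (Ck_continuous (Ck_partial _ CF) I).
Qed.

Lemma partial_supp n (F : 'rV[R]_n -> R) (K : set 'rV[R]_n) i : closed K ->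
  (forall x, ~ K x -> F x = 0) -> forall x, ~ K x -> partial i F x = 0.
Proof.
move=> cK F0 x Kx; rewrite (@partial_ext _ _ (~` K) _ (fun=> 0))//.
- by apply: partialP; exact: is_derive_cst.
- exact: closed_openC.
Qed.

(** Fubini with induction on the dimension. A derivative in the first coordinate integrates to 0
    along each line by the fundamental theorem of calculus; a derivative in another coordinate is
    one of a slice, where the induction hypothesis applies. *)
Lemma integral_partial n (F : 'rV[R]_n -> R) (M : R) i : Ck 1 setT F ->
  (forall x, ~ cube 0 M x -> F x = 0) ->
  (\int[lebesgue_rV n]_x (partial i F x)%:E = 0)%E.
Proof.
elim: n F i => [|n ih] F i CF FM; first by case: i.
have CpF : Ck 0 setT (partial i F) by exact: Ck_partial.
have mpF : measurable_fun setT (partial i F).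
  by apply: continuous_measurable_rV openT _ => x _; exact: Ck_continuous CpF _.
have [C C0 pFC] : exists2 C : R, 0 < C & forall x, cube 0 M x -> `|partial i F x| <= C.
  apply: continuous_compact_bounded; first exact: cube_compact.
  by move=> x _; exact: Ck_continuous CpF _.
have pF0 := partial_supp i (@cube_closed _ _ 0 M) FM.
pose g (z : measurableTypeR R * 'rV[R]_n) := partial i F (cons_rV z).
have ig : (lebesgue_measure \x lebesgue_rV n)%E.-integrable setT (EFin \o g).
  apply: (@integrable_supp _ _ _ _ (cons_rV (n := n) @^-1` cube 0 M) _ C).
  - by rewrite -[X in measurable X]setTI; apply: measurable_cons_rV => //; exact: measurable_cube.
  (* The radius [M] is allowed to be negative; the cube is then empty. *)
  - have [M0|M0] := leP 0 M; first by have := lebesgue_rV_cube (0 : 'rV[R]_n.+1) M0;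
      rewrite /= /lebesgue_cons /pushforward => ->; exact: ltry.
    rewrite (_ : _ @^-1` _ = set0) ?measure0//.
    apply/seteqP; split => // z /= /(_ 0); rewrite leNgt => /negP; apply.
    exact: lt_le_trans M0 _.
  - exact: (measurableT_comp mpF (@measurable_cons_rV R n)).
  - by move=> z; exact: pF0.
  - by move=> z; exact: pFC.
have mE : measurable_fun setT (EFin \o partial i F) by exact/measurable_EFinP.
rewrite [LHS](integral_pushforward (@measurable_cons_rV R n) mE ig measurableT).
rewrite preimage_setT.
have [j ij|i0] := unliftP ord0 i.
  rewrite -(integral12_prod_meas1 ig); apply: integral0_eq => t _; rewrite /fubini_F.
  have [sl Csl] := Ck_slice t CF.
  transitivity (\int[lebesgue_rV n]_y (partial j (fun y => F (cons_rV (t, y))) y)%:E)%E.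
    by apply: eq_integral => y _; rewrite sl /= /g ij.
  apply: ih => // y yM; apply: FM => /cons_rV_cube[_]; apply: contra_not yM.
  by rewrite (_ : tail_rV 0 = 0)//; apply/rowP => k; rewrite !mxE.
rewrite -(integral21_prod_meas1 ig); apply: integral0_eq => y _; rewrite /fubini_G /g /= i0.
apply: (@integral_derive_supp _ (fun t => F (cons_rV (t, y))) _ M).
- move=> t; have := (@is_derive_line _ _ F (cons_rV (0, y)) (delta_mx 0 0) t
    (partial ord0 F (cons_rV (t, y)))).
  rewrite -cons_rV_line0 addr0 => -[+ _] => /(_ (Ck_is_derive _ CF I)).
  by under eq_fun do rewrite -cons_rV_line0 addr0.
- move=> t; apply: (@continuous_comp _ _ _ (fun t => cons_rV (t, y)) (partial ord0 F)); last first.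
    by rewrite -i0; exact: Ck_continuous CpF _.
  apply: (@continuous_comp _ _ _ (fun t => (t, y)) (@cons_rV R n)).
    have h1 : (fun _ : R => y) @ t --> y by exact: cst_continuous.
    have h2 : (fun t : R => t) @ t --> t by exact: cvg_id.
    exact: (cvg_pair h2 h1).
  exact: continuous_cons_rV.
- move=> t tM; apply: FM => /cons_rV_cube[+ _].
  by rewrite mxE subr0 leNgt tM.
Qed.

End integral_partial.

(** * The unit ball, its conformal factor and cutoff functions *)

Section ball.
Context {R : realType} {n : nat}.
Implicit Types (a x : 'rV[R]_n) (f g : 'rV[R]_n -> R) (K Om : set 'rV[R]_n) (r : R).

(** The squared Euclidean distance, a polynomial and hence smooth everywhere, unlike [enorm]. *)
Definition sqd a x : R := \sum_i (x 0 i - a 0 i) ^+ 2.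

Lemma sqd_ge0 a x : 0 <= sqd a x.
Proof. by apply: sumr_ge0 => i _; exact: sqr_ge0. Qed.

Lemma Ck_sqd k Om a : open Om -> Ck k Om (sqd a).
Proof.
move=> oOm; apply: Ck_sum => // i.
rewrite (_ : (fun x => _) = fun x => (x 0 i - a 0 i) * (x 0 i - a 0 i)).
  by apply: CkM => //; apply: CkB => //; by [exact: Ck_coord|exact: Ck_cst].
by apply/funext => x; rewrite expr2.
Qed.

Lemma is_derive_sqd a x i : is_derive x (delta_mx 0 i) (sqd a) (2 * (x 0 i - a 0 i)).
Proof.
rewrite (_ : sqd a = \sum_(j < n) fun x => (x 0 j - a 0 j) * (x 0 j - a 0 j)); last first.
  by apply/funext => y; rewrite fct_sumE; apply: eq_bigr => j _; rewrite expr2.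
have d j : is_derive x (delta_mx 0 i) (fun x : 'rV[R]_n => (x 0 j - a 0 j) * (x 0 j - a 0 j))
    ((i == j)%:R * 2 * (x 0 j - a 0 j)).
  have d1 : is_derive x (delta_mx 0 i) (fun x : 'rV[R]_n => x 0 j - a 0 j) ((i == j)%:R).
    apply: is_derive_eq.
      exact: (is_derive_add (is_derive_coord x (delta_mx 0 i) j) (is_derive_cst (- a 0 j) _ _)).
    by rewrite addr0 mxE /= eq_sym.
  apply: (is_derive_eq (is_derive_mul d1 d1)); ring.
apply: (is_derive_eq (is_derive_sum d)).
rewrite (bigD1 i)//= eqxx mul1r big1 ?addr0// => j ji.
by rewrite eq_sym (negbTE ji) !mul0r.
Qed.

Lemma is_derive_affine (c k d : R) f x (v : 'rV[R]_n) : is_derive x v f d ->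
  is_derive x v (fun y => c + k * f y) (k * d).
Proof.
move=> fd.
have d1 : is_derive x v (fun _ : 'rV[R]_n => c) 0 by exact: is_derive_cst.
have d2 : is_derive x v (fun _ : 'rV[R]_n => k) 0 by exact: is_derive_cst.
by apply: (is_derive_eq (is_derive_add d1 (is_derive_mul d2 fd))); ring.
Qed.

Lemma enorm_sqr x : enorm x ^+ 2 = sqd 0 x.
Proof.
rewrite /enorm sqr_sqrtr; last by apply: sumr_ge0 => i _; rewrite -expr2 sqr_ge0.
by apply: eq_bigr => i _; rewrite mxE subr0 expr2.
Qed.

Lemma rhoE x : rho x = (1 - sqd 0 x) / 2.
Proof. by rewrite /rho enorm_sqr. Qed.

Lemma hballE x : hball x <-> 0 < rho x.
Proof.

rewrite rhoE /hball /= -(@expr_lt1 _ 2)// ?sqrtr_ge0// enorm_sqr.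
by split=> h; [rewrite divr_gt0// subr_gt0|lra].
Qed.

Lemma Ck_rho k Om : open Om -> Ck k Om (@rho R n).
Proof.
move=> oOm; rewrite (_ : @rho R n = fun x => (1 - sqd 0 x) * 2^-1).
  apply: CkM => //; last exact: Ck_cst.
  by apply: CkB => //; [exact: Ck_cst|exact: Ck_sqd].
by apply/funext => x; exact: rhoE.
Qed.

Lemma is_derive_rho x i : is_derive x (delta_mx 0 i) (@rho R n) (- x 0 i).
Proof.
rewrite (_ : @rho R n = fun x => 2^-1 + (- 2^-1) * sqd 0 x); last first.
  by apply/funext => y; rewrite rhoE; field.
apply: (is_derive_eq (is_derive_affine _ _ (is_derive_sqd 0 x i))).
by rewrite mxE; field.
Qed.

Lemma hball_open : open (@hball R n).
Proof.
rewrite (_ : @hball R n = @rho R n @^-1` `]0, +oo[%classic); last first.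
  by apply/seteqP; split=> x hx; [move/hballE: hx|apply/hballE; move: hx]; rewrite /preimage /= in_itv /= andbT.
apply: open_comp; last exact: interval_open.
by move=> x _; exact: (Ck_continuous (Ck_rho 0 openT) I).
Qed.

Lemma measurable_hball : measurable (@hball R n).
Proof. exact: (open_measurable_rV hball_open). Qed.

Lemma hball_subset_cube : @hball R n `<=` cube 0 1.
Proof.
move=> x /hballE; rewrite rhoE => h i; rewrite mxE subr0.
rewrite -(@expr_le1 _ 2)// real_normK ?num_real//.
have : sqd 0 x < 1 by lra.
rewrite /sqd (bigD1 i)//= mxE subr0 => h1.
have : 0 <= \sum_(j < n | j != i) (x 0 j - (0 : 'rV[R]_n) 0 j) ^+ 2.
  by apply: sumr_ge0 => j _; exact: sqr_ge0.
by move=> h2; lra.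
Qed.

Lemma Ck_rho_powR k (s : R) : Ck k (@hball R n) (fun x => rho x `^ s).
Proof.
rewrite (_ : (fun x => _) = fun x => powR_seq s 0 (rho x)); last by rewrite powR_seq0.
apply: (Ck_comp _ hball_open (powR_seqP s)).
  by move=> x /hballE.
exact/Ck_rho/hball_open.
Qed.

Lemma is_derive_rho_powR (s : R) x (i : 'I_n) : hball x ->
  is_derive x (delta_mx 0 i) (fun x => rho x `^ s) (- s * rho x `^ (s - 1) * x 0 i).
Proof.
move=> /hballE x0; apply: (is_derive_eq
  (is_derive_compr (is_derive1_powR s x0) (is_derive_rho x i))).
ring.
Qed.

Lemma Ck_glue k Om K f : open Om -> closed K -> K `<=` Om -> Ck k Om f ->
  (forall x, ~ K x -> f x = 0) -> Ck k setT f.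
Proof.
move=> oOm cK KOm Cf f0.
rewrite (_ : setT = Om `|` ~` K); last first.
  by apply/seteqP; split => // x _; have [/KOm|] := pselect (K x); [left|right].
apply: CkU => //; apply: (@Ck_ext _ _ _ _ (fun=> 0)).
- exact: closed_openC.
- by move=> x /f0.
- exact: Ck_cst.
Qed.

Lemma test_function_glue Om K f : open Om -> compact K -> K `<=` Om ->
  (forall k, Ck k Om f) -> (forall x, ~ K x -> f x = 0) -> test_function Om f.
Proof.
move=> oOm cK KOm Cf f0.
have clK : closed K by apply: compact_closed cK; exact: norm_hausdorff.
have sub : closure [set x | f x != 0] `<=` K.
  rewrite [X in _ `<=` X](closure_id _).1//; apply: closure_subset => x /= fx.
  by apply: contrapT => /f0 /eqP; rewrite (negbTE fx).
split.
- by move=> k; exact: (Ck_glue oOm clK KOm (Cf k) f0).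
- by apply: subclosed_compact cK sub; exact: closed_closure.
- exact: subset_trans sub KOm.
Qed.

Lemma test_function_supp Om phi : test_function Om phi ->
  exists K, [/\ compact K, closed K, K `<=` Om, (forall x, ~ K x -> phi x = 0)
    & forall i x, ~ K x -> partial i phi x = 0].
Proof.
move=> [Cp cK KOm]; exists (closure [set x | phi x != 0]).
have p0 x : ~ closure [set x | phi x != 0] x -> phi x = 0.
  by move=> Kx; apply: contrapT => /eqP px; apply: Kx; exact: subset_closure.
split => //; first exact: closed_closure.
by move=> i x; apply: partial_supp => //; exact: closed_closure.
Qed.

End ball.

Section ball_bump.
Context {R : realType} {n : nat}.
Implicit Types (a x : 'rV[R]_n) (r : R).

Definition ball_bump a r x : R := theta (1 - sqd a x / r ^+ 2).

Lemma ball_bump_ge0 a r x : 0 <= ball_bump a r x.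
Proof. exact: theta_ge0. Qed.

Lemma ball_bump_le1 a r x : ball_bump a r x <= 1.
Proof. exact: theta_le1. Qed.

Lemma sqd_gt a r x : 0 < r -> ~ cube a r x -> r ^+ 2 < sqd a x.
Proof.
move=> r0 /existsNP[i /negP]; rewrite -ltNge => h.
rewrite /sqd (bigD1 i)//=; apply: (@lt_le_trans _ _ ((x 0 i - a 0 i) ^+ 2)).
  by rewrite -(real_normK (num_real (x 0 i - a 0 i))) ltr_pXn2r ?nnegrE ?normr_ge0 ?(ltW r0).
by rewrite lerDl; apply: sumr_ge0 => j _; exact: sqr_ge0.
Qed.

Lemma ball_bump_eq0 a r x : 0 < r -> ~ cube a r x -> ball_bump a r x = 0.
Proof.
move=> r0 /(sqd_gt r0) h; apply: theta_eq0.
by rewrite subr_le0 ler_pdivlMr ?exprn_gt0// mul1r ltW.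
Qed.

(** On this smaller cube the squared distance is at most n (r / (2(n+1)))^2, hence at most r^2 / 2.
    Using n+1 instead of n keeps the radius meaningful in dimension 0. *)
Lemma ball_bump_ge a r x : 0 < r -> cube a (r / (2 * n.+1%:R)) x -> theta 2^-1 <= ball_bump a r x.
Proof.
move=> r0 h; apply: theta_homo.
suff : sqd a x / r ^+ 2 <= 2^-1 by lra.
rewrite ler_pdivrMr ?exprn_gt0//.
apply: (@le_trans _ _ (\sum_(i < n) (r / (2 * n.+1%:R)) ^+ 2)).
  apply: ler_sum => i _; rewrite -(real_normK (num_real (x 0 i - a 0 i))).
  by rewrite lerXn2r// ?nnegrE// ?h// ltW// divr_gt0// mulr_gt0.
rewrite sumr_const card_ord -[_ *+ n]mulr_natl.
set N : R := n.+1%:R.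
have N1 : 1 <= N by rewrite ler1n.
have nN : n%:R <= N by rewrite ler_nat.
have r2 : 0 < r ^+ 2 by rewrite exprn_gt0.
have -> : n%:R * (r / (2 * N)) ^+ 2 = (n%:R / N ^+ 2) * (r ^+ 2 / 4).
  by field; rewrite gt_eqF// (lt_le_trans ltr01).
have h1 : n%:R / N ^+ 2 <= 1.
  rewrite ler_pdivrMr ?exprn_gt0 ?(lt_le_trans ltr01)// mul1r (le_trans nN)// expr2.
  by rewrite ler_peMr// (le_trans ler01).
by apply: le_trans (_ : 1 * (r ^+ 2 / 4) <= _); [rewrite ler_wpM2r// divr_ge0// ltW|lra].
Qed.

Lemma Ck_bump k a r : Ck k setT (ball_bump a r).
Proof.
apply: (@Ck_comp _ _ _ _ setT (@theta_seq R) 0) => //; first exact: openT.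
  exact: theta_seqP.
apply: CkB; [exact: openT|exact: Ck_cst|].
by apply: CkM; [exact: openT|exact/Ck_sqd/openT|exact: Ck_cst].
Qed.

Lemma ball_bump_test a r : 0 < r -> cube a r `<=` @hball R n -> test_function (@hball R n) (ball_bump a r).
Proof.
move=> r0 sub; apply: (@test_function_glue _ _ _ (cube a r)) => //.
- exact: hball_open.
- exact: cube_compact.
- by move=> k; apply: Ck_subset (@Ck_bump k a r).
- by move=> x; exact: ball_bump_eq0.
Qed.

(** [C] is uniform in centre and radius: the inner function has slope at most 2/r on the cube, and
    [dtheta] is bounded. *)
Lemma partial_bump_le : exists2 C : R, 0 < C & forall a r x i, 0 < r ->
  `|partial i (ball_bump a r) x| <= C / r.
Proof.
have [C C0 hC] := @dtheta_bounded R.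
exists (2 * C) => [|a r x i r0]; first by rewrite mulr_gt0.
have [hx|hx] := pselect (cube a r x); last first.
  rewrite (@partial_supp _ _ _ (cube a r)) ?normr0 ?divr_ge0 ?mulr_ge0 ?ltW//.
    exact: cube_closed.
  by move=> y; exact: ball_bump_eq0.
have d1 : is_derive x (delta_mx 0 i) (fun x => 1 - sqd a x / r ^+ 2)
    (- (2 * (x 0 i - a 0 i)) / r ^+ 2).
  rewrite (_ : (fun x => _) = fun x => 1 + (- r ^- 2) * sqd a x).
    apply: (is_derive_eq (is_derive_affine _ _ (is_derive_sqd a x i))); ring.
  by apply/funext => y; ring.
have r2 : 0 < r ^+ 2 by rewrite exprn_gt0.
rewrite (partialP (is_derive_compr (@theta_seqP R 0 _ I) d1)) normrM.
rewrite (ger0_norm (dtheta_ge0 _)) mulNr normrN normrM normfV (gtr0_norm r2) normrM gtr0_norm//.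
have -> : 2 * C / r = C * (2 * r / r ^+ 2) by field; rewrite gt_eqF.
apply: ler_pM; [exact: dtheta_ge0| |exact: hC|].
  by rewrite !mulr_ge0// invr_ge0 ltW.
by rewrite ler_pM2r ?invr_gt0// ler_pM2l//; exact: hx.
Qed.

End ball_bump.

(** * Real-valued integration over the ball *)

Section ball_integral.
Context {R : realType} {n : nat}.
Implicit Types (a x : 'rV[R]_n) (f g h : 'rV[R]_n -> R) (K : set 'rV[R]_n) (r : R).

Definition bint f := (lebesgue_rV n).-integrable (@hball R n) (EFin \o f).

(** An infinite integral is read as 0 here, so linearity and monotonicity are stated together with
    [bint]. *)
Definition bI f : R := \int[lebesgue_rV n]_(x in @hball R n) f x.

Let mB := @measurable_hball R n.

Lemma bintD f g : bint f -> bint g -> bint (fun x => f x + g x).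
Proof. by move=> hf hg; have := integrableD mB hf hg. Qed.

Lemma bintZ (c : R) f : bint f -> bint (fun x => c * f x).
Proof. by move=> hf; have := integrableZl mB c hf. Qed.

Lemma bintN f : bint f -> bint (fun x => - f x).
Proof. by move=> hf; have := integrableN hf. Qed.

Lemma bintB f g : bint f -> bint g -> bint (fun x => f x - g x).
Proof. by move=> hf hg; apply: bintD => //; exact: bintN. Qed.

Lemma bint0 : bint (fun=> 0).
Proof. exact: integrable0. Qed.

Lemma bint_sum (I : Type) (s : seq I) (F : I -> 'rV[R]_n -> R) :
  (forall i, bint (F i)) -> bint (fun x => \sum_(i <- s) F i x).
Proof.
move=> hF; elim: s => [|i s ih].
  by rewrite (_ : (fun x => _) = fun=> 0); [exact: bint0|apply/funext => x; rewrite big_nil].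
rewrite (_ : (fun x => _) = fun x => F i x + \sum_(j <- s) F j x); first exact: bintD.
by apply/funext => x; rewrite big_cons.
Qed.

Lemma eq_bint f g : (forall x, hball x -> f x = g x) -> bint f -> bint g.
Proof.
move=> fg; apply: eq_integrable => // x /[!inE] hx.
by rewrite /= fg.
Qed.

Lemma bint_measurable f : bint f -> measurable_fun (@hball R n) f.
Proof. by move=> /measurable_int/measurable_EFinP. Qed.

Lemma le_bint f g : measurable_fun (@hball R n) f -> bint g ->
  (forall x, hball x -> `|f x| <= g x) -> bint f.
Proof.
move=> mf ig fg; apply: le_integrable ig => //; first exact/measurable_EFinP.
by move=> x hx; rewrite /= lee_fin (le_trans (fg x hx))// ler_norm.
Qed.

Lemma bI_ext f g : (forall x, hball x -> f x = g x) -> bI f = bI g.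
Proof. by move=> fg; apply: eq_Rintegral => x /[!inE]; exact: fg. Qed.

Lemma bID f g : bint f -> bint g -> bI (fun x => f x + g x) = bI f + bI g.
Proof. by move=> hf hg; rewrite /bI RintegralD. Qed.

Lemma bIZ (c : R) f : bint f -> bI (fun x => c * f x) = c * bI f.
Proof. by move=> hf; rewrite /bI RintegralZl. Qed.

Lemma bIN f : bint f -> bI (fun x => - f x) = - bI f.
Proof.
by move=> hf; rewrite -[RHS]mulN1r -bIZ//; apply: bI_ext => x _; rewrite mulN1r.
Qed.

Lemma bIB f g : bint f -> bint g -> bI (fun x => f x - g x) = bI f - bI g.
Proof. by move=> hf hg; rewrite bID ?bIN//; exact: bintN. Qed.

Lemma bI0 f : (forall x, hball x -> f x = 0) -> bI f = 0.
Proof. by move=> f0; rewrite /bI /Rintegral integral0_eq// => x hx; rewrite f0. Qed.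

Lemma bI_sum (I : Type) (s : seq I) (F : I -> 'rV[R]_n -> R) :
  (forall i, bint (F i)) -> bI (fun x => \sum_(i <- s) F i x) = \sum_(i <- s) bI (F i).
Proof.
move=> hF; elim: s => [|i s ih].
  by rewrite big_nil; apply: bI0 => x _; rewrite big_nil.
rewrite big_cons -ih -bID//; last exact: bint_sum.
by apply: bI_ext => x _; rewrite big_cons.
Qed.

Lemma le_bI f g : bint f -> bint g -> (forall x, hball x -> f x <= g x) -> bI f <= bI g.
Proof. by move=> hf hg fg; apply: le_Rintegral. Qed.

Lemma bI_ge0 f : (forall x, hball x -> 0 <= f x) -> 0 <= bI f.
Proof. by move=> f0; apply: Rintegral_ge0. Qed.

Lemma bint_restrict K f : measurable K -> K `<=` @hball R n ->
  (lebesgue_rV n).-integrable K (EFin \o f) -> (forall x, ~ K x -> f x = 0) -> bint f.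
Proof.
move=> mK KB iK f0.
have : (lebesgue_rV n).-integrable setT ((EFin \o f) \_ K) by rewrite -integrable_mkcond.
move=> /(@integrableS _ _ _ _ setT (@hball R n) _ measurableT mB) h.
have {h} h := h (@subsetT _ _); apply: eq_integrable h => // x _.
rewrite patchE; case: ifPn => //; rewrite notin_setE => /f0 /= ->.
by [].
Qed.

Lemma compact_measurable K : compact K -> measurable K.
Proof. by move=> cK; apply: closed_measurable_rV; apply: compact_closed cK; exact: norm_hausdorff. Qed.

Lemma compact_fin K : compact K -> (lebesgue_rV n K < +oo)%E.
Proof.
move=> cK; have [r r0 Kr] := compact_subset_cube cK.
apply: (@le_lt_trans _ _ (lebesgue_rV n (cube 0 r))).
  by apply: le_measure; rewrite ?inE//; [exact: compact_measurable|exact: measurable_cube].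
by rewrite lebesgue_rV_cube ?ltry// ltW.
Qed.

Lemma bint_compact K f : compact K -> K `<=` @hball R n ->
  (forall x, hball x -> {for x, continuous f}) -> (forall x, ~ K x -> f x = 0) -> bint f.
Proof.
move=> cK KB cf f0; apply: (bint_restrict _ KB) => //; first exact: compact_measurable.
have [C C0 hC] : exists2 C : R, 0 < C & forall x, K x -> `|f x| <= C.
  by apply: continuous_compact_bounded => // x /KB; exact: cf.
apply: measurable_bounded_integrable.
- exact: compact_measurable.
- exact: compact_fin.
- by apply: measurable_funS KB _ => //; exact: continuous_measurable_rV hball_open cf.
- exists C; split; first exact: num_real.
  by move=> M CM x Kx; apply: le_trans (hC x Kx) (ltW CM).
Qed.

Lemma bint_loc_mul K f g : compact K -> K `<=` @hball R n -> loc_integrable (@hball R n) f ->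
  (forall x, hball x -> {for x, continuous g}) -> (forall x, ~ K x -> g x = 0) ->
  bint (fun x => f x * g x).
Proof.
move=> cK KB [mf lf] cg g0.
apply: (bint_restrict _ KB); first exact: compact_measurable; last first.
  by move=> x /g0 ->; rewrite mulr0.
have [C C0 hC] : exists2 C : R, 0 < C & forall x, K x -> `|g x| <= C.
  by apply: continuous_compact_bounded => // x /KB; exact: cg.
apply: (@integrableMl _ _ _ _ _ (compact_measurable cK) (EFin \o f) g).
- exact: lf.
- by apply: measurable_funS KB _ => //; exact: continuous_measurable_rV hball_open cg.
- exists C; split; first exact: num_real.
  by move=> M CM x Kx; apply: le_trans (hC x Kx) (ltW CM).
Qed.

Lemma loc_integrable_continuous f : (forall x, hball x -> {for x, continuous f}) ->
  loc_integrable (@hball R n) f.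
Proof.
move=> cf; have mf := continuous_measurable_rV hball_open cf.
split => // K cK KB.
have [C C0 hC] : exists2 C : R, 0 < C & forall x, K x -> `|f x| <= C.
  by apply: continuous_compact_bounded => // x /KB; exact: cf.
apply: measurable_bounded_integrable.
- exact: compact_measurable.
- exact: compact_fin.
- exact: measurable_funS KB mf.
- exists C; split; first exact: num_real.
  by move=> M CM x Kx; apply: le_trans (hC x Kx) (ltW CM).
Qed.

(** Vanishing off [K] makes f of class C^1 on the whole space, where [integral_partial] applies. *)
Lemma bI_partial K f i : compact K -> K `<=` @hball R n -> Ck 1 (@hball R n) f ->
  (forall x, ~ K x -> f x = 0) -> bI (partial i f) = 0.
Proof.
move=> cK KB Cf f0.
have clK : closed K by apply: compact_closed cK; exact: norm_hausdorff.
have CT := Ck_glue hball_open clK KB Cf f0.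
have [r r0 Kr] := compact_subset_cube cK.
have := integral_partial i CT (fun x xr => f0 x (contra_not (Kr x) xr)).
rewrite /bI Rintegral_mkcond /Rintegral => h; rewrite -[RHS]/(fine 0%E) -[in RHS]h.
congr fine; apply: eq_integral => x _; rewrite patchE.
case: ifPn => //; rewrite notin_setE => hx.
by rewrite (partial_supp i clK f0)// => /KB.
Qed.

Lemma bint_indic_cube (a : 'rV[R]_n) r : cube a r `<=` @hball R n -> bint \1_(cube a r).
Proof.
move=> rB; apply: (bint_restrict (@measurable_cube _ _ a r) rB).
  apply: measurable_bounded_integrable; first exact: measurable_cube.
  - exact/compact_fin/cube_compact.
  - exact: measurable_indic (measurable_cube a r).
  - exists 1; split; first exact: num_real.
    move=> M M1 x _; rewrite /= /indic; case: (_ \in _) => /=; rewrite ?normr1 ?normr0; lra.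
by move=> x xa; rewrite indicE memNset.
Qed.

Lemma bI_indic_cube (a : 'rV[R]_n) r : 0 <= r -> cube a r `<=` @hball R n ->
  bI \1_(cube a r) = (r *+ 2) ^+ n.
Proof.
move=> r0 rB; rewrite /bI /Rintegral integral_indic//; last exact: measurable_cube.
rewrite setIidl//; transitivity (fine (lebesgue_rV n (cube a r))) => //.
by rewrite lebesgue_rV_cube.
Qed.

Lemma bI_cube_ge (a : 'rV[R]_n) r (c : R) f : 0 < r -> cube a r `<=` @hball R n ->
  bint f -> (forall x, hball x -> 0 <= f x) -> (forall x, cube a r x -> c <= f x) ->
  c * (r *+ 2) ^+ n <= bI f.
Proof.
move=> r0 rB fi f0 fc; have i1 := bint_indic_cube rB.
rewrite -(bI_indic_cube (ltW r0) rB) -bIZ//.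
apply: le_bI => //; first exact: bintZ.
move=> x hx; rewrite indicE.
have [xa|xa] := pselect (cube a r x); first by rewrite mem_set// mulr1 fc.
by rewrite memNset// mulr0 f0.
Qed.

(** If f were positive at x, it would exceed f(x)/2 on a cube, and a bump supported there would have
    a positive integral against f. The negative case is the same for -f. *)
Lemma fundamental_lemma f : (forall x, hball x -> {for x, continuous f}) ->
  (forall phi, test_function (@hball R n) phi -> bI (fun x => f x * phi x) = 0) ->
  forall x, hball x -> f x = 0.
Proof.
suff H g : (forall x, hball x -> {for x, continuous g}) ->
    (forall phi, test_function (@hball R n) phi -> bI (fun x => g x * phi x) = 0) ->
    forall x, hball x -> g x <= 0.
  move=> cf hf x hx; apply: le_anti; rewrite H//= -oppr_le0.
  apply: (H (fun x => - f x)) => // [y hy|phi tphi].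
    exact: (cvgN (cf y hy)).
  have [K [cK _ KB p0 _]] := test_function_supp tphi.
  rewrite (@bI_ext _ (fun x => - (f x * phi x))); last by move=> y _; rewrite mulNr.
  rewrite bIN ?hf ?oppr0//; apply: (bint_loc_mul cK KB) => //.
    exact: loc_integrable_continuous.
  by move=> y hy; have [Cp _ _] := tphi; exact: (Ck_continuous (Cp 0%N) I).
move=> cg hg x hx; rewrite leNgt; apply/negP => gx.
have [s s0 sg] : exists2 s : R, 0 < s & cube x s `<=` [set y | hball y /\ g x / 2 < g y].
  apply/nbhs_cubeP; apply: filterI; first by apply: open_nbhs_nbhs; split; [exact: hball_open|].
  have h2 : g x / 2 < g x by rewrite ltr_pdivrMr// ltr_pMr// ltr1n.
  exact: (cvgr_gt _ (cg x hx) _ h2).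
have sB : cube x s `<=` @hball R n by move=> y /sg[].
have := hg _ (ball_bump_test s0 sB).
set t := s / (2 * n.+1%:R).
have t0 : 0 < t by rewrite divr_gt0 // mulr_gt0.
have ts : t <= s.
  rewrite ler_pdivrMr ?mulr_gt0// ler_peMr ?ltW//.
  have : (1 : R) <= n.+1%:R by rewrite ler1n.
  lra.
have : 0 < g x / 2 * theta 2^-1 * (t *+ 2) ^+ n.
  by rewrite !mulr_gt0 ?theta_gt0// exprn_gt0// pmulrn_lgt0.
move=> p0 e0; move: p0; apply/negP; rewrite -leNgt -e0.
apply: (@bI_cube_ge x) => //.
- by move=> y /(le_cube ts); exact: sB.
- apply: (bint_loc_mul (@cube_compact _ _ x s) sB).
  + exact: loc_integrable_continuous.
  + by move=> y hy; exact: (Ck_continuous (Ck_bump 0 x s) I).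
  + by move=> y; exact: ball_bump_eq0.
- move=> y _; have [ys|ys] := pselect (cube x s y); last by rewrite ball_bump_eq0// mulr0.
  by have [_ gy] := sg _ ys; rewrite mulr_ge0 ?ball_bump_ge0// (le_trans _ (ltW gy))// divr_ge0// ltW.
- move=> y yt; have [_ gy] := sg _ (le_cube ts yt).
  by apply: ler_pM; [rewrite divr_ge0// ltW|exact: theta_ge0|exact: ltW|exact: ball_bump_ge].
Qed.

End ball_integral.

Section powR_facts.
Context {R : realType}.

Lemma powR_add (x r s : R) : 0 < x -> x `^ (r + s) = x `^ r * x `^ s.
Proof. by move=> x0; rewrite powRD// (gt_eqF x0) /= implybT. Qed.

Lemma continuous_norm_powR (q : R) : 0 < q -> continuous (fun t : R => `|t| `^ q).
Proof.
move=> q0 t; have [->|t0] := eqVneq t 0.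
  rewrite /continuous_at normr0 powR0 ?gt_eqF//.
  apply/cvgr0Pnorm_le => e e0.
  have e1 : 0 < e `^ q^-1 by rewrite powR_gt0.
  near=> s; have hs : `|s| <= e `^ q^-1 by near: s; exact: (@nbhs0_le R R _ e1).
  rewrite ger0_norm ?powR_ge0//.
  apply: le_trans (_ : (e `^ q^-1) `^ q <= e); last first.
    by rewrite -powRrM mulVf ?gt_eqF// powRr1// ltW.
  by rewrite ge0_ler_powR ?nnegrE ?powR_ge0 ?normr_ge0 ?(ltW q0).
apply: (@continuous_comp _ _ _ (fun s : R => `|s|) (fun s => s `^ q)).
  exact: (@norm_continuous _ R^o t).
have nt : 0 < `|t| by rewrite normr_gt0.
by apply/differentiable_continuous/derivable1_diffP; case: (is_derive1_powR q nt).
Unshelve. all: by end_near. Qed.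

End powR_facts.

(** * The equation in weak, pointwise and conformally changed form *)

Section pde.
Context {R : realType} {n : nat}.
Implicit Types (a x : 'rV[R]_n) (f u phi : 'rV[R]_n -> R).

(* The conformal factor in front of the Dirichlet energy: rho^2 rho^-n. *)
Definition kap x : R := rho x `^ (2 - n%:R).

Lemma kapE x : hball x -> kap x = rho x ^+ 2 * rho x ^- n.
Proof.
move=> /hballE x0; rewrite /kap powR_add// powR_invn ?ltW//.
by rewrite (powR_mulrn 2) ?ltW.
Qed.

Lemma Ck_kap k : Ck k (@hball R n) kap.
Proof. exact: Ck_rho_powR. Qed.

(** This is rho^-n times the Laplace-Beltrami operator of the ball. *)
Definition divkap f x : R := \sum_i partial i (fun y => kap y * partial i f y) x.

(** Each [kap * partial i phi] is again a test function, since the singularity of [kap] at the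
    boundary is off its support. Inserting it in the definition of the weak gradient and summing
    over i eliminates [g]. *)
Lemma weak_kap u g phi : weak_gradient (@hball R n) u g -> test_function (@hball R n) phi ->
  (forall x, hball x -> {for x, continuous u}) ->
  let F := fun x => hgrad_dot x (g x) (grad phi x) * rho x ^- n in
  [/\ bint F, bint (fun x => u x * divkap phi x) & bI F = - bI (fun x => u x * divkap phi x)].
Proof.
move=> [lu lg wg] tphi cu F; have [K [cK clK KB p0 dp0]] := test_function_supp tphi.
have [Cp _ _] := tphi.
have Cpsi k i : Ck k (@hball R n) (fun x => kap x * partial i phi x).
  apply: CkM; [exact: hball_open|exact: Ck_kap|].
  by apply: Ck_partial; apply: Ck_subset (Cp k.+1).
have tpsi i : test_function (@hball R n) (fun x => kap x * partial i phi x).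
  apply: (test_function_glue hball_open cK KB) => // x /dp0 ->; exact: mulr0.
have FE x : hball x -> \sum_i g x 0 i * (kap x * partial i phi x) = F x.
  move=> hx; rewrite /F /hgrad_dot /edot mulrAC -kapE// mulr_sumr.
  by apply: eq_bigr => i _; rewrite mxE; ring.
have i1 i : bint (fun x => g x 0 i * (kap x * partial i phi x)).
  apply: (bint_loc_mul cK KB) => //; last by move=> x /dp0 ->; exact: mulr0.
  by move=> x; exact: (Ck_continuous (Cpsi 0%N i)).
have i2 i : bint (fun x => u x * partial i (fun x => kap x * partial i phi x) x).
  apply: (bint_loc_mul cK KB) => //.
    by move=> x; exact: (Ck_continuous (Ck_partial _ (Cpsi 1%N i))).
  move=> x; apply: partial_supp => // y /dp0 ->; exact: mulr0.
have i2' : bint (fun x => u x * divkap phi x).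
  apply: eq_bint (bint_sum (index_enum _) i2) => x _.
  by rewrite /divkap mulr_sumr.
split => //; first by apply: eq_bint (bint_sum (index_enum _) i1) => x hx; exact: FE.
rewrite -(bI_ext FE) bI_sum//.
transitivity (- \sum_i bI (fun x => u x * partial i (fun x => kap x * partial i phi x) x)).
  rewrite -sumrN; apply: eq_bigr => i _.
  have := wg _ (tpsi i) i; rewrite /bI /Rintegral => ->.
  by rewrite fineN opprK.
congr (- _); rewrite -bI_sum//; apply: bI_ext => x _.
by rewrite /divkap mulr_sumr.
Qed.

(** Green's second identity, for a compactly supported flux. *)
Lemma divkap_sym u phi : Ck 2 (@hball R n) u -> test_function (@hball R n) phi ->
  bI (fun x => u x * divkap phi x) = bI (fun x => divkap u x * phi x).
Proof.
move=> Cu tphi; have [K [cK clK KB p0 dp0]] := test_function_supp tphi.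
have [Cp _ _] := tphi; have oB := @hball_open R n.
have CpB k : Ck k (@hball R n) phi by apply: Ck_subset (Cp k).
have Ckp i : Ck 1 (@hball R n) (fun x => kap x * partial i phi x).
  by apply: CkM => //; [exact: Ck_kap|apply: Ck_partial; exact: CpB].
have Cku i : Ck 1 (@hball R n) (fun x => kap x * partial i u x).
  by apply: CkM => //; [exact: Ck_kap|apply: Ck_partial].
have Cu1 := CkW Cu.
(* In the divergence of this flux the products of first derivatives of u and phi cancel. *)
pose G i x := u x * (kap x * partial i phi x) + - (phi x * (kap x * partial i u x)).
have CG i : Ck 1 (@hball R n) (G i).
  exact: (CkD oB (CkM oB Cu1 (Ckp i)) (CkN oB (CkM oB (CpB 1%N) (Cku i)))).
have G0 i x : ~ K x -> G i x = 0.
  by move=> Kx; rewrite /G dp0// p0// !(mulr0, mul0r) oppr0 addr0.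
have alg (a b c d e f g : R) : a * b + (c * d) * e - (f * g + (c * e) * d) = a * b - f * g by ring.
have dG x i : hball x -> partial i (G i) x =
    u x * partial i (fun y => kap y * partial i phi y) x -
    phi x * partial i (fun y => kap y * partial i u y) x.
  move=> hx; apply: partialP.
  apply: is_derive_eq.
    apply: is_derive_add.
      exact: (is_derive_mul (Ck_is_derive i Cu1 hx) (Ck_is_derive i (Ckp i) hx)).
    apply: is_deriveN.
    exact: (is_derive_mul (Ck_is_derive i (CpB 1%N) hx) (Ck_is_derive i (Cku i) hx)).
  exact: alg.
have i1 : bint (fun x => u x * divkap phi x).
  apply: (bint_loc_mul cK KB).
  - apply: loc_integrable_continuous => x; exact: (Ck_continuous Cu).
  - move=> x hx; apply: (Ck_continuous (k := 0) (Om := hball (n := n))) hx.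
    apply: Ck_sum => // i.
    exact: (Ck_partial i (Ckp i)).
  - move=> x Kx; apply: big1 => i _.
    by apply: (partial_supp i clK) Kx => y /dp0 ->; exact: mulr0.
have i2 : bint (fun x => divkap u x * phi x).
  apply: (bint_loc_mul cK KB) => //.
  - apply: loc_integrable_continuous => x hx; apply: (Ck_continuous (k := 0) (Om := hball (n := n))) hx.
    by apply: Ck_sum => // i; exact: (Ck_partial i (Cku i)).
  - by move=> x _; exact: (Ck_continuous (Cp 0%N)).
apply/eqP; rewrite -subr_eq0 -bIB//; apply/eqP.
rewrite (@bI_ext _ _ _ (fun x => \sum_i partial i (G i) x)); last first.
  move=> x hx; rewrite /divkap mulr_sumr mulr_suml -sumrB.
  by apply: eq_bigr => i _; rewrite dG// [X in _ - X]mulrC.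
rewrite bI_sum; first by apply: big1 => i _; exact: (bI_partial i cK KB (CG i) (@G0 i)).
move=> i; apply: (bint_compact cK KB).
  by move=> x; exact: (Ck_continuous (Ck_partial _ (CG i))).
by apply: partial_supp => // x; exact: G0.
Qed.

Section solution.
Variables (lambda p : R) (u : 'rV[R]_n -> R).
Hypotheses (p1 : 1 < p) (uC2 : Ck 2 (@hball R n) u) (usol : weak_solution lambda p u).

Let cu x : hball x -> {for x, continuous u}. Proof. exact: (Ck_continuous uC2). Qed.

Lemma continuous_norm_u_powR x : hball x -> {for x, continuous (fun x => `|u x| `^ (p - 1))}.
Proof.
move=> hx; apply: (@continuous_comp _ _ _ u (fun t => `|t| `^ (p - 1))); first exact: cu.
by apply: continuous_norm_powR; rewrite subr_gt0.
Qed.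

Lemma continuous_rhoN x : hball x -> {for x, continuous (fun x : 'rV[R]_n => rho x ^- n)}.
Proof.
move=> hx; have := Ck_continuous (Ck_rho_powR 0 (- n%:R)) hx.
apply: near_eq_continuous.
near=> y; rewrite powR_invn// ltW//; apply/hballE; near: y.
by apply: open_nbhs_nbhs; split; [exact: hball_open|].
Unshelve. all: by end_near. Qed.

(* Since the weak gradient enters only through [weak_kap], any weak gradient can be used. *)
Lemma weak_form g phi : weak_gradient (@hball R n) u g -> test_function (@hball R n) phi ->
  bI (fun x => `|u x| `^ (p - 1) * u x * phi x * rho x ^- n) =
  bI (fun x => hgrad_dot x (g x) (grad phi x) * rho x ^- n) -
  lambda * bI (fun x => u x * phi x * rho x ^- n).
Proof.
move=> wg tphi; have [g1 [wg1 sol]] := usol.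
have [K [cK clK KB p0 dp0]] := test_function_supp tphi.
have [i1 _ e1] := weak_kap wg1 tphi cu; have [i2 _ e2] := weak_kap wg tphi cu.
rewrite e2 -e1.
transitivity (bI (fun x => (hgrad_dot x (g1 x) (grad phi x) - lambda * u x * phi x) * rho x ^- n)).
  exact: (esym (congr1 fine (sol _ tphi))).
have i3 : bint (fun x => u x * phi x * rho x ^- n).
  rewrite (_ : (fun x => _) = fun x => u x * (phi x * rho x ^- n)).
    apply: (bint_loc_mul cK KB).
    - exact: loc_integrable_continuous.
    - move=> x hx; have [Cp _ _] := tphi.
      exact: (cvgM (Ck_continuous (Cp 0%N) I) (continuous_rhoN hx)).
    - by move=> x /p0 ->; exact: mul0r.
  by apply/funext => x; rewrite mulrA.
rewrite -bIZ// -bIB//; last exact: bintZ.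
by apply: bI_ext => x _; ring.
Qed.

(** Moving both derivatives onto the C^2 function u shows that the difference of the two sides,
    which is continuous, integrates to 0 against every test function. *)
Lemma divkap_eq x : hball x -> divkap u x = - (lambda + `|u x| `^ (p - 1)) * u x * rho x ^- n.
Proof.
have oB := @hball_open R n.
have [g1 [wg1 _]] := usol.
pose w x := divkap u x + (lambda + `|u x| `^ (p - 1)) * u x * rho x ^- n.
suff w0 : forall x, hball x -> w x = 0.
  by move=> hx; have := w0 _ hx; rewrite /w => /eqP; rewrite addr_eq0 => /eqP ->; ring.
have Cku i : Ck 1 (@hball R n) (fun x => kap x * partial i u x).
  by apply: CkM => //; [exact: Ck_kap|apply: Ck_partial].
have cd y : hball y -> {for y, continuous (divkap u)}.
  move=> hy; apply: (Ck_continuous (k := 0) (Om := hball (n := n))) hy.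
  by apply: Ck_sum => // i; exact: (Ck_partial i (Cku i)).
have cc y : hball y -> {for y, continuous (fun x => (lambda + `|u x| `^ (p - 1)) * u x * rho x ^- n)}.
  move=> hy; have c1 : {for y, continuous (fun _ : 'rV[R]_n => lambda)} by exact: cst_continuous.
  exact: (cvgM (cvgM (cvgD c1 (continuous_norm_u_powR hy)) (cu hy)) (continuous_rhoN hy)).
apply: fundamental_lemma => [y hy|phi tphi]; first exact: (cvgD (cd _ hy) (cc _ hy)).
have [K [cK clK KB p0 dp0]] := test_function_supp tphi; have [Cp _ _] := tphi.
have cp y : hball y -> {for y, continuous phi}.
  by move=> _; exact: (Ck_continuous (Cp 0%N) I).
have [_ _ e1] := weak_kap wg1 tphi cu; have := weak_form wg1 tphi.
rewrite e1 divkap_sym// => e2.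
have ib f : (forall y, hball y -> {for y, continuous f}) -> bint (fun x => f x * phi x).
  by move=> cf; apply: (bint_loc_mul cK KB) => //; exact: loc_integrable_continuous.
have j1 := ib _ cd; have j2 := ib _ cc.
have j3 : bint (fun x => `|u x| `^ (p - 1) * u x * phi x * rho x ^- n).
  apply: (@eq_bint _ _ (fun x => (`|u x| `^ (p - 1) * u x * rho x ^- n) * phi x)).
    by move=> y _; ring.
  apply: ib => y hy.
  exact: (cvgM (cvgM (continuous_norm_u_powR hy) (cu hy)) (continuous_rhoN hy)).
have j4 : bint (fun x => u x * phi x * rho x ^- n).
  apply: (@eq_bint _ _ (fun x => (u x * rho x ^- n) * phi x)); first by move=> y _; ring.
  by apply: ib => y hy; exact: (cvgM (cu hy) (continuous_rhoN hy)).
rewrite (@bI_ext _ _ _ (fun x => divkap u x * phi x + (`|u x| `^ (p - 1) * u x * phi x * rho x ^- n +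
  lambda * (u x * phi x * rho x ^- n)))); last by move=> y _; rewrite /w; ring.
rewrite bID//; last by apply: bintD => //; exact: bintZ.
rewrite bID//; last exact: bintZ.
by rewrite bIZ// e2; ring.
Qed.

Definition conf (s : R) x : R := rho x `^ (- s) * u x.

Lemma Ck_conf s : Ck 2 (@hball R n) (conf s).
Proof. exact: (CkM hball_open (Ck_rho_powR 2 (- s)) uC2). Qed.

Lemma confK s x : hball x -> u x = rho x `^ s * conf s x.
Proof. by move=> /hballE x0; rewrite /conf mulrA -powR_add// subrr powRr0 mul1r. Qed.

(** The weight is chosen so that the flux of [conf s] is rho^s times the flux of u plus a term of
    order zero in u; taking the divergence then leaves no first-order term. *)
Lemma pde_conf s x : hball x ->
  \sum_i partial i (fun y => rho y `^ (2 * s - n%:R + 2) * partial i (conf s) y) x =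
  conf s x * rho x `^ (2 * s - n%:R) *
    (s * (n%:R - 1 - s) + (2 * s - n%:R + 2) * s * rho x - lambda - `|u x| `^ (p - 1)).
Proof.
move=> hx; have x0 := (hballE _).1 hx; have oB := @hball_open R n.
have Cku i : Ck 1 (@hball R n) (fun x => kap x * partial i u x).
  by apply: CkM => //; [exact: Ck_kap|apply: Ck_partial].
have Cu1 := CkW uC2.
(* The second summand comes from differentiating rho^(-s), as the i-th derivative of rho is -x_i. *)
pose G i y := rho y `^ s * (kap y * partial i u y) +
  s * (u y * (y 0 i * rho y `^ (s - n%:R + 1))).
have EG i y : hball y -> rho y `^ (2 * s - n%:R + 2) * partial i (conf s) y = G i y.
  move=> hy; have y0 := (hballE _).1 hy.
  rewrite (partialP (is_derive_mul (is_derive_rho_powR (- s) i hy) (Ck_is_derive i Cu1 hy))) /G /kap.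
  have -> : rho y `^ (2 * s - n%:R + 2) = rho y `^ s * rho y `^ s * rho y `^ (2 - n%:R).
    by rewrite -!powR_add//; congr (_ `^ _); ring.
  have -> : rho y `^ (s - n%:R + 1) = rho y `^ s * rho y `^ s * rho y `^ (2 - n%:R) * rho y `^ (- s - 1).
    by rewrite -!powR_add//; congr (_ `^ _); ring.
  have e : rho y `^ s * rho y `^ (- s) = 1 by rewrite -powR_add// subrr powRr0.
  rewrite mulrDr opprK; congr (_ + _).
    transitivity (rho y `^ s * rho y `^ (- s) * (rho y `^ s * rho y `^ (2 - n%:R) * partial i u y)); first ring.
    by rewrite e mul1r mulrA.
  ring.
have dG i : is_derive x (delta_mx 0 i) (G i)
    (rho x `^ s * partial i (fun y => kap y * partial i u y) x +
     (kap x * partial i u x) * (- s * rho x `^ (s - 1) * x 0 i) +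
     s * (u x * (x 0 i * (- (s - n%:R + 1) * rho x `^ (s - n%:R + 1 - 1) * x 0 i) +
                 rho x `^ (s - n%:R + 1) * 1) +
          (x 0 i * rho x `^ (s - n%:R + 1)) * partial i u x)).
  have d1 := is_derive_mul (is_derive_rho_powR s i hx) (Ck_is_derive i (Cku i) hx).
  have d2 : is_derive x (delta_mx 0 i) (fun y : 'rV[R]_n => y 0 i) 1.
    by apply: (is_derive_eq (is_derive_coord x (delta_mx 0 i) i)); rewrite mxE !eqxx.
  have d3 := is_derive_mul d2 (is_derive_rho_powR (s - n%:R + 1) i hx).
  have d4 := is_derive_mul (Ck_is_derive i Cu1 hx) d3.
  have d5 := is_derive_affine 0 s d4.
  have := is_derive_add d1 d5; rewrite (_ : (fun y => _ + (0 + _)) = G i)//.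
  by apply/funext => y; rewrite add0r.
rewrite (eq_bigr (fun i => rho x `^ s * partial i (fun y => kap y * partial i u y) x +
   s * u x * rho x `^ (s - n%:R) * (rho x - (s - n%:R + 1) * (x 0 i) ^+ 2))); last first.
  move=> i _; rewrite (partial_ext i oB (EG i) hx) (partialP (dG i)).
  have -> : s - n%:R + 1 - 1 = s - n%:R by ring.
  have -> : rho x `^ (s - n%:R + 1) = rho x `^ (s - n%:R) * rho x by rewrite powR_add// powRr1// ltW.
  have e : kap x * rho x `^ (s - 1) = rho x `^ (s - n%:R) * rho x.
    transitivity (rho x `^ (s - n%:R + 1)); last by rewrite powR_add// powRr1// ltW.
    by rewrite /kap -powR_add//; congr (_ `^ _); ring.
  (* The middle line collects the first derivatives of u; its coefficient is 0 by [e]. *)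
  transitivity (rho x `^ s * partial i (fun y : 'rV_n => kap y * partial i u y) x +
    s * x 0 i * partial i u x * (rho x `^ (s - n%:R) * rho x - kap x * rho x `^ (s - 1)) +
    s * u x * rho x `^ (s - n%:R) * (rho x - (s - n%:R + 1) * (x 0 i) ^+ 2)); first ring.
  by rewrite e subrr mulr0 addr0.
rewrite big_split /= -mulr_sumr -/(divkap u x) divkap_eq// -mulr_sumr sumrB sumr_const card_ord.
rewrite -mulr_sumr.
have -> : \sum_(i < n) x 0 i ^+ 2 = 1 - 2 * rho x.
  by rewrite rhoE /sqd; under [in RHS]eq_bigr do rewrite mxE subr0; field.
have e1 : rho x `^ s * rho x ^- n = rho x `^ (s - n%:R) by rewrite powR_add// powR_invn// ltW.
have e2 : conf s x * rho x `^ (2 * s - n%:R) = u x * rho x `^ (s - n%:R).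
  by rewrite /conf mulrAC -powR_add// mulrC; congr (_ * _ `^ _); ring.
rewrite e2 -[rho x *+ n]mulr_natl.
transitivity (- (lambda + `|u x| `^ (p - 1)) * u x * (rho x `^ s * rho x ^- n) +
  s * u x * rho x `^ (s - n%:R) * (n%:R * rho x - (s - n%:R + 1) * (1 - 2 * rho x))); first ring.
by rewrite e1; ring.
Qed.

End solution.

End pde.

(** * Brandt's interior gradient estimate by discrete second differences *)

Section second_difference.
Context {R : realType}.

Lemma is_derive_small_o (f : R -> R) (c e : R) : is_derive (0 : R) 1 f c -> 0 < e ->
  exists2 d : R, 0 < d & forall s, `|s| < d -> `|f s - f 0 - c * s| <= e * `|s|.
Proof.
move=> [df dv] e0.
have : (fun h : R => h^-1 *: ((f \o shift 0) (h *: (1 : R)) - f 0)) @ 0^' --> c.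
  by rewrite -dv; exact: df.
move=> /cvgrPdist_le/(_ e e0); rewrite near_withinE => /nbhs_ballP[d /= d0 hd].
exists d => // s sd; have [->|s0] := eqVneq s 0.
  by rewrite mulr0 subrr subr0 normr0 mulr0.
have := hd s; rewrite /ball /= sub0r normrN => /(_ sd s0).
rewrite addr0 [_%:A]mulr1 => h.
have -> : f s - f 0 - c * s = - s * (c - s^-1 * (f s - f 0)) by field.
by rewrite normrM normrN mulrC ler_wpM2r.
Qed.

(** The mean value theorem is applied to g(s) + g(-s) - c s^2, whose derivative dg(s) - dg(-s) - 2cs
    is o(s) because dg is derivable at 0. No continuity of a second derivative enters. *)
Lemma second_difference (g dg : R -> R) (c e r : R) : 0 < r ->
  (forall s : R, `|s| < r -> is_derive s 1 g (dg s)) -> is_derive (0 : R) 1 dg c -> 0 < e ->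
  \forall t \near (0 : R)^'+, `|g t + g (- t) - 2 * g 0 - c * t ^+ 2| <= e * t ^+ 2.
Proof.
move=> r0 gd dgc e0.
have [d d0 hd] := is_derive_small_o dgc (divr_gt0 e0 (ltr0n R 2)).
near=> t; have t0 : 0 < t by near: t; exact: nbhs_right_gt.
have tr : t < r by near: t; exact: nbhs_right_lt.
have td : t < d by near: t; exact: nbhs_right_lt.
pose h s := g s + g (- s) - c * s ^+ 2.
have dh (s : R) : `|s| < r -> is_derive s 1 h (dg s - dg (- s) - 2 * c * s).
  move=> sr; have d1 := gd s sr.
  have d2 : is_derive s 1 (fun s : R => - s) (- 1 : R) by exact: is_deriveNid.
  have d3 : is_derive s 1 (fun s => g (- s)) (dg (- s) * -1).
    by apply: (@is_derive1_comp _ g (fun s => - s)) => //; apply: gd; rewrite normrN.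
  have d4 : is_derive s 1 (fun s : R => s) (1 : R) by exact: is_derive_id.
  have d5 : is_derive s 1 (cst c : R -> R) (0 : R) by exact: is_derive_cst.
  have d6 := is_deriveB (is_deriveD d1 d3) (is_deriveM d5 (is_deriveM d4 d4)).
  apply: (is_derive_eq d6); rewrite /GRing.scale /= /cst; ring.
have ti s : s \in `]0, t[ -> 0 < s /\ s < t by rewrite in_itv => /andP[].
have [||s /ti[s0 st]] := @MVT R h (fun s => dg s - dg (- s) - 2 * c * s) 0 t t0.
- by move=> s /ti[s0 st]; apply: dh; rewrite gtr0_norm// (lt_trans st).
- apply: continuous_in_subspaceT => s /[!inE] /=; rewrite in_itv /= => /andP[s0 st].
  have sr : `|s| < r by rewrite ger0_norm// (le_lt_trans st).
  by apply/differentiable_continuous/derivable1_diffP; have [] := dh s sr.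
rewrite subr0 /h oppr0 => E.
have -> : g t + g (- t) - 2 * g 0 - c * t ^+ 2 = (dg s - dg (- s) - 2 * c * s) * t.
  by rewrite -E; ring.
rewrite normrM (gtr0_norm t0) expr2 mulrA ler_pM2r//.
have -> : dg s - dg (- s) - 2 * c * s = (dg s - dg 0 - c * s) - (dg (- s) - dg 0 - c * - s) by ring.
apply: le_trans (ler_normB _ _) _.
have h1 := hd s; have h2 := hd (- s); rewrite normrN in h2; rewrite gtr0_norm// in h1 h2.
have sd : s < d by exact: lt_trans st td.
apply: le_trans (lerD (h1 sd) (h2 sd)) _.
have -> : e / 2 * s + e / 2 * s = e * s by field.
by rewrite ler_pM2l// ltW.
Unshelve. all: by end_near. Qed.

End second_difference.

Section brandt.
Context {R : realType} {n : nat}.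
Implicit Types (a x : 'rV[R]_n) (v : 'rV[R]_n -> R) (Om : set 'rV[R]_n).

Definition lap v x : R := \sum_i partial i (partial i v) x.

Definition shiftc j (t : R) x : 'rV[R]_n := t *: delta_mx 0 j + x.

Lemma shiftcE j t x k : shiftc j t x 0 k = x 0 k + t * (k == j)%:R.
Proof. by rewrite !mxE eqxx /= addrC eq_sym. Qed.

Lemma shiftc0 j x : shiftc j 0 x = x.
Proof. by rewrite /shiftc scale0r add0r. Qed.

(** Second differences make the maximum principle elementary: at a maximum they are nonpositive by
    inspection, also for functions composed with a reflection. *)
Lemma near_lap Om v x (F : R) : open Om -> Ck 2 Om v -> Om x -> `|lap v x| < F ->
  \forall t \near (0 : R)^'+,
    `|\sum_j (v (shiftc j t x) + v (shiftc j (- t) x) - 2 * v x)| < F * t ^+ 2.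
Proof.
move=> oOm Cv Omx vF; have [r r0 rOm] := (open_cubeP _).1 oOm x Omx.
(* The gap left by the strict inequality is shared among the n directions; n+1 avoids a division by
   0. *)
pose e := (F - `|lap v x|) / (2 * n.+1%:R).
have n0 : 0 < n.+1%:R :> R by rewrite ltr0n.
have e0 : 0 < e by rewrite divr_gt0 ?mulr_gt0// subr_gt0.
have mOm j s : `|s| < r -> Om (shiftc j s x).
  move=> sr; apply: rOm => k; rewrite shiftcE addrAC subrr add0r.
  by case: eqP => _; rewrite ?mulr1 ?mulr0 ?normr0 ltW.
have H j : \forall t \near (0 : R)^'+, `|v (shiftc j t x) + v (shiftc j (- t) x) - 2 * v x -
    partial j (partial j v) x * t ^+ 2| <= e * t ^+ 2.
  have dv (s : R) : `|s| < r -> is_derive s 1 (fun s => v (shiftc j s x)) (partial j v (shiftc j s x)).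
    by move=> /(mOm j) h; apply/is_derive_line; exact: (Ck_is_derive j (CkW Cv) h).
  have dpv : is_derive (0 : R) 1 (fun s => partial j v (shiftc j s x)) (partial j (partial j v) x).
    apply/is_derive_line; rewrite -/(shiftc j 0 x) shiftc0.
    exact: (Ck_is_derive j (Ck_partial j Cv) Omx).
  by have := second_difference r0 dv dpv e0; rewrite shiftc0.
near=> t; have t0 : 0 < t by near: t; exact: nbhs_right_gt.
have Ht j : `|v (shiftc j t x) + v (shiftc j (- t) x) - 2 * v x -
    partial j (partial j v) x * t ^+ 2| <= e * t ^+ 2.
  by move: j; near: t; exact: filter_forall.
rewrite (_ : \sum_j _ = \sum_j (v (shiftc j t x) + v (shiftc j (- t) x) - 2 * v x -
    partial j (partial j v) x * t ^+ 2) + lap v x * t ^+ 2); last first.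
  by rewrite /lap mulr_suml -big_split /=; apply: eq_bigr => j _; ring.
apply: le_lt_trans (ler_normD _ _) _.
have t2 : 0 < t ^+ 2 by rewrite exprn_gt0.
apply: (@le_lt_trans _ _ (n%:R * (e * t ^+ 2) + `|lap v x| * t ^+ 2)).
  rewrite lerD//; last by rewrite normrM (gtr0_norm t2).
  apply: le_trans (ler_norm_sum _ _ _) _.
  apply: le_trans (ler_sum _ (fun j _ => Ht j)) _.
  by rewrite sumr_const card_ord -[_ *+ n]mulr_natl.
rewrite mulrA -mulrDl ltr_pM2r//.
have : n%:R * e < F - `|lap v x|.
  rewrite /e mulrA ltr_pdivrMr ?mulr_gt0// mulrC ltr_pM2l ?subr_gt0//.
  have : n%:R < n.+1%:R :> R by rewrite ltr_nat.
  lra.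
lra.
Unshelve. all: by end_near. Qed.

Lemma sqd_shiftc a j t x : sqd a (shiftc j t x) = sqd a x + 2 * t * (x 0 j - a 0 j) + t ^+ 2.
Proof.
rewrite /sqd (bigD1 j)//= [in RHS](bigD1 j)//= shiftcE eqxx mulr1.
rewrite (eq_bigr (fun k => (x 0 k - a 0 k) ^+ 2)); first ring.
by move=> k kj; rewrite shiftcE (negbTE kj) mulr0 addr0.
Qed.

(* Comparison with a quadratic barrier on the half cube {x_i >= a_i}, applied to
   the part of v that is odd under reflection in the hyperplane x_i = a_i. *)
Lemma brandt_half Om v a i (d M F t : R) : open Om -> Ck 2 Om v -> 0 < d -> cube a d `<=` Om ->
  (forall x, cube a d x -> `|v x| <= M) -> (forall x, cube a d x -> `|lap v x| < F) ->
  0 <= t <= d ->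
  v (shiftc i t a) - v (shiftc i (- t) a) <= 2 * t * (n%:R * M / d + F * d / 2).
Proof.
move=> oOm Cv d0 dOm vM vF /andP[t0 td].
have M0 : 0 <= M by apply: le_trans (normr_ge0 _) (vM a (cube_center _ (ltW d0))).
have F0 : 0 < F by apply: le_lt_trans (normr_ge0 _) (vF a (cube_center _ (ltW d0))).
pose refl x := shiftc i (2 * (a 0 i - x 0 i)) x.
pose H := [set x | cube a d x /\ a 0 i <= x 0 i].
(* Chosen so that the barrier [psi] has Laplacian exactly -F. *)
pose k := n%:R * M / d ^+ 2 + F / 2.
(* The first term is at least M on the faces |x_j - a_j| = d; the second is nonnegative on the half
   cube. As v minus its reflection is at most 2M, and is 0 on the mirror, [w] is nonpositive on the
   whole boundary. *)
pose psi x := M / d ^+ 2 * sqd a x + k * ((x 0 i - a 0 i) * (d - (x 0 i - a 0 i))).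
pose w x := v x - v (refl x) - 2 * psi x.
have reflE x j : refl x 0 j = if j == i then 2 * a 0 i - x 0 i else x 0 j.
  by rewrite shiftcE; case: eqP => [->|_] /=; ring.
have refl_cube x : cube a d x -> cube a d (refl x).
  move=> xd j; rewrite reflE; case: eqP => [->|_]; last exact: xd.
  by rewrite -normrN opprB; have := xd i; congr (`|_| <= _); ring.
have k0 : 0 <= k by rewrite addr_ge0// divr_ge0// ?exprn_ge0 ?mulr_ge0// ltW.
have cx (f : 'rV[R]_n -> R) x : Ck 0 setT f -> {for x, continuous f}.
  by move=> Cf; exact: (Ck_continuous Cf I).
have crefl x : {for x, continuous refl}.
  move=> U /nbhs_cubeP[r r0 rU]; apply/nbhs_cubeP; exists r => // y xy.
  apply: rU => j; rewrite !reflE; case: eqP => _; last exact: xy.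
  by rewrite -normrN; have := xy i; congr (`|_| <= _); ring.
have cpsi x : {for x, continuous psi}.
  have oT := @openT 'rV[R]_n.
  apply: cx; apply: CkD => //; apply: CkM => //; try exact: Ck_cst; first exact: Ck_sqd.
  have h : Ck 0 setT (fun x : 'rV[R]_n => x 0 i - a 0 i).
    by apply: CkB => //; [exact: Ck_coord|exact: Ck_cst].
  by apply: CkM => //; apply: CkB => //; exact: Ck_cst.
have cw x : H x -> {for x, continuous w}.
  move=> [hx _]; have c1 := Ck_continuous Cv (dOm _ hx).
  have c2 : {for x, continuous (v \o refl)}.
    by apply: continuous_comp; [exact: crefl|exact: (Ck_continuous Cv (dOm _ (refl_cube _ hx)))].
  have c3 : {for x, continuous (fun _ : 'rV[R]_n => 2 : R)} by exact: cst_continuous.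
  exact: (cvgB (cvgB c1 c2) (cvgM c3 (cpsi x))).
have cH : compact H.
  have -> : H = cube a d `&` ((fun x : 'rV[R]_n => x 0 i) @^-1` `[a 0 i, +oo[%classic).
    apply/seteqP; split => x; rewrite /H /= /preimage /= in_itv /= => -[h1 h2]; split => //.
      by rewrite h2.
    by move: h2; rewrite andbT.
  apply: compact_closedI; first exact: cube_compact.
  apply: closed_comp; last exact: interval_closed.
  by move=> x _; apply: cx; apply: Ck_coord; exact: openT.
have Ha : H a by split; [exact/cube_center/ltW|].
have [x /[!inE] Hx xmax] : exists2 c, c \in H & forall y, y \in H -> w y <= w c.
  apply: compact_EVT_max => //; first by exists a.
  by apply: continuous_in_subspaceT => x /[!inE]; exact: cw.
have d2 : 0 < d ^+ 2 by rewrite exprn_gt0.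
suff wx : w x <= 0.
  have tE : shiftc i t a 0 i - a 0 i = t by rewrite shiftcE eqxx mulr1; ring.
  have : w (shiftc i t a) <= 0.
    apply: le_trans wx; apply: xmax; rewrite inE; split; last by rewrite -subr_ge0 tE.
    move=> j; rewrite shiftcE addrAC subrr add0r.
    by case: eqP => _; rewrite ?mulr1 ?mulr0 ?normr0 ?(ger0_norm t0) ?(ltW d0).
  rewrite /w.
  have -> : refl (shiftc i t a) = shiftc i (- t) a.
    by apply/rowP => j; rewrite reflE !shiftcE eqxx; case: eqVneq => [->|_] /=; ring.
  rewrite /psi tE sqd_shiftc subrr.
  have -> : sqd a a = 0 by rewrite /sqd big1// => j _; rewrite subrr expr0n.
  rewrite mulr0 addr0 add0r => h.
  have n1 : 1 <= n%:R :> R by rewrite ler1n (leq_ltn_trans _ (ltn_ord i)).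
  (* The linear part is the claimed bound. The quadratic part, with the M t^2 / d^2 of [psi], is
     nonpositive since n >= 1, and is discarded. *)
  have kE : k * (t * (d - t)) = t * (n%:R * M / d + F * d / 2) - (n%:R * (M / d ^+ 2) + F / 2) * t ^+ 2.
    by rewrite /k; field; rewrite gt_eqF.
  have : 0 <= (n%:R - 1) * (M / d ^+ 2) * t ^+ 2.
    by rewrite !mulr_ge0 ?subr_ge0 ?exprn_ge0 ?invr_ge0 ?exprn_ge0 ?(ltW d0).
  have : 0 <= F * t ^+ 2 by rewrite mulr_ge0 ?exprn_ge0 ?(ltW F0).
  rewrite kE in h; lra.
rewrite leNgt; apply/negP => wx0.
have [xd xi] := Hx.
set y := x 0 i - a 0 i; have y0 : 0 <= y by rewrite subr_ge0.
have yd : y <= d by have := xd i; rewrite ger0_norm.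
have sq0 := sqd_ge0 a x.
have wle : w x <= 2 * M - 2 * psi x.
  have := vM _ xd; have := vM _ (refl_cube _ xd); rewrite /w !ler_norml.
  by move=> /andP[h1 h2] /andP[h3 h4]; lra.
have psiM : (exists j, `|x 0 j - a 0 j| = d) -> M <= psi x.
  move=> [j jd]; have : d ^+ 2 <= sqd a x.
    rewrite /sqd (bigD1 j)//= -(real_normK (num_real (x 0 j - a 0 j))) jd lerDl.
    by apply: sumr_ge0 => l _; exact: sqr_ge0.
  move=> h; have h1 : M <= M / d ^+ 2 * sqd a x.
    by rewrite mulrAC ler_pdivlMr// ler_wpM2l.
  rewrite /psi -/y; have : 0 <= k * (y * (d - y)) by rewrite !mulr_ge0// subr_ge0.
  lra.
have xint j : `|x 0 j - a 0 j| < d.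
  rewrite lt_neqAle xd andbT; apply/eqP => jd.
  by have := psiM (ex_intro _ j jd); lra.
have y_gt0 : 0 < y.
  rewrite lt_neqAle y0 andbT; apply/eqP => yE.
  have E : refl x = x.
    by apply/rowP => j; rewrite reflE; case: eqP => [->|//]; move: yE; rewrite /y; lra.
  move: wx0; rewrite /w E subrr sub0r.
  have : 0 <= psi x by rewrite /psi -/y -yE mul0r mulr0 addr0 mulr_ge0// divr_ge0// ltW.
  lra.
have near1 := near_lap oOm Cv (dOm _ xd) (vF _ xd).
have near2 := near_lap oOm Cv (dOm _ (refl_cube _ xd)) (vF _ (refl_cube _ xd)).
have near3 : \forall s \near (0 : R)^'+, forall j, `|x 0 j - a 0 j| + s < d.
  apply: filter_forall => j; have h : 0 < d - `|x 0 j - a 0 j| by rewrite subr_gt0.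
  by near=> s; rewrite -ltrBrDl; near: s; exact: nbhs_right_lt.
(* A single step s must serve at x and at its reflection, and keep all shifted points in the half
   cube, which is possible because x is interior. *)
have [s [s0 sy s1 s2 s3]] : exists s, [/\ 0 < s, s < y,
    `|\sum_j (v (shiftc j s x) + v (shiftc j (- s) x) - 2 * v x)| < F * s ^+ 2,
    `|\sum_j (v (shiftc j s (refl x)) + v (shiftc j (- s) (refl x)) - 2 * v (refl x))| < F * s ^+ 2
    & forall j, `|x 0 j - a 0 j| + s < d].
  apply: (@filter_ex _ (0 : R)^'+); near=> s; split; near: s => //.
    exact: nbhs_right_gt.
  exact: nbhs_right_lt.
have Hm j (sg : R) : `|sg| = s -> H (shiftc j sg x).
  move=> sgs; split.
    move=> l; rewrite shiftcE addrAC; apply: le_trans (ler_normD _ _) _; apply: le_trans (ltW (s3 l)).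
    by rewrite lerD2l; case: eqP => _; rewrite ?mulr1 ?mulr0 ?normr0 ?sgs// ltW.
  rewrite shiftcE; have : - s <= sg by rewrite -sgs -normrN lerNl ler_norm.
  by case: eqP => _; rewrite ?mulr1 ?mulr0; move: sy xi; rewrite /y; lra.
have ns : `|s| = s by rewrite gtr0_norm.
have wj j : w (shiftc j s x) + w (shiftc j (- s) x) - 2 * w x <= 0.
  have h1 : w (shiftc j s x) <= w x by apply: xmax; rewrite inE; exact: Hm.
  have h2 : w (shiftc j (- s) x) <= w x by apply: xmax; rewrite inE; apply: Hm; rewrite normrN.
  lra.
(* The reflection exchanges the two shifts in direction i and commutes with the others, so symmetric
   sums are preserved. *)
have vr j : v (refl (shiftc j s x)) + v (refl (shiftc j (- s) x)) =
    v (shiftc j s (refl x)) + v (shiftc j (- s) (refl x)).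
  have E sg : refl (shiftc j sg x) = shiftc j (if j == i then - sg else sg) (refl x).
    apply/rowP => l; rewrite [RHS]shiftcE !reflE !shiftcE.
    case: (eqVneq l i) => [->|li]; first by rewrite eq_sym; case: eqVneq => _ /=; ring.
    by case: (eqVneq l j) => [<-|_] /=; rewrite ?(negbTE li) ?mulr0.
  by rewrite !E opprK; case: eqP => _ //; rewrite addrC.
have psij j : psi (shiftc j s x) + psi (shiftc j (- s) x) - 2 * psi x =
    2 * (M / d ^+ 2) * s ^+ 2 - 2 * k * s ^+ 2 * (i == j)%:R.
  by rewrite /psi !sqd_shiftc !shiftcE; case: eqVneq => [<-|_] /=; ring.
(* This is the contradiction: the same sum exceeds -F s^2 - F s^2 + 2 F s^2 = 0, the last term
   coming from -2 [psi]. *)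
have : \sum_j (w (shiftc j s x) + w (shiftc j (- s) x) - 2 * w x) <= 0.
  by rewrite -oppr_ge0 -sumrN; apply: sumr_ge0 => j _; rewrite oppr_ge0.
rewrite (eq_bigr (fun j => (v (shiftc j s x) + v (shiftc j (- s) x) - 2 * v x) -
   (v (shiftc j s (refl x)) + v (shiftc j (- s) (refl x)) - 2 * v (refl x)) -
   2 * (2 * (M / d ^+ 2) * s ^+ 2 - 2 * k * s ^+ 2 * (i == j)%:R))); last first.
  by move=> j _; rewrite -psij -vr /w; ring.
have split3 (A B C : 'I_n -> R) : \sum_j (A j - B j - 2 * C j) =
    \sum_j A j - \sum_j B j - 2 * \sum_j C j by rewrite !sumrB mulr_sumr.
have S3 : \sum_(j < n) (2 * (M / d ^+ 2) * s ^+ 2 - 2 * k * s ^+ 2 * (i == j)%:R) =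
    n%:R * (2 * (M / d ^+ 2) * s ^+ 2) - 2 * k * s ^+ 2.
  rewrite sumrB sumr_const card_ord -[_ *+ n]mulr_natl -mulr_sumr (bigD1 i)//= eqxx big1 ?addr0 ?mulr1//.
  by move=> j; rewrite eq_sym => /negbTE ->.
rewrite split3 S3.
move: s1 s2; rewrite !ltr_norml => /andP[h1 _] /andP[_ h2].
have -> : 2 * k * s ^+ 2 = n%:R * (2 * (M / d ^+ 2) * s ^+ 2) + F * s ^+ 2 by rewrite /k; field; rewrite gt_eqF.
lra.
Unshelve. all: by end_near. Qed.

Lemma lapN Om v : open Om -> Ck 2 Om v -> forall x, Om x -> lap (fun y => - v y) x = - lap v x.
Proof.
move=> oOm Cv x Omx; rewrite /lap -sumrN; apply: eq_bigr => i _.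
have E y : Om y -> partial i (fun y => - v y) y = - partial i v y.
  by move=> hy; apply: partialP; apply: is_deriveN; exact: (Ck_is_derive i (CkW Cv) hy).
rewrite (partial_ext i oOm E Omx); apply: partialP; apply: is_deriveN.
exact: (Ck_is_derive i (Ck_partial i Cv) Omx).
Qed.

Lemma brandt Om v a i (d M F t : R) : open Om -> Ck 2 Om v -> 0 < d -> cube a d `<=` Om ->
  (forall x, cube a d x -> `|v x| <= M) -> (forall x, cube a d x -> `|lap v x| < F) ->
  `|t| <= d ->
  `|v (shiftc i t a) - v (shiftc i (- t) a)| <= 2 * `|t| * (n%:R * M / d + F * d / 2).
Proof.
move=> oOm Cv d0 dOm vM vF.
wlog t0 : t / 0 <= t.
  move=> h td; have [t0|/ltW t0] := leP 0 t; first exact: h.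
  by have := h (- t); rewrite oppr_ge0 normrN opprK distrC; exact.
rewrite ger0_norm// => td; rewrite ler_norml lerNl opprB.
have tt : 0 <= t <= d by rewrite t0.
apply/andP; split; last exact: (brandt_half i oOm Cv d0 dOm vM vF tt).
have vM' x : cube a d x -> `|- v x| <= M by rewrite normrN; exact: vM.
have vF' x : cube a d x -> `|lap (fun y => - v y) x| < F.
  by move=> xd; rewrite (lapN oOm Cv) ?normrN ?vF//; exact: dOm.
by have := brandt_half i oOm (CkN oOm Cv) d0 dOm vM' vF' tt; rewrite opprK addrC.
Qed.

(** From a to x one coordinate is changed at a time. Each segment is symmetric about its midpoint,
    where [brandt] applies; the midpoints stay within r <= d of a, hence the hypotheses on the cube
    of radius 2d. *)
Lemma brandt_lipschitz Om v a (d M F r : R) : open Om -> Ck 2 Om v -> 0 < d ->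
  cube a (2 * d) `<=` Om ->
  (forall x, cube a (2 * d) x -> `|v x| <= M) ->
  (forall x, cube a (2 * d) x -> `|lap v x| < F) -> r <= d ->
  forall x, cube a r x -> `|v x - v a| <= n%:R * r * (n%:R * M / d + F * d / 2).
Proof.
move=> oOm Cv d0 dOm vM vF rd x xr.
set L := n%:R * M / d + F * d / 2.
have a2 : cube a (2 * d) a by apply: cube_center; rewrite mulr_ge0// ltW.
have M0 : 0 <= M by exact: le_trans (normr_ge0 _) (vM _ a2).
have F0 : 0 <= F by apply: le_trans (normr_ge0 _) (ltW (vF _ a2)).
have L0 : 0 <= L by rewrite addr_ge0// ?divr_ge0 ?mulr_ge0// ltW.
pose z k : 'rV[R]_n := \row_j (if (j < k)%N then x 0 j else a 0 j).
suff H k : (k <= n)%N -> `|v (z k) - v a| <= k%:R * r * L.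
  have -> : x = z n by apply/rowP => j; rewrite mxE ltn_ord.
  exact: H.
elim: k => [_|k ih kn].
  rewrite (_ : z 0%N = a) ?subrr ?normr0 ?mul0r//.
  by apply/rowP => j; rewrite mxE.
pose i := Ordinal kn; pose t := (x 0 i - a 0 i) / 2.
(* The midpoint between [z k] and [z k.+1]. *)
pose m : 'rV[R]_n := shiftc i t (z k).
have jk (j : 'I_n) : j != i -> (j < k.+1)%N = (j < k)%N.
  by move=> ji; rewrite ltnS leq_eqVlt orb_idl// => /eqP E; move: ji; rewrite -val_eqE /= E eqxx.
have E1 : shiftc i t m = z k.+1.
  apply/rowP => j; rewrite !shiftcE !mxE; case: (eqVneq j i) => [->|ji].
    by rewrite /= ltnn leqnn /t; field.
  by rewrite jk// !mulr0 !addr0.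
have E2 : shiftc i (- t) m = z k.
  by apply/rowP => j; rewrite !shiftcE mulNr addrK.
have r0 : 0 <= r by apply: le_trans (xr i).
have tr : 2 * `|t| <= r.
  by rewrite /t normrM normfV (gtr0_norm (ltr0n R 2)) mulrCA mulfV// mulr1; exact: xr.
have md : cube m d `<=` cube a (2 * d).
  apply: cube_subset => j; suff : `|m 0 j - a 0 j| <= r by lra.
  rewrite shiftcE mxE; case: (eqVneq j i) => [->|ji] /=.
    by rewrite ltnn mulr1 addrAC subrr add0r; have := normr_ge0 t; lra.
  by rewrite mulr0 addr0; case: ifP => _; [exact: xr|rewrite subrr normr0].
have := @brandt Om v m i d M F t oOm Cv d0 (subset_trans md dOm)
  (fun y hy => vM _ (md _ hy)) (fun y hy => vF _ (md _ hy)).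
rewrite E1 E2 => /(_ _) h.
have td : `|t| <= d by have := normr_ge0 t; lra.
have -> : v (z k.+1) - v a = (v (z k.+1) - v (z k)) + (v (z k) - v a) by ring.
apply: le_trans (ler_normD _ _) _.
apply: le_trans (lerD (h td) (ih (ltnW kn))) _.
rewrite -/L -natr1.
have : 2 * `|t| * L <= r * L by rewrite ler_wpM2r.
lra.
Qed.

End brandt.

(** * Cubes adapted to the metric, point picking, energy near the boundary *)

Section geometry.
Context {R : realType} {n : nat}.
Implicit Types (a x : 'rV[R]_n).

Lemma cube_normE a r x : 0 <= r -> cube a r x <-> `|x - a| <= r.
Proof.
move=> r0; rewrite [`|x - a|]mx_normrE; split=> [h|/bigmax_leP[_ h] i].
  by apply/bigmax_leP; split => // -[i j] _ /=; rewrite ord1 !mxE; exact: h.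
by have := h (0, i) isT; rewrite /= !mxE.
Qed.

(** With d the radius, coordinates bounded by 1 and d <= 1 give |x_i^2 - a_i^2| <= 3d; summing, rho
    changes by at most 3/8 of rho(a). Such cubes have bounded hyperbolic size. *)
Lemma rho_cube a x : (0 < n)%N -> hball a -> cube a (rho a / (4 * n%:R)) x ->
  [/\ hball x, rho a / 2 <= rho x & rho x <= 2 * rho a].
Proof.
move=> n0 ha hx; have a0 := (hballE _).1 ha.
have n1 : 0 < n%:R :> R by rewrite ltr0n.
set d := rho a / (4 * n%:R) in hx.
have d0 : 0 < d by rewrite divr_gt0// mulr_gt0.
have nd : n%:R * d = rho a / 4 by rewrite /d; field; rewrite gt_eqF.
have a1 : rho a <= 2^-1 by rewrite rhoE; have := sqd_ge0 0 a; lra.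
have d1 : d <= 1.
  apply: le_trans (_ : n%:R * d <= 1); last by lra.
  by rewrite ler_peMl ?(ltW d0)// ler1n.
have h i : `|x 0 i ^+ 2 - a 0 i ^+ 2| <= 3 * d.
  have := hball_subset_cube ha i; rewrite mxE subr0 => ai.
  rewrite subr_sqr normrM mulrC; apply: ler_pM => //.
  have -> : x 0 i + a 0 i = (x 0 i - a 0 i) + 2 * a 0 i by ring.
  apply: le_trans (ler_normD _ _) _; have := hx i.
  by rewrite normrM (gtr0_norm (ltr0n R 2)); lra.
have E : `|rho x - rho a| <= 3 / 2 * (n%:R * d).
  have -> : rho x - rho a = - 2^-1 * \sum_i (x 0 i ^+ 2 - a 0 i ^+ 2).
    have S y : sqd 0 y = \sum_i y 0 i ^+ 2 :> R.
      by apply: eq_bigr => i _; rewrite mxE subr0.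
    by rewrite !rhoE !S sumrB; field.
  rewrite normrM normrN [`|2^-1|]gtr0_norm ?invr_gt0//.
  have : `|\sum_i (x 0 i ^+ 2 - a 0 i ^+ 2)| <= n%:R * (3 * d).
    apply: le_trans (ler_norm_sum _ _ _) _; apply: le_trans (ler_sum _ (fun i _ => h i)) _.
    by rewrite sumr_const card_ord -[_ *+ n]mulr_natl.
  lra.
move: E; rewrite nd ler_norml => /andP[e1 e2].
have x0 : rho a / 2 <= rho x by lra.
split; [apply/hballE; lra|by []|lra].
Qed.

(** [x1] maximizes b times the sup-norm distance s to the boundary of the cube. Within s/2 of [x1]
    this distance is still at least s/2, so b at most doubles. *)
Lemma point_picking (b : 'rV[R]_n -> R) a (d beta : R) : 0 < d -> 0 < beta ->
  (forall x, cube a d x -> {for x, continuous b}) -> (forall x, 0 <= b x) -> beta <= b a ->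
  exists x1 s, [/\ 0 < s, cube x1 s `<=` cube a d, beta * d <= s * b x1, beta <= b x1
    & forall x, cube x1 (s / 2) x -> b x <= 2 * b x1].
Proof.
move=> d0 beta0 cb b0 ba.
pose h x := (d - `|x - a|) * b x.
have ca := cube_center a (ltW d0).
have [x1 /[!inE] hx1 hmax] : exists2 c, c \in cube a d & forall y, y \in cube a d -> h y <= h c.
  apply: compact_EVT_max; [by exists a|exact: cube_compact|].
  apply: continuous_in_subspaceT => x /[!inE] hx.
  have c1 : {for x, continuous (fun x => `|x - a|)}.
    apply: (@continuous_comp _ _ _ (fun x => x - a) (fun x => `|x|)).
      have c0 : {for x, continuous (fun _ : 'rV[R]_n => a)} by exact: cst_continuous.
      have ci : {for x, continuous (fun y : 'rV[R]_n => y)} by move=> ?; exact: cvg_id.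
      exact: (cvgB ci c0).
    exact: norm_continuous.
  have c2 : {for x, continuous (fun _ : 'rV[R]_n => d)} by exact: cst_continuous.
  exact: (cvgM (cvgB c2 c1) (cb _ hx)).
have ha : h a = d * b a by rewrite /h subrr normr0 subr0.
have h1 : beta * d <= h x1.
  apply: le_trans (hmax a _); last by rewrite inE.
  by rewrite ha mulrC ler_wpM2l// ltW.
set s := d - `|x1 - a|.
have s0 : 0 < s.
  have sge : 0 <= s by rewrite subr_ge0; exact/cube_normE/hx1/ltW.
  rewrite lt_neqAle sge andbT; apply/eqP => E; move: h1.
  by rewrite /h -/s -E mul0r leNgt mulr_gt0.
have sd : s <= d by rewrite lerBlDr lerDl.
exists x1, s; split => //.
- move=> y /(cube_normE _ _ (ltW s0)) ys; apply/(cube_normE _ _ (ltW d0)).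
  have -> : y - a = (y - x1) + (x1 - a) by rewrite addrA subrK.
  by apply: le_trans (ler_normD _ _) _; move: ys; rewrite /s; lra.
- rewrite -(ler_pM2r d0); apply: le_trans h1 _.
  by rewrite /h -/s mulrC ler_wpM2l.
- move=> y ys.
  have s2 : 0 < s / 2 by rewrite divr_gt0.
  have n1 := (cube_normE _ _ (ltW s2)).1 ys.
  have n2 : s / 2 <= d - `|y - a|.
    have : `|y - a| <= `|y - x1| + `|x1 - a|.
      have -> : y - a = (y - x1) + (x1 - a) by rewrite addrA subrK.
      exact: ler_normD.
    by move: n1; rewrite /s; lra.
  have : h y <= h x1.
    apply: hmax; rewrite inE; apply/(cube_normE _ _ (ltW d0)); lra.
  rewrite /h -/s => h2; rewrite -(ler_pM2l s2); apply: le_trans (_ : s * b x1 <= _); last lra.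
  by apply: le_trans h2; rewrite ler_wpM2r.
Qed.

(** Dominated convergence over the shells rho <= 1/(k+1): each point of the ball leaves them
    eventually. *)
Lemma tail_small (e : 'rV[R]_n -> R) (eps : R) : bint e -> (forall x, 0 <= e x) -> 0 < eps ->
  exists2 r0 : R, 0 < r0 &
    forall A : set 'rV[R]_n, measurable A -> A `<=` @hball R n -> (forall x, A x -> rho x <= r0) ->
    bint (fun x => e x * \1_A x) /\ bI (fun x => e x * \1_A x) < eps.
Proof.
move=> ie e0 eps0.
have mB := @measurable_hball R n.
pose T k := [set x : 'rV[R]_n | rho x <= k.+1%:R^-1].
have mT k : measurable (T k).
  apply: closed_measurable_rV.
  rewrite (_ : T k = @rho R n @^-1` `]-oo, k.+1%:R^-1]%classic); last first.
    by apply/seteqP; split => x; rewrite /T /preimage /= in_itv.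
  apply: closed_comp; last exact: interval_closed.
  by move=> x _; exact: (Ck_continuous (Ck_rho 0 (@openT _)) I).
have iT (A : set 'rV[R]_n) : measurable A -> bint (fun x => e x * \1_A x).
  move=> mA; apply: le_bint (ie) _.
    apply: measurable_funM; first exact: (bint_measurable ie).
    exact: measurable_indic mA.
  move=> x _; rewrite normrM ger0_norm// indicE.
  by case: (_ \in _); rewrite /= ?normr1 ?normr0 ?mulr1 ?mulr0.
have cvg0 : (fun k => bI (fun x => e x * \1_(T k) x)) @ \oo --> (0 : R).
  have := @dominated_cvg _ _ _ (lebesgue_rV n) (@hball R n) mB
    (fun k x => (e x * \1_(T k) x)%:E) (fun=> 0%E) (EFin \o e).
  rewrite integral0 => h; suff /fine_cvgP[_] :
    (fun k => \int[lebesgue_rV n]_(x in @hball R n) (e x * \1_(T k) x)%:E)%E @ \oo --> (0%R)%:E by [].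
  apply: h => //.
  - by move=> k; apply/measurable_EFinP; exact: (bint_measurable (iT _ (mT k))).
  - move=> x /hballE x0; apply: cvg_near_cst; near=> k.
    rewrite indicE memNset ?mulr0// /T /= => h; have : k.+1%:R^-1 < rho x.
      near: k; exact: near_infty_natSinv_lt (PosNum x0).
    by rewrite ltNge h.
  - move=> k x _; rewrite /= lee_fin normrM ger0_norm// indicE.
    by case: (_ \in _); rewrite /= ?normr1 ?normr0 ?mulr1 ?mulr0.
have [k hk] : exists k, bI (fun x => e x * \1_(T k) x) < eps.
  apply: (@filter_ex _ \oo); near=> k; near: k.
  exact: (cvgr_lt _ cvg0 _ eps0).
exists k.+1%:R^-1 => [|A mA AB Ar]; first by rewrite invr_gt0.
split; first exact: iT.
apply: le_lt_trans hk; apply: le_bI; [exact: iT|exact: (iT _ (mT k))|].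
move=> x _; rewrite ler_wpM2l// !indicE ler_nat.
have [xA|xA] := pselect (A x); last by rewrite memNset.
by rewrite !mem_set//; exact: Ar.
Unshelve. all: by end_near. Qed.

End geometry.

(** * A large value of |u| persists on a cube of the natural scale *)

Section large_values.
Context {R : realType} {n : nat}.
Variables (lambda p : R) (u : 'rV[R]_n -> R).
Hypotheses (n2 : (2 <= n)%N) (lambdan : lambda <= n%:R * (n%:R - 2) / 4) (p1 : 1 < p).
Hypotheses (uC2 : Ck 2 (@hball R n) u) (usol : weak_solution lambda p u).
Implicit Types (a x : 'rV[R]_n).

Lemma lap_conf x : hball x -> let s := (n%:R - 2) / 2 in
  lap (conf u s) x = conf u s x * rho x ^- 2 *
    (n%:R * (n%:R - 2) / 4 - lambda - `|u x| `^ (p - 1)).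
Proof.
move=> hx s; have := pde_conf p1 uC2 usol s hx; have x0 := (hballE _).1 hx.
have -> : 2 * s - n%:R + 2 = 0 by rewrite /s; field.
have -> : 2 * s - n%:R = - 2%:R by rewrite /s; field.
rewrite powR_invn ?ltW// => E.
have -> : lap (conf u s) x = \sum_i partial i (fun y => rho y `^ 0 * partial i (conf u s) y) x.
  apply: eq_bigr => i _; apply: (partial_ext i hball_open _ hx) => y _.
  by rewrite powRr0 mul1r.
rewrite E; congr (_ * (_ - _)).
by rewrite mul0r mul0r addr0 /s; field.
Qed.

(* At a point of size b the equation has length scale rho / b. *)
Definition usize x : R := `|u x| `^ ((p - 1) / 2).

Let q0 : 0 < p - 1. Proof. by rewrite subr_gt0. Qed.
Let q20 : 0 < (p - 1) / 2. Proof. by rewrite divr_gt0. Qed.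

Lemma usize_sqr x : usize x ^+ 2 = `|u x| `^ (p - 1).
Proof.
by rewrite /usize -powR_mulrn ?powR_ge0// -powRrM; congr (_ `^ _); field.
Qed.

Lemma usize_inv x : `|u x| = usize x `^ (2 / (p - 1)).
Proof.
rewrite /usize -powRrM.
have -> : (p - 1) / 2 * (2 / (p - 1)) = 1 by field; rewrite gt_eqF.
by rewrite powRr1.
Qed.

Lemma continuous_usize x : hball x -> {for x, continuous usize}.
Proof.
move=> hx; apply: (@continuous_comp _ _ _ u (fun t => `|t| `^ ((p - 1) / 2))).
  exact: (Ck_continuous uC2).
exact: continuous_norm_powR.
Qed.

(** Point picking bounds u, hence v = [conf u s] and its Laplacian, around [x1]. The gradient
    estimate then keeps v within half of |v(x1)| on a cube of radius delta rho / b, and the factor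
    rho^s is nearly constant there. The sign [sg] is that of u(x1). *)
Lemma large_on_cube : exists c delta : R, [/\ 0 < c, 0 < delta &
  forall a, hball a -> 4^-1 <= usize a -> exists x1 sg,
    let r := delta * rho a / usize x1 in
    [/\ `|sg| = 1, 4^-1 <= usize x1, cube x1 r `<=` cube a (rho a / (4 * n%:R))
      & forall x, cube x1 r x -> c * `|u x1| <= sg * u x]].
Proof.
pose s : R := (n%:R - 2) / 2.
have N2 : 2 <= n%:R :> R by rewrite (ler_nat _ 2).
have N0 : 0 < n%:R :> R by lra.
have s0 : 0 <= s by rewrite /s; lra.
have ngt0 : (0 < n)%N by exact: ltnW.
pose La : R := n%:R * (n%:R - 2) / 4 - lambda.
have La0 : 0 <= La by rewrite subr_ge0.
(* Bounds the Laplacian in units of M b1^2 / rho(a)^2: 4 comes from rho^-2, the bracket from the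
   linear and nonlinear coefficients, and the +1 makes the bound strict. *)
pose C1 : R := 4 * (16 * La + 4) + 1.
have C10 : 0 < C1 by rewrite /C1; lra.
(* The value of n M / d + F d / 2 in units of M b1 / rho(a), for d = rho(a) / (64 n b1). *)
pose C2 : R := 64 * n%:R ^+ 2 + C1 / (128 * n%:R).
have C20 : 0 < C2 by rewrite addr_gt0 ?divr_gt0 ?mulr_gt0 ?exprn_gt0.
(* The growth allowed for |u| when [usize] doubles. *)
pose K2 : R := 2 `^ (2 / (p - 1)).
have K20 : 0 < K2 by rewrite powR_gt0.
(* The oscillation of rho^s on the cube, where rho lies between rho(a)/2 and 2 rho(a). *)
pose fs : R := 4 `^ s.
have fs0 : 0 < fs by rewrite powR_gt0.
(* The first summand ensures r <= d, the second that v oscillates by at most |v(x1)| / 2. *)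
pose delta : R := (64 * n%:R + 2 * n%:R * C2 * K2 * fs)^-1.
have D0 : 0 < 2 * n%:R * C2 * K2 * fs by rewrite !mulr_gt0.
have D1 : 0 < 64 * n%:R + 2 * n%:R * C2 * K2 * fs by rewrite addr_gt0// mulr_gt0.
have delta0 : 0 < delta by rewrite invr_gt0.
exists (fs^-1 / 2), delta; split => //; first by rewrite divr_gt0// invr_gt0.
move=> a ha ba; have a0 := (hballE _).1 ha.
set d0 := rho a / (4 * n%:R).
have d00 : 0 < d0 by rewrite divr_gt0// mulr_gt0.
have geo x : cube a d0 x -> [/\ hball x, rho a / 2 <= rho x & rho x <= 2 * rho a].
  exact: rho_cube.
have b40 : 0 < 4^-1 :> R by rewrite invr_gt0.
have cb x : cube a d0 x -> {for x, continuous usize}.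
  by move=> /geo[hx _ _]; exact: continuous_usize.
have bge0 x : 0 <= usize x by exact: powR_ge0.
have [x1 [t [t0 tsub tb1 b1ge bx]]] := point_picking d00 b40 cb bge0 ba.
set b1 := usize x1 in tb1 b1ge bx *.
have b10 : 0 < b1 by exact: lt_le_trans b1ge.
exists x1, (Num.sg (u x1)); set r := delta * rho a / b1.
(* Point picking gives t b1 >= rho(a) / (16 n), so that 2d <= t/2 and the doubling bound holds on
   the cube of radius 2d. *)
pose d := rho a / (64 * n%:R * b1).
have dd0 : 0 < d by rewrite divr_gt0// !mulr_gt0.
have d2t : 2 * d <= t / 2.
  suff : d0 / 4 <= t * b1 -> 2 * d <= t / 2 by apply; rewrite mulrC.
  rewrite -ler_pdivrMr// => h; have -> : 2 * d = (d0 / 4 / b1) / 2; last lra.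
  by rewrite /d /d0; field; rewrite !gt_eqF.
have tt : t / 2 <= t by lra.
have sub2 : cube x1 (2 * d) `<=` cube a d0.
  by apply: subset_trans tsub; apply: le_cube; lra.
have A0 : 0 < `|u x1|.
  rewrite normr_gt0; apply/eqP => E; move: b10; rewrite /b1 /usize E normr0 powR0 ?ltxx// gt_eqF//.
set A := `|u x1| in A0 *.
pose P := (rho a / 2) `^ (- s).
have P0 : 0 < P by rewrite powR_gt0// divr_gt0.
pose M := P * K2 * A.
have M0 : 0 < M by rewrite !mulr_gt0.
have ub x : cube x1 (2 * d) x -> `|u x| <= K2 * A.
  move=> hx; rewrite /A (usize_inv x) (usize_inv x1) -powRM ?powR_ge0//.
  rewrite ge0_ler_powR ?nnegrE ?powR_ge0//; first by rewrite divr_ge0// ltW.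
    by rewrite mulr_ge0// powR_ge0.
  by apply: bx; apply: le_cube hx.
have powN (x y : R) : 0 < x -> x <= y -> y `^ (- s) <= x `^ (- s).
  move=> x0 xy; rewrite !powRN lef_pV2 ?posrE ?powR_gt0//; last exact: lt_le_trans xy.
  by rewrite ge0_ler_powR ?nnegrE ?(ltW x0)// (le_trans (ltW x0)).
have ra2 : 0 < rho a / 2 by rewrite divr_gt0.
have vM x : cube x1 (2 * d) x -> `|conf u s x| <= M.
  move=> hx; have [_ h1 _] := geo _ (sub2 _ hx).
  rewrite /conf normrM ger0_norm ?powR_ge0// /M -mulrA.
  by apply: ler_pM; rewrite ?powR_ge0//; [exact: powN|exact: ub].
pose F := M * C1 * b1 ^+ 2 / rho a ^+ 2.
have ra0 : 0 < rho a ^+ 2 by rewrite exprn_gt0.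
have b12 : 0 < b1 ^+ 2 by rewrite exprn_gt0.
(* The lower bound 1/4 on [usize] serves to absorb the constant [La] into a multiple of b1^2. *)
have b1sq : 1 <= 16 * b1 ^+ 2.
  have -> : 16 * b1 ^+ 2 = (4 * b1) ^+ 2 by ring.
  by rewrite expr_ge1//; lra.
have vF x : cube x1 (2 * d) x -> `|lap (conf u s) x| < F.
  move=> hx; have [hbx h1 _] := geo _ (sub2 _ hx).
  have x0 := (hballE _).1 hbx.
  rewrite lap_conf// -/s -/La -usize_sqr.
  move: (conf u s x) (vM _ hx) => vx hv; rewrite !normrM normfV normrX (gtr0_norm x0).
  have r2 : rho x ^- 2 <= 4 / rho a ^+ 2.
    have -> : 4 / rho a ^+ 2 = (rho a / 2) ^- 2 by field; rewrite gt_eqF.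
    rewrite lef_pV2 ?posrE ?exprn_gt0// lerXn2r// nnegrE ltW//.
  have h2 : `|La - usize x ^+ 2| <= (16 * La + 4) * b1 ^+ 2.
    have h3 : usize x ^+ 2 <= (2 * b1) ^+ 2.
      rewrite lerXn2r// ?nnegrE ?powR_ge0//; first by rewrite mulr_ge0// ltW.
      by apply: bx; apply: le_cube hx.
    have h4 : La <= 16 * La * b1 ^+ 2 by rewrite mulrAC -[X in X <= _]mul1r ler_wpM2r.
    have h5 := sqr_ge0 (usize x).
    by rewrite ler_norml; apply/andP; split; rewrite exprMn in h3; lra.
  apply: (@le_lt_trans _ _ (M * (4 / rho a ^+ 2) * ((16 * La + 4) * b1 ^+ 2))).
    apply: ler_pM => //; first by rewrite mulr_ge0// invr_ge0 exprn_ge0// ltW.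
    by apply: ler_pM => //; rewrite invr_ge0 exprn_ge0// ltW.
  rewrite /F /C1; have -> : M * (4 * (16 * La + 4) + 1) * b1 ^+ 2 / rho a ^+ 2 =
    M * (4 / rho a ^+ 2) * ((16 * La + 4) * b1 ^+ 2) + M * b1 ^+ 2 / rho a ^+ 2 by ring.
  by rewrite ltrDl divr_gt0// mulr_gt0.
have rd : r <= d.
  have -> : d = (64 * n%:R)^-1 * rho a / b1 by rewrite /d; field; rewrite !gt_eqF.
  rewrite /r ler_wpM2r ?invr_ge0 ?(ltW b10)// ler_wpM2r ?(ltW a0)//.
  by rewrite lef_pV2 ?posrE// ?mulr_gt0// lerDl ltW.
have lip := brandt_lipschitz hball_open (Ck_conf uC2 s) dd0 _ vM vF rd.
have {lip} lip := lip (fun x hx => let: And3 h _ _ := geo _ (sub2 _ hx) in h).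
have hx1 : cube a d0 x1 by apply: tsub; exact/cube_center/ltW.
have [hb1 _ rx1] := geo _ hx1; have x10 := (hballE _).1 hb1.
have v1ge : fs^-1 * P * A <= `|conf u s x1|.
  rewrite /conf normrM (ger0_norm (powR_ge0 _ _)) -/A ler_wpM2r ?(ltW A0)//.
  have -> : fs^-1 * P = (2 * rho a) `^ (- s).
    rewrite /fs /P -powRN -powRM//; last by rewrite ltW.
    by congr (_ `^ _); field.
  exact: powN.
have v1half x : cube x1 r x -> `|conf u s x - conf u s x1| <= `|conf u s x1| / 2.
  move=> hx; apply: le_trans (lip x hx) _.
  have -> : n%:R * r * (n%:R * M / d + F * d / 2) = delta * (2 * n%:R * C2 * K2 * fs) * (fs^-1 * P * A) / 2.
    by rewrite /r /d /F /C2 /M; field; rewrite !gt_eqF.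
  rewrite ler_pM2r ?invr_gt0//.
  apply: le_trans v1ge; rewrite -[leRHS]mul1r ler_wpM2r//.
    by rewrite !mulr_ge0 ?invr_ge0 ?(ltW fs0) ?(ltW P0) ?(ltW A0).
  by rewrite mulrC ler_pdivrMr// mul1r lerDr mulr_ge0// ltW.
split => //.
- by rewrite normr_sg -normr_gt0 -/A A0.
- by apply: subset_trans sub2; apply: le_cube; lra.
- move=> x hx; have hx2 : cube x1 (2 * d) x by apply: le_cube hx; lra.
  have [hbx h1 _] := geo _ (sub2 _ hx2); have x0 := (hballE _).1 hbx.
  rewrite (confK u s hbx).
  have := v1half x hx; set v := conf u s x; set v1 := conf u s x1 => hv.
  have sgE : Num.sg (u x1) * v1 = `|v1|.
    by rewrite /v1 /conf mulrCA -normrEsg normrM ger0_norm// powR_ge0.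
  have hv2 : `|v1| / 2 <= Num.sg (u x1) * v.
    have : `|Num.sg (u x1) * (v - v1)| <= `|v1| / 2.
      by rewrite normrM normr_sg -normr_gt0 -/A A0 mul1r.
    by rewrite mulrBr sgE ler_norml => /andP[h2 _]; lra.
  rewrite mulrCA; apply: (@le_trans _ _ (P^-1 * (`|v1| / 2))).
    have -> : fs^-1 / 2 * A = P^-1 * (fs^-1 * P * A / 2) by field; rewrite !gt_eqF.
    by rewrite ler_wpM2l ?invr_ge0 ?(ltW P0)// ler_pM2r ?invr_gt0.
  apply: ler_pM => //; first by rewrite invr_ge0 ltW.
  rewrite /P powRN invrK ge0_ler_powR ?nnegrE ?(ltW x0) ?(ltW ra2)//.
Qed.

End large_values.

(** * The energy density and the equation tested with a bump *)

Section energy.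
Context {R : realType} {n : nat}.
Variables (lambda p : R) (u : 'rV[R]_n -> R) (g : 'rV[R]_n -> 'rV[R]_n).
Hypotheses (n2 : (2 <= n)%N) (p1 : 1 < p).
Hypotheses (uC2 : Ck 2 (@hball R n) u) (usol : weak_solution lambda p u).
Hypothesis wg : weak_gradient (@hball R n) u g.
Hypothesis ufin : (hintegral (fun x => hgrad_dot x (g x) (g x) + u x ^+ 2)%R < +oo)%E.
Implicit Types (a x : 'rV[R]_n).

(** Inside the ball the absolute value changes nothing; outside, where rho may be negative, it gives
    the nonnegativity required by [tail_small]. *)
Definition energy x : R := `|(hgrad_dot x (g x) (g x) + u x ^+ 2) * rho x ^- n|.

Lemma hgrad_dot_ge0 x v : 0 <= hgrad_dot x v v :> R.
Proof.
rewrite /hgrad_dot mulr_ge0 ?sqr_ge0// /edot sumr_ge0// => i _.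
by rewrite -expr2 sqr_ge0.
Qed.

Lemma energyE x : hball x -> energy x = (hgrad_dot x (g x) (g x) + u x ^+ 2) * rho x ^- n.
Proof.
move=> /hballE x0; rewrite /energy ger0_norm// mulr_ge0//.
  by rewrite addr_ge0 ?hgrad_dot_ge0 ?sqr_ge0.
by rewrite invr_ge0 exprn_ge0// ltW.
Qed.

Lemma measurable_rhoN : measurable_fun (@hball R n) (fun x : 'rV[R]_n => rho x ^- n).
Proof.
apply: (continuous_measurable_rV hball_open) => x hx; exact: continuous_rhoN.
Qed.

Lemma energy_bint : bint energy.
Proof.
have [lu lg _] := wg.
have mu : measurable_fun (@hball R n) u by have [] := lu.
have mf : measurable_fun (@hball R n) energy.
  apply: measurableT_comp; first exact: normr_measurable.
  apply: measurable_funM; last exact: measurable_rhoN.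
  apply: measurable_funD; last exact: (measurable_funX 2 mu).
  apply: measurable_funM.
    apply: (continuous_measurable_rV hball_open) => x _.
    have c := Ck_continuous (Ck_rho 0 (@openT 'rV[R]_n)) (I : setT x).
    exact: (cvgM c c).
  apply: measurable_sum => i; have mg : measurable_fun (@hball R n) (fun x => g x 0 i) by have [] := lg i.
  exact: (measurable_funM mg mg).
apply/integrableP; split; first exact/measurable_EFinP.
rewrite (eq_integral (fun x => ((hgrad_dot x (g x) (g x) + u x ^+ 2) * rho x ^- n)%:E))//.
move=> x /[!inE] hx; rewrite /= ger0_norm ?energyE//.
by rewrite -energyE// normr_ge0.
Qed.

Let q0 : 0 < p - 1. Proof. by rewrite subr_gt0. Qed.

(** Tested with a bump, the nonlinear term is bounded below on a smaller cube, while Young's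
    inequality splits the gradient and linear terms into t times the energy and 1/(4t) times the
    size of the bump. The parameter t stays free for [vanishing]. *)
Lemma energy_inequality : exists2 C : R, 0 < C & forall a x1 sg r c t E,
  hball a -> `|sg| = 1 -> 0 < r -> 0 < c -> 0 < t ->
  cube x1 r `<=` cube a (rho a / (4 * n%:R)) ->
  (forall x, cube x1 r x -> c <= sg * u x) ->
  bint (fun x => energy x * \1_(cube x1 r) x) ->
  bI (fun x => energy x * \1_(cube x1 r) x) <= E ->
  c `^ p * theta 2^-1 * (2 * rho a) ^- n * (r / n.+1%:R) ^+ n <=
  t * E + (4 * t)^-1 * (rho a ^+ 2 * C / r ^+ 2 + lambda ^+ 2) * (rho a / 2) ^- n * (2 * r) ^+ n.
Proof.
have [Cb Cb0 hCb] := @partial_bump_le R n.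
have N2 : 2 <= n%:R :> R by rewrite (ler_nat _ 2).
have ngt0 : (0 < n)%N by exact: ltnW.
(* From rho^2 |grad phi|^2 <= (2 rho(a))^2 n (Cb / r)^2. *)
exists (4 * n%:R * Cb ^+ 2); first by rewrite !mulr_gt0 ?exprn_gt0//; lra.
move=> a x1 sg r c t E ha sg1 r0 c0 t0 sub uc ie hE.
have a0 := (hballE _).1 ha.
have geo x : cube x1 r x -> [/\ hball x, rho a / 2 <= rho x & rho x <= 2 * rho a].
  by move=> /sub; exact: rho_cube.
have rB : cube x1 r `<=` @hball R n by move=> x /geo[].
have tphi := ball_bump_test r0 rB.
set phi := ball_bump x1 r in tphi.
have [K [cK clK KB p0 dp0]] := test_function_supp tphi.
have phi0 x : ~ cube x1 r x -> phi x = 0 by exact: ball_bump_eq0.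
have dphi0 i x : ~ cube x1 r x -> partial i phi x = 0.
  by apply: partial_supp; [exact: cube_closed|exact: phi0].
have cu x : hball x -> {for x, continuous u} by exact: (Ck_continuous uC2).
have cphi x : {for x, continuous phi} by exact: (Ck_continuous (Ck_bump 0 x1 r) I).
have ibl (f : 'rV[R]_n -> R) : (forall x, hball x -> {for x, continuous f}) -> bint (fun x => f x * phi x).
  move=> cf; apply: (bint_loc_mul (@cube_compact _ _ x1 r) rB) => //.
  exact: loc_integrable_continuous.
have [iF _ _] := weak_kap wg tphi cu.
have i1 : bint (fun x => `|u x| `^ (p - 1) * u x * phi x * rho x ^- n).
  apply: (@eq_bint _ _ (fun x => (`|u x| `^ (p - 1) * u x * rho x ^- n) * phi x)).
    by move=> y _; ring.
  apply: ibl => y hy.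
  exact: (cvgM (cvgM (continuous_norm_u_powR p1 uC2 hy) (cu _ hy)) (continuous_rhoN hy)).
have i2 : bint (fun x => u x * phi x * rho x ^- n).
  apply: (@eq_bint _ _ (fun x => (u x * rho x ^- n) * phi x)); first by move=> y _; ring.
  by apply: ibl => y hy; exact: (cvgM (cu _ hy) (continuous_rhoN hy)).
have wf := weak_form uC2 usol wg tphi.
set F := fun x => hgrad_dot x (g x) (grad phi x) * rho x ^- n in iF wf.
have rn x : hball x -> 0 < rho x ^- n by move=> /hballE x0; rewrite invr_gt0 exprn_gt0.
pose f x := sg * (`|u x| `^ (p - 1) * u x * phi x * rho x ^- n).
have fE x : f x = sg * (`|u x| `^ (p - 1) * u x) * phi x * rho x ^- n by rewrite /f; ring.
have ufc x : cube x1 r x -> c `^ p <= sg * (`|u x| `^ (p - 1) * u x).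
  move=> hx; have h := uc _ hx.
  have h2 : c <= `|u x|.
    by apply: le_trans h _; apply: le_trans (ler_norm _) _; rewrite normrM sg1 mul1r.
  rewrite -mulr_powRB1 ?(ltW c0) ?(lt_trans ltr01)// mulrCA mulrC.
  apply: ler_pM; rewrite ?powR_ge0 ?(ltW c0)//.
  by rewrite ge0_ler_powR ?nnegrE ?normr_ge0 ?(ltW c0) ?(ltW q0).
have low : c `^ p * theta 2^-1 * (2 * rho a) ^- n * (r / n.+1%:R) ^+ n <= bI f.
  (* The cube on which the bump is at least theta(1/2). *)
  pose r' := r / (2 * n.+1%:R).
  have r'0 : 0 < r' by rewrite divr_gt0// mulr_gt0.
  have r'r : r' <= r.
    rewrite ler_pdivrMr ?mulr_gt0// ler_peMr ?(ltW r0)//.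
    have : (1 : R) <= n.+1%:R by rewrite ler1n.
    lra.
  have -> : r / n.+1%:R = r' *+ 2 by rewrite /r' -mulr_natr; field; rewrite gt_eqF.
  apply: (@bI_cube_ge _ _ x1) => //.
  - by move=> y /(le_cube r'r); exact: rB.
  - exact: bintZ.
  - move=> x hx; have [hxr|hxr] := pselect (cube x1 r x); last first.
      by rewrite /f phi0// !(mulr0, mul0r).
    rewrite fE mulr_ge0 ?(ltW (rn _ hx))// mulr_ge0 ?ball_bump_ge0//.
    by apply: le_trans (ufc _ hxr); exact: powR_ge0.
  - move=> x hx; have hxr := le_cube r'r hx; have [hbx _ h3] := geo _ hxr.
    have x0 := (hballE _).1 hbx.
    rewrite fE; apply: ler_pM.
    + by rewrite mulr_ge0 ?powR_ge0// theta_ge0.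
    + by rewrite invr_ge0 exprn_ge0// mulr_ge0// ltW.
    + apply: ler_pM; rewrite ?powR_ge0 ?theta_ge0//; [exact: ufc|exact: ball_bump_ge].
    + have h2a : 0 < 2 * rho a by rewrite mulr_gt0.
      by rewrite lef_pV2 ?posrE ?exprn_gt0// lerXn2r ?nnegrE ?(ltW x0) ?(ltW h2a).
apply: le_trans low _.
have -> : bI f = bI (fun x => sg * F x - sg * lambda * (u x * phi x * rho x ^- n)).
  by rewrite bIB ?bIZ//; [rewrite wf; ring|exact: bintZ|exact: bintZ].
pose D := (4 * t)^-1 * (rho a ^+ 2 * (4 * n%:R * Cb ^+ 2) / r ^+ 2 + lambda ^+ 2) * (rho a / 2) ^- n.
have t40 : 0 < (4 * t)^-1 by rewrite invr_gt0 mulr_gt0.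
have iI := bint_indic_cube rB.
apply: (@le_trans _ _ (bI (fun x => t * (energy x * \1_(cube x1 r) x) + D * \1_(cube x1 r) x))); last first.
  rewrite bID ?bIZ//; [|exact: bintZ|exact: bintZ].
  rewrite bI_indic_cube ?(ltW r0)// [2 * r]mulr_natl lerD2r.
  by rewrite ler_pM2l.
apply: le_bI.
- by apply: bintB; exact: bintZ.
- by apply: bintD; exact: bintZ.
move=> x hx; rewrite indicE.
have [hxr|hxr] := pselect (cube x1 r x); last first.
  rewrite memNset// /F phi0// /hgrad_dot /edot big1 => [|i _]; last by rewrite mxE dphi0// mulr0.
  by rewrite !(mulr0, mul0r) subr0 addr0.
rewrite mem_set//= !mulr1 energyE//.
have [_ h2 h3] := geo _ hxr; have x0 := (hballE _).1 hx; have rx := rn _ hx.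
(* Young's inequality with a sign, used for the gradient pairing and for the term in lambda. *)
have yg (s A B : R) : `|s| = 1 -> s * (A * B) <= t * A ^+ 2 + (4 * t)^-1 * B ^+ 2.
  move=> s1; have s2 : s ^+ 2 = 1 by rewrite -(real_normK (num_real s)) s1 expr1n.
  have : 0 <= t * (A - (2 * t)^-1 * (s * B)) ^+ 2 by rewrite mulr_ge0 ?sqr_ge0// ltW.
  have -> : t * (A - (2 * t)^-1 * (s * B)) ^+ 2 =
      t * A ^+ 2 - s * (A * B) + (4 * t)^-1 * (s ^+ 2 * B ^+ 2) by field; rewrite gt_eqF.
  by rewrite s2 mul1r; lra.
have G1 : sg * hgrad_dot x (g x) (grad phi x) <=
    t * hgrad_dot x (g x) (g x) + (4 * t)^-1 * (rho a ^+ 2 * (4 * n%:R * Cb ^+ 2) / r ^+ 2).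
  apply: (@le_trans _ _ (rho x ^+ 2 * \sum_i (t * g x 0 i ^+ 2 + (4 * t)^-1 * (Cb / r) ^+ 2))).
    rewrite /hgrad_dot /edot mulrCA ler_wpM2l ?sqr_ge0// mulr_sumr; apply: ler_sum => i _.
    apply: le_trans (yg _ _ _ sg1) _; rewrite lerD2l ler_pM2l// mxE.
    rewrite -(real_normK (num_real (partial i phi x))) lerXn2r ?nnegrE ?normr_ge0//.
      by rewrite divr_ge0// ltW.
    exact: hCb.
  rewrite big_split /= sumr_const card_ord -mulr_sumr -[_ *+ n]mulr_natl mulrDr lerD//.
    rewrite /hgrad_dot /edot mulrCA; rewrite le_eqVlt; apply/orP; left; apply/eqP.
    by congr (_ * (_ * _)); apply: eq_bigr => i _; rewrite expr2.
  have -> : rho x ^+ 2 * (n%:R * ((4 * t)^-1 * (Cb / r) ^+ 2)) =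
    ((4 * t)^-1 * (n%:R * (Cb / r) ^+ 2)) * rho x ^+ 2 by ring.
  have -> : (4 * t)^-1 * (rho a ^+ 2 * (4 * n%:R * Cb ^+ 2) / r ^+ 2) =
    ((4 * t)^-1 * (n%:R * (Cb / r) ^+ 2)) * (2 * rho a) ^+ 2 by field; rewrite !gt_eqF.
  apply: ler_wpM2l; first by rewrite mulr_ge0 ?(ltW t40)// mulr_ge0 ?sqr_ge0//; lra.
  by rewrite lerXn2r ?nnegrE ?(ltW x0)// mulr_ge0// ltW.
have G2 : - (sg * lambda * (u x * phi x)) <= t * u x ^+ 2 + (4 * t)^-1 * lambda ^+ 2.
  have := @yg (- sg) (u x) (lambda * phi x); rewrite normrN => /(_ sg1) h.
  have -> : - (sg * lambda * (u x * phi x)) = - sg * (u x * (lambda * phi x)) by ring.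
  apply: le_trans h _; rewrite lerD2l ler_pM2l// exprMn ler_piMr ?sqr_ge0//.
  by rewrite expr_le1 ?ball_bump_ge0 ?ball_bump_le1.
have G3 : rho x ^- n <= (rho a / 2) ^- n.
  have ra2 : 0 < rho a / 2 by rewrite divr_gt0.
  by rewrite lef_pV2 ?posrE ?exprn_gt0// lerXn2r ?nnegrE ?(ltW x0) ?(ltW ra2).
set Q := (4 * t)^-1 * (rho a ^+ 2 * (4 * n%:R * Cb ^+ 2) / r ^+ 2 + lambda ^+ 2).
have Q0 : 0 <= Q.
  rewrite mulr_ge0 ?(ltW t40)// addr_ge0 ?sqr_ge0// divr_ge0 ?sqr_ge0//.
  by rewrite mulr_ge0 ?sqr_ge0// mulr_ge0 ?sqr_ge0//; lra.
apply: (@le_trans _ _ (t * ((hgrad_dot x (g x) (g x) + u x ^+ 2) * rho x ^- n) + Q * rho x ^- n)).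
  have -> : sg * F x - sg * lambda * (u x * phi x * rho x ^- n) =
    (sg * hgrad_dot x (g x) (grad phi x) - sg * lambda * (u x * phi x)) * rho x ^- n.
    by rewrite /F; ring.
  have -> : t * ((hgrad_dot x (g x) (g x) + u x ^+ 2) * rho x ^- n) + Q * rho x ^- n =
    (t * (hgrad_dot x (g x) (g x) + u x ^+ 2) + Q) * rho x ^- n by ring.
  rewrite ler_wpM2r ?(ltW rx)//.
  by rewrite /Q mulrDr; lra.
by rewrite lerD2l /D -/Q ler_wpM2l.
Qed.

End energy.

(** * Smallness of u near the boundary *)

Section vanishing.
Context {R : realType} {n : nat}.
Variables (lambda p : R) (u : 'rV[R]_n -> R) (g : 'rV[R]_n -> 'rV[R]_n).
Hypotheses (n2 : (2 <= n)%N) (lambdan : lambda <= n%:R * (n%:R - 2) / 4) (p1 : 1 < p).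
Hypothesis pn : (2 < n)%N -> p <= (n%:R + 2) / (n%:R - 2).
Hypotheses (uC2 : Ck 2 (@hball R n) u) (usol : weak_solution lambda p u).
Hypothesis wg : weak_gradient (@hball R n) u g.
Hypothesis ufin : (hintegral (fun x => hgrad_dot x (g x) (g x) + u x ^+ 2)%R < +oo)%E.
Implicit Types (a x : 'rV[R]_n).

(** Clearing the denominator gives p(n-2) <= n+2; in dimension 2 the inequality reads 4p >=
    4(p-1). *)
Lemma subcritical : 0 <= 4 * p / (p - 1) - (n%:R + 2).
Proof.
have q0 : 0 < p - 1 by rewrite subr_gt0.
rewrite subr_ge0 ler_pdivlMr//.
have [n3|] := ltnP 2 n; last first.
  move=> h; have -> : n = 2%N by apply/eqP; rewrite eqn_leq h n2.
  lra.
have := pn n3; have n20 : 0 < n%:R - 2 :> R by rewrite subr_gt0 ltr_nat.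
by rewrite ler_pdivlMr//; lra.
Qed.

(* Testing the equation with a bump on the cube where u is large, the exponent
   [subcritical] bounds the energy there from below by a fixed constant. *)
Lemma vanishing : exists2 r0 : R, 0 < r0 &
  forall x, hball x -> rho x <= r0 -> `|u x| `^ (p - 1) <= 16^-1.
Proof.
have q0 : 0 < p - 1 by rewrite subr_gt0.
have [c [delta [c0 delta0 large]]] := large_on_cube n2 lambdan p1 uC2 usol.
have [C C0 EI] := energy_inequality n2 p1 uC2 usol wg.
pose e' := 4 * p / (p - 1) - (n%:R + 2).
have e'0 : 0 <= e' by exact: subcritical.
have th0 : 0 < theta 2^-1 :> R by rewrite theta_gt0// invr_gt0.
have N0 : 0 < 2 * n.+1%:R :> R by rewrite mulr_gt0.
pose c1 := c `^ p * theta 2^-1 / (2 * n.+1%:R) ^+ n.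
have c10 : 0 < c1 by rewrite !mulr_gt0 ?powR_gt0// invr_gt0 exprn_gt0.
pose C4 := (C + lambda ^+ 2 * (4 * delta) ^+ 2) * 4 ^+ n / 4.
have C40 : 0 < C4.
  rewrite divr_gt0// mulr_gt0 ?exprn_gt0// ltr_wpDr// mulr_ge0 ?sqr_ge0//.
(* The lower bound that the energy will have to satisfy, with b1 replaced by its least value 1/4;
   the exponent [e'] being nonnegative, this is the worst case. *)
pose eps := c1 ^+ 2 * delta ^+ n.+2 * 4^-1 `^ e' / (4 * C4).
have eps0 : 0 < eps.
  apply: divr_gt0; last exact: mulr_gt0.
  by rewrite mulr_gt0 ?powR_gt0 ?invr_gt0// mulr_gt0// exprn_gt0.
have en0 x : 0 <= energy u g x by exact: normr_ge0.
have [r1 r10 tail] := tail_small (energy_bint wg ufin) en0 eps0.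
(* On the cube rho is at most 2 rho(a), so halving [r1] keeps the cube in the region of small
   energy. *)
exists (r1 / 2); first by rewrite divr_gt0.
move=> a ha ra; rewrite -usize_sqr leNgt; apply/negP => ba.
have a0 := (hballE _).1 ha.
have ea : 0 < 1 - enorm a ^+ 2 by move: a0; rewrite /rho; lra.
have ba4 : 4^-1 <= usize p u a.
  rewrite leNgt; apply/negP => h; move: ba; rewrite ltNge => /negP; apply.
  have -> : 16^-1 = 4^-1 ^+ 2 :> R by field.
  by rewrite lerXn2r ?nnegrE ?powR_ge0 ?(ltW h)// invr_ge0.
have [x1 [sg [sg1 b1ge sub uc]]] := large a ha ba4.
set b1 := usize p u x1 in b1ge sub uc.
have b10 : 0 < b1 by apply: lt_le_trans b1ge; rewrite invr_gt0.
pose y := delta / b1.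
have y0 : 0 < y by rewrite divr_gt0.
have rE : delta * rho a / b1 = y * rho a by rewrite /y; ring.
rewrite rE in sub uc; set r := y * rho a in sub uc.
have r0 : 0 < r by rewrite mulr_gt0.
have AE : `|u x1| = b1 `^ (2 / (p - 1)) by exact: usize_inv.
have A0 : 0 < `|u x1| by rewrite AE powR_gt0.
have geo x : cube x1 r x -> [/\ hball x, rho a / 2 <= rho x & rho x <= 2 * rho a].
  by move=> /sub; apply: rho_cube => //; exact: ltnW.
have [|||ie E_small] := tail (cube x1 r).
- exact: measurable_cube.
- by move=> x /geo[].
- by move=> x /geo[_ _]; lra.
set E := bI _ in E_small.
pose X := `|u x1| `^ p.
have X0 : 0 < X by rewrite powR_gt0.
(* Makes the second term of Young's inequality at most half of the left-hand side. *)
pose t := 2 * C4 / (c1 * X * y ^+ 2).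
have y2 : 0 < y ^+ 2 by rewrite exprn_gt0.
have t0 : 0 < t.
  by apply: divr_gt0; [exact: mulr_gt0|apply: mulr_gt0 => //; exact: mulr_gt0].
have := EI a x1 sg r _ t E ha sg1 r0 (mulr_gt0 c0 A0) t0 sub uc ie (lexx _).
have -> : (c * `|u x1|) `^ p * theta 2^-1 * (2 * rho a) ^- n * (r / n.+1%:R) ^+ n = c1 * X * y ^+ n.
  rewrite powRM ?(ltW c0)// /c1 /X /r !exprMn !exprVn; field.
  by rewrite !expf_neq0 ?gt_eqF.
have -> : (4 * t)^-1 * (rho a ^+ 2 * C / r ^+ 2 + lambda ^+ 2) * (rho a / 2) ^- n * (2 * r) ^+ n =
    (4 * t)^-1 * (C / y ^+ 2 + lambda ^+ 2) * 4 ^+ n * y ^+ n.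
  rewrite /r; have -> : (4 : R) = 2 * 2 by ring.
  rewrite !exprMn !exprVn; field.
  by rewrite !expf_neq0 ?gt_eqF.
move=> h.
(* Since b1 >= 1/4. It lets lambda^2 be absorbed into a multiple of 1/y^2, like the term coming from
   the gradient of the bump. *)
have y4 : y <= 4 * delta.
  rewrite /y ler_pdivrMr// mulrAC -[leLHS]mul1r ler_wpM2r ?(ltW delta0)//.
  by have := b1ge; lra.
have h1 : lambda ^+ 2 <= lambda ^+ 2 * (4 * delta) ^+ 2 / y ^+ 2.
  rewrite ler_pdivlMr// ler_wpM2l ?sqr_ge0// lerXn2r ?nnegrE ?(ltW y0)//.
  by rewrite mulr_ge0// ltW.
have yn : 0 < y ^+ n by rewrite exprn_gt0.
have h2 : (4 * t)^-1 * (C / y ^+ 2 + lambda ^+ 2) * 4 ^+ n * y ^+ n <= c1 * X * y ^+ n / 2.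
  have -> : c1 * X * y ^+ n / 2 =
      (4 * t)^-1 * (C / y ^+ 2 + lambda ^+ 2 * (4 * delta) ^+ 2 / y ^+ 2) * 4 ^+ n * y ^+ n.
    transitivity (t^-1 * (C4 / y ^+ 2) * y ^+ n).
      by rewrite /t; field; rewrite !gt_eqF.
    by rewrite /C4; field; rewrite !gt_eqF.
  apply: ler_wpM2r; first exact: ltW.
  apply: ler_wpM2r; first exact: exprn_ge0.
  apply: ler_wpM2l; first by rewrite invr_ge0 mulr_ge0// ltW.
  by rewrite lerD2l.
have h3 : c1 * X * y ^+ n / 2 <= t * E by lra.
have h4 : c1 ^+ 2 * (X ^+ 2 * y ^+ n.+2) <= 4 * C4 * E.
  have k0 : 0 < (2 * c1 * X * y ^+ 2)^-1.
    by rewrite invr_gt0; do 3 apply: mulr_gt0 => //.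
  rewrite -(ler_pM2l k0).
  have -> : (2 * c1 * X * y ^+ 2)^-1 * (4 * C4 * E) = t * E by rewrite /t; field; rewrite !gt_eqF.
  apply: le_trans h3; rewrite le_eqVlt; apply/orP; left; apply/eqP.
  have -> : y ^+ n.+2 = y ^+ n * y ^+ 2 by rewrite -exprD addn2.
  by field; rewrite !gt_eqF.
(* Here |u(x1)| = b1^(2/(p-1)) and y = delta / b1 produce the exponent of [subcritical]. *)
have h5 : X ^+ 2 * y ^+ n.+2 = delta ^+ n.+2 * b1 `^ e'.
  rewrite /y exprMn exprVn /X AE -powRrM -powR_mulrn ?powR_ge0// -powRrM.
  rewrite mulrCA; congr (_ * _).
  rewrite -powR_invn ?(ltW b10)// -powR_add//; congr (_ `^ _).
  have -> : n.+2%:R = n%:R + 2 :> R by rewrite -addn2 natrD.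
  by rewrite /e'; field; rewrite gt_eqF.
rewrite h5 in h4.
have h6 : 4^-1 `^ e' <= b1 `^ e'.
  by rewrite ge0_ler_powR ?nnegrE ?invr_ge0 ?(ltW b10).
have h7 : c1 ^+ 2 * (delta ^+ n.+2 * 4^-1 `^ e') <= 4 * C4 * E.
  apply: le_trans h4; apply: ler_wpM2l; first exact: sqr_ge0.
  by apply: ler_wpM2l => //; rewrite exprn_ge0// ltW.
have : 4 * C4 * E < c1 ^+ 2 * (delta ^+ n.+2 * 4^-1 `^ e').
  by move: E_small; rewrite /eps ltr_pdivlMr; [lra|exact: mulr_gt0].
by rewrite ltNge h7.
Qed.

End vanishing.

(** * Decay at the rate (n-1)/2 by truncation and a logarithmic cutoff *)

Section decay.
Context {R : realType} {n : nat}.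
Implicit Types (a x : 'rV[R]_n).

(** A variant for functions known to vanish off [K] only inside the ball: real powers of rho take
    default values outside it, so f is first replaced by 0 there. *)
Lemma bI_partial_ball K (f : 'rV[R]_n -> R) i : compact K -> K `<=` @hball R n ->
  Ck 1 (@hball R n) f -> (forall x, hball x -> ~ K x -> f x = 0) ->
  bint (partial i f) /\ bI (partial i f) = 0.
Proof.
move=> cK KB Cf f0; have oB := @hball_open R n.
pose h x := if `[< hball x >] then f x else 0.
have fh x : hball x -> f x = h x by move=> hx; rewrite /h; case: asboolP.
have Ch := Ck_ext oB fh Cf.
have h0 x : ~ K x -> h x = 0.
  by move=> Kx; rewrite /h; case: asboolP => // hx; exact: f0.
have E x : hball x -> partial i h x = partial i f x.
  by move=> hx; apply: (partial_ext i oB _ hx) => y /fh.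
have clK : closed K by apply: compact_closed cK; exact: norm_hausdorff.
split; last by rewrite -(bI_ext E); exact: (bI_partial i cK KB Ch h0).
apply: eq_bint E _; apply: (bint_compact cK KB).
  by move=> x; exact: (Ck_continuous (Ck_partial i Ch)).
exact: (partial_supp i clK h0).
Qed.

Lemma rho_ge_compact (r : R) : 0 < r ->
  compact [set x : 'rV[R]_n | r <= rho x] /\ [set x : 'rV[R]_n | r <= rho x] `<=` @hball R n.
Proof.
move=> r0; have sub : [set x : 'rV[R]_n | r <= rho x] `<=` @hball R n.
  by move=> x /= h; apply/hballE; exact: lt_le_trans h.
split => //; apply: subclosed_compact (@cube_compact R n 0 1) _; last first.
  by move=> x /sub; exact: hball_subset_cube.
rewrite (_ : [set x | _] = @rho R n @^-1` `[r, +oo[%classic); last first.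
  by apply/seteqP; split => x; rewrite /preimage /= in_itv /= andbT.
apply: closed_comp; last exact: interval_closed.
by move=> x _; exact: (Ck_continuous (Ck_rho 0 (@openT _)) I).
Qed.

Variables (lambda p : R) (u : 'rV[R]_n -> R) (g : 'rV[R]_n -> 'rV[R]_n).
Hypotheses (n2 : (2 <= n)%N) (lambdan : lambda <= n%:R * (n%:R - 2) / 4) (p1 : 1 < p).
Hypotheses (uC2 : Ck 2 (@hball R n) u) (usol : weak_solution lambda p u).
Hypothesis wg : weak_gradient (@hball R n) u g.
Hypothesis ufin : (hintegral (fun x => hgrad_dot x (g x) (g x) + u x ^+ 2)%R < +oo)%E.

Let s : R := (n%:R - 1) / 2.
Let f : 'rV[R]_n -> R := conf u s.

(** The exponent (n-1)/2 maximizes s(n-1-s), with value s^2 = (n-1)^2/4, and leaves the weights rho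
    and 1/rho. *)
Lemma pde_half x : hball x ->
  \sum_i partial i (fun y => rho y * partial i f y) x =
  f x / rho x * (s ^+ 2 + s * rho x - lambda - `|u x| `^ (p - 1)).
Proof.
move=> hx; have x0 := (hballE _).1 hx; have := pde_conf p1 uC2 usol s hx.
have -> : 2 * s - n%:R + 2 = 1 by rewrite /s; field.
have -> : 2 * s - n%:R = -1 by rewrite /s; field.
rewrite powR_inv1 ?(ltW x0)// => E.
have -> : \sum_i partial i (fun y => rho y * partial i f y) x =
    \sum_i partial i (fun y => rho y `^ 1 * partial i (conf u s) y) x.
  apply: eq_bigr => i _; apply: (partial_ext i hball_open _ hx) => y /hballE y0.
  by rewrite powRr1// ltW.
rewrite E; congr (_ * (_ - _ - _)).
by rewrite /s; field.
Qed.

(** The function equals u^2 rho^-n, which is part of the energy density. *)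
Lemma bint_conf_sqr : bint (fun x => f x ^+ 2 / rho x).
Proof.
apply: le_bint (energy_bint wg ufin) _.
  apply: (continuous_measurable_rV hball_open) => x hx.
  have c := Ck_continuous (Ck_conf uC2 s) hx.
  have c2 : {for x, continuous (fun x => rho x `^ (-1))}.
    exact: (Ck_continuous (Ck_rho_powR 0 (-1)) hx).
  have c3 : {for x, continuous (fun x => f x * f x * rho x `^ (-1))}.
    exact: (cvgM (cvgM c c) c2).
  apply: near_eq_continuous c3.
  near=> y; rewrite powR_inv1 ?expr2//.
  apply/ltW/hballE; near: y.
  by apply: open_nbhs_nbhs; split; [exact: hball_open|].
move=> x hx; have x0 := (hballE _).1 hx.
have E : f x ^+ 2 / rho x = u x ^+ 2 * rho x ^- n.
  rewrite /f /conf exprMn mulrAC mulrC; congr (_ * _).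
  rewrite expr2 -powR_add// -[(rho x)^-1]powR_inv1 ?(ltW x0)// -powR_add//.
  rewrite -powR_invn ?(ltW x0)//; congr (_ `^ _).
  by rewrite /s; field.
rewrite E ger0_norm; last by rewrite mulr_ge0 ?sqr_ge0// invr_ge0 exprn_ge0// ltW.
rewrite energyE// ler_wpM2r ?invr_ge0 ?exprn_ge0 ?(ltW x0)//.
by rewrite lerDr hgrad_dot_ge0.
Unshelve. all: by end_near. Qed.

(* Completing the square bounds the cross term created by the cutoff. *)
Lemma theta_square_le (e t A B : R) :
  - (t ^+ 2 * B ^+ 2) * (0 < t)%R%:R <=
  2 * e * theta t * B * A + e ^+ 2 * dtheta t * A ^+ 2.
Proof.
have [t0|t0] := ltP 0 t; last first.
  by rewrite theta_eq0// dtheta_eq0// !(mulr0, mul0r) addr0.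
rewrite mulr1 -(dthetaE t0).
have h1 : 0 <= dtheta t * (e * A + t ^+ 2 * B) ^+ 2 by rewrite mulr_ge0 ?sqr_ge0 ?dtheta_ge0.
have h2 : theta t * (t ^+ 2 * B ^+ 2) <= t ^+ 2 * B ^+ 2.
  by rewrite ler_piMl ?theta_le1// mulr_ge0 ?sqr_ge0.
rewrite -(dthetaE t0) in h2.
lra.
Qed.

Lemma conf_bounded (r0 : R) : 0 < r0 ->
  (forall x, hball x -> rho x <= r0 -> `|u x| `^ (p - 1) <= 16^-1) ->
  exists2 M : R, 0 < M & forall x, hball x -> f x <= M.
Proof.
move=> r00 small; have oB := @hball_open R n.
have cf x : hball x -> {for x, continuous f} by exact: (Ck_continuous (Ck_conf uC2 s)).
have [cK0 K0B] := rho_ge_compact r00.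
(* With this M, wherever f exceeds M one has rho < r0, and there |u|^(p-1) is small. *)
have [M M0 fM] := continuous_compact_bounded cK0 (fun x hx => cf x (K0B x hx)).
exists M => // x0 hx0; rewrite leNgt; apply/negP => fx0.
have rho0 := (hballE _).1 hx0.
have [Ct Ct0 hCt] := @dtheta_bounded R.
pose m := (f x0 - M) / 2.
have m0 : 0 < m by rewrite divr_gt0// subr_gt0.
have [t t0 ht] : exists2 t : R, 0 < t &
    cube x0 t `<=` [set y | [/\ hball y, M + m < f y & rho x0 / 2 < rho y]].
  apply/nbhs_cubeP; near=> y; split; near: y.
  - by apply: open_nbhs_nbhs; split.
  - by apply: (cvgr_gt _ (cf _ hx0)); rewrite /m; lra.
  - by apply: (cvgr_gt _ (Ck_continuous (Ck_rho 0 (@openT _)) I)); lra.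
have tB : cube x0 t `<=` @hball R n by move=> y /ht[].
pose I0 := bI (fun x => f x ^+ 2 / rho x).
have I00 : 0 <= I0.
  by apply: bI_ge0 => x /hballE x1; rewrite divr_ge0 ?sqr_ge0// ltW.
(* Lower bound on the cube for the integrand of [low]: the cutoff is at least theta(1/2), the
   truncation at least theta(m), f at least m, and 1/rho at least 1. *)
pose c0 := 8^-1 * theta 2^-1 ^+ 2 * theta m * m.
have th0 : 0 < theta 2^-1 :> R by rewrite theta_gt0// invr_gt0.
have tm0 : 0 < theta m by exact: theta_gt0.
have c00 : 0 < c0.
  by apply: mulr_gt0 => //; apply: mulr_gt0 => //; rewrite mulr_gt0 ?invr_gt0 ?exprn_gt0.
pose V := c0 * (t *+ 2) ^+ n.
have V0 : 0 < V by rewrite mulr_gt0// exprn_gt0// pmulrn_lgt0.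
have W0 : 0 <= Ct ^+ 2 * I0 by rewrite mulr_ge0 ?sqr_ge0.
suff H e : 0 < e -> V <= e ^+ 2 * (Ct ^+ 2 * I0).
  have VW : 0 < V + Ct ^+ 2 * I0 by rewrite ltr_wpDr.
  (* With W = Ct^2 I0 and e = V/(V+W) <= 1, one gets e^2 W <= e W = V - e V < V, a contradiction. *)
  have e0 : 0 < V / (V + Ct ^+ 2 * I0) by rewrite divr_gt0.
  have e1 : V / (V + Ct ^+ 2 * I0) <= 1 by rewrite ler_pdivrMr// mul1r lerDl.
  have := H _ e0; set e := V / _ in e0 e1 *.
  have : e * (V + Ct ^+ 2 * I0) = V by rewrite /e divfK// gt_eqF.
  have : e ^+ 2 * (Ct ^+ 2 * I0) <= e * (Ct ^+ 2 * I0).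
    by rewrite ler_wpM2r// expr2 ler_piMr// ltW.
  have : 0 < e * V by rewrite mulr_gt0.
  by move=> h1 h2 h3 h4; lra.
move=> e0.
(* Solves (s' / (rho(x0)/2))^e = 1/2, so the cutoff stays at least theta(1/2) where rho >=
   rho(x0)/2, whatever e is. *)
pose s' := rho x0 / 2 * 2 `^ (- e^-1).
have s'0 : 0 < s' by apply: mulr_gt0; [exact: divr_gt0|exact: powR_gt0].
have s'e : s' `^ e = (rho x0 / 2) `^ e / 2.
  have ra2 : 0 <= rho x0 / 2 by rewrite ltW// divr_gt0.
  rewrite /s' (powRM _ ra2 (powR_ge0 _ _)); congr (_ * _).
  by rewrite -powRrM mulNr mulVf ?gt_eqF// powR_inv1.
(* The derivative of w in log rho is e (s'/rho)^e, which is at most e where w > 0; and w <= 0 where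
   rho <= s'. *)
pose w x : R := 1 - s' `^ e * rho x `^ (- e).
pose eta x := theta (w x).
pose G x := theta (f x - M).
have [cK KB] := rho_ge_compact s'0; set K := [set x | _] in cK KB.
have pw (x y : R) : 0 < x -> x <= y -> y `^ (- e) <= x `^ (- e).
  move=> x1 xy; rewrite !powRN lef_pV2 ?posrE ?powR_gt0//; last exact: lt_le_trans xy.
  by rewrite ge0_ler_powR ?nnegrE ?(ltW x1) ?(ltW e0)// (le_trans (ltW x1)).
have eta0 x : hball x -> ~ K x -> eta x = 0.
  move=> /hballE x1 /negP; rewrite -ltNge => xs.
  apply: theta_eq0; rewrite /w subr_le0.
  have -> : 1 = s' `^ e * s' `^ (- e) by rewrite -powR_add// subrr powRr0.
  by rewrite ler_wpM2l ?powR_ge0// pw// ltW.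
have Cf := Ck_conf uC2 s; have Cf1 := CkW Cf.
have Cw : Ck 1 (@hball R n) w.
  exact: (CkB oB (Ck_cst 1 _ 1) (CkM oB (Ck_cst 1 _ (s' `^ e)) (Ck_rho_powR 1 (- e)))).
have Ceta : Ck 1 (@hball R n) eta.
  exact: (Ck_comp 0 oB (@theta_seqP R) (fun _ _ => I) Cw).
have CG : Ck 1 (@hball R n) G.
  exact: (Ck_comp 0 oB (@theta_seqP R) (fun _ _ => I) (CkB oB Cf1 (Ck_cst 1 _ M))).
have Crf i : Ck 1 (@hball R n) (fun x => rho x * partial i f x).
  exact: (CkM oB (Ck_rho 1 oB) (Ck_partial i Cf)).
(* The flux of f times the test function eta^2 theta(f - M). Squaring [eta] lets the cross term be
   absorbed by completing the square. *)
pose F i x := eta x * eta x * G x * (rho x * partial i f x).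
have CF i : Ck 1 (@hball R n) (F i).
  exact: (CkM oB (CkM oB (CkM oB Ceta Ceta) CG) (Crf i)).
have F0 i x : hball x -> ~ K x -> F i x = 0.
  by move=> hx Kx; rewrite /F eta0// !mul0r.
have iF i := bI_partial_ball i cK KB (CF i) (F0 i).
pose H x := - (dtheta (w x) * (e * s' `^ e * rho x `^ (- e - 1))).
have dF i x : hball x -> partial i (F i) x =
    eta x ^+ 2 * G x * partial i (fun y => rho y * partial i f y) x +
    rho x * (2 * eta x * theta (f x - M) * (H x * x 0 i) * partial i f x +
             eta x ^+ 2 * dtheta (f x - M) * partial i f x ^+ 2).
  move=> hx.
  have d1 : is_derive x (delta_mx 0 i) eta (H x * x 0 i).
    have dw : is_derive x (delta_mx 0 i) w (- s' `^ e * (- - e * rho x `^ (- e - 1) * x 0 i)).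
      rewrite (_ : w = fun x => 1 + (- s' `^ e) * rho x `^ (- e)).
        exact: (is_derive_affine _ _ (is_derive_rho_powR (- e) i hx)).
      by apply/funext => y; rewrite /w mulNr.
    apply: (is_derive_eq (is_derive_compr (@theta_seqP R 0 (w x) I) dw)).
    by rewrite /H -/(dtheta (w x)); ring.
  have d2 : is_derive x (delta_mx 0 i) G (dtheta (f x - M) * partial i f x).
    have df : is_derive x (delta_mx 0 i) (fun x => f x - M) (partial i f x).
      rewrite (_ : (fun x => f x - M) = fun x => - M + 1 * f x).
        apply: (is_derive_eq (is_derive_affine _ _ (Ck_is_derive i Cf1 hx))).
        exact: mul1r.
      by apply/funext => y; rewrite mul1r addrC.
    exact: (is_derive_compr (@theta_seqP R 0 (f x - M) I) df).
  rewrite (partialP (is_derive_mul (is_derive_mul (is_derive_mul d1 d1) d2)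
    (Ck_is_derive i (Crf i) hx))) /=.
  rewrite -/(G x); move: (partial i (fun y => rho y * partial i f y) x) => D.
  move: (partial i f x) (eta x) (G x) (H x) (rho x) (dtheta _) (x 0 i) => a1 a2 a3 a4 a5 a6 a7.
  ring.
have iS : bint (fun x => \sum_i partial i (F i) x).
  by apply: bint_sum => i; have [] := iF i.
have IS : bI (fun x => \sum_i partial i (F i) x) = 0.
  rewrite bI_sum; first by apply: big1 => i _; have [] := iF i.
  by move=> i; have [] := iF i.
have i1 := bint_indic_cube tB.
have i2 := bint_conf_sqr.
have Hb x : hball x -> `|rho x * H x| <= e * Ct.
  move=> hx; have x1 := (hballE _).1 hx.
  have -> : rho x * H x = - (e * (dtheta (w x) * (s' `^ e * rho x `^ (- e)))).
    have -> : rho x `^ (- e) = rho x `^ (- e - 1) * rho x.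
      rewrite -[X in _ * X]powRr1 ?(ltW x1)// -powR_add//; congr (_ `^ _); ring.
    by rewrite /H; ring.
  rewrite normrN normrM (gtr0_norm e0) ler_wpM2l ?(ltW e0)//.
  have P0 : 0 <= s' `^ e * rho x `^ (- e) by rewrite mulr_ge0 ?powR_ge0.
  rewrite (ger0_norm (mulr_ge0 (dtheta_ge0 _) P0)).
  have [w0|w0] := leP (w x) 0; first by rewrite dtheta_eq0// mul0r ltW.
  have P1 : s' `^ e * rho x `^ (- e) <= 1 by move: w0; rewrite /w; lra.
  by rewrite -[leRHS]mulr1; apply: ler_pM => //; exact: dtheta_ge0.
(* The gap (n-1)^2/4 - n(n-2)/4 = 1/4. *)
have s2 : 2^-1 ^+ 2 <= s ^+ 2 - lambda.
  by have := lambdan; rewrite /s; lra.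
have s0 : 0 <= s.
  have : 2 <= n%:R :> R by rewrite (ler_nat _ 2).
  by rewrite /s; lra.
have low : forall x, hball x ->
    8^-1 * (eta x ^+ 2 * G x * f x) / rho x <=
    \sum_i partial i (F i) x + e ^+ 2 * Ct ^+ 2 * (f x ^+ 2 / rho x).
  move=> x hx; have x1 := (hballE _).1 hx.
  under eq_bigr do rewrite dF//.
  rewrite big_split /= -mulr_sumr pde_half// -mulr_sumr.
  set B := `|u x| `^ (p - 1).
  (* Where f > M the coefficient is at least 1/4 - 1/16, which exceeds 1/8; elsewhere the truncation
     [G] vanishes. *)
  have h1 : 8^-1 * (eta x ^+ 2 * G x * f x) / rho x <=
      eta x ^+ 2 * G x * (f x / rho x * (s ^+ 2 + s * rho x - lambda - B)).
    have [fxM|fxM] := leP (f x) M.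
      by rewrite /G theta_eq0 ?subr_le0// !(mulr0, mul0r).
    have Bs : B <= 16^-1.
      apply: small => //; rewrite leNgt; apply/negP => rx.
      by have := fM x (ltW rx); rewrite ler_norml => /andP[_]; rewrite leNgt fxM.
    have -> : 8^-1 * (eta x ^+ 2 * G x * f x) / rho x = eta x ^+ 2 * G x * (f x / rho x * 8^-1) by ring.
    apply: ler_wpM2l; first by rewrite mulr_ge0 ?sqr_ge0 ?theta_ge0.
    apply: ler_wpM2l; first by rewrite divr_ge0 ?(ltW x1)// (le_trans (ltW M0) (ltW fxM)).
    have : 0 <= s * rho x by rewrite mulr_ge0// ltW.
    lra.
  (* [theta_square_le] is summed over the coordinates; then |rho H| <= e Ct by [Hb], |x| <= 1, and 0
     < f - M < f where the truncation is active. *)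
  have h2 : - (e ^+ 2 * Ct ^+ 2 * (f x ^+ 2 / rho x)) <=
      rho x * \sum_i (2 * eta x * theta (f x - M) * (H x * x 0 i) * partial i f x +
             eta x ^+ 2 * dtheta (f x - M) * partial i f x ^+ 2).
    have [fxM|fxM] := leP (f x) M.
      rewrite big1; last first.
        by move=> i _; rewrite theta_eq0 ?subr_le0// dtheta_eq0 ?subr_le0// !(mulr0, mul0r) addr0.
      have fr : 0 <= f x ^+ 2 / rho x by rewrite divr_ge0 ?sqr_ge0 ?(ltW x1).
      by rewrite mulr0 oppr_le0; apply: mulr_ge0 => //; apply: mulr_ge0; exact: sqr_ge0.
    have tp : 0 < f x - M by rewrite subr_gt0.
    apply: (@le_trans _ _ (rho x * \sum_i (- ((f x - M) ^+ 2 * (H x * x 0 i) ^+ 2)))); last first.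
      rewrite ler_wpM2l ?(ltW x1)//; apply: ler_sum => i _.
      by have := theta_square_le (eta x) (f x - M) (partial i f x) (H x * x 0 i); rewrite tp mulr1.
    rewrite sumrN mulrN lerN2 -mulr_sumr.
    have -> : \sum_i (H x * x 0 i) ^+ 2 = H x ^+ 2 * sqd 0 x.
      by rewrite /sqd mulr_sumr; apply: eq_bigr => i _; rewrite mxE subr0 exprMn.
    have q1 : sqd 0 x <= 1 by move: x1; rewrite rhoE; lra.
    have -> : rho x * ((f x - M) ^+ 2 * (H x ^+ 2 * sqd 0 x)) =
      (rho x * H x) ^+ 2 * ((f x - M) ^+ 2 * sqd 0 x / rho x) by field; rewrite gt_eqF.
    apply: ler_pM; first exact: sqr_ge0.
    - by rewrite divr_ge0 ?(ltW x1)// mulr_ge0 ?sqr_ge0 ?sqd_ge0.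
    - rewrite -exprMn -(real_normK (num_real (rho x * H x))) lerXn2r ?nnegrE ?normr_ge0 ?Hb//.
      by rewrite mulr_ge0// ltW.
    - rewrite ler_wpM2r ?invr_ge0 ?(ltW x1)// -[leRHS]mulr1.
      apply: ler_pM => //; rewrite ?sqr_ge0 ?sqd_ge0//.
      rewrite lerXn2r ?nnegrE ?(ltW tp)//; first by rewrite (le_trans (ltW M0)) ?ltW.
      by rewrite gerBl ltW.
  lra.
have -> : e ^+ 2 * (Ct ^+ 2 * I0) = bI (fun x => \sum_i partial i (F i) x + e ^+ 2 * Ct ^+ 2 * (f x ^+ 2 / rho x)).
  rewrite bID//; last exact: bintZ.
  by rewrite IS add0r bIZ// mulrA.
rewrite /V -(bI_indic_cube (ltW t0) tB) -bIZ//.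
apply: le_bI; [exact: bintZ|by apply: bintD => //; exact: bintZ|].
move=> x hx; have x1 := (hballE _).1 hx; apply: le_trans (low _ hx).
rewrite indicE; have [xt|xt] := pselect (cube x0 t x); last first.
  rewrite memNset// mulr0.
  have [fxM|fxM] := leP (f x) M.
    by rewrite /G theta_eq0 ?subr_le0// !(mulr0, mul0r).
  have fx_ge0 : 0 <= f x := le_trans (ltW M0) (ltW fxM).
  apply: divr_ge0; last exact: ltW.
  apply: mulr_ge0; first by rewrite invr_ge0.
  by apply: mulr_ge0 => //; apply: mulr_ge0; [exact: sqr_ge0|exact: theta_ge0].
rewrite mem_set// mulr1; have [_ h1 h2] := ht _ xt.
have r1 : 1 <= (rho x)^-1.
  rewrite invf_ge1//; rewrite rhoE; have := sqd_ge0 0 x; lra.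
have eta_ge : theta 2^-1 <= eta x.
  apply: theta_homo; rewrite /w s'e.
  have : rho x `^ (- e) <= (rho x0 / 2) `^ (- e) by apply: pw; [rewrite divr_gt0|exact: ltW].
  move=> h; have z0 : 0 < (rho x0 / 2) `^ e by rewrite powR_gt0// divr_gt0.
  have : (rho x0 / 2) `^ e * rho x `^ (- e) <= 1.
    apply: le_trans (_ : (rho x0 / 2) `^ e * (rho x0 / 2) `^ (- e) <= _).
      by rewrite ler_wpM2l// ltW.
    by rewrite -(powR_add _ _ (divr_gt0 rho0 (ltr0n R 2))) subrr powRr0.
  lra.
have G_ge : theta m <= G x by apply: theta_homo; lra.
have m1 : m <= f x by lra.
rewrite -[leLHS]mulr1; apply: ler_pM => //; first exact: ltW.
rewrite /c0 -2!mulrA; apply: ler_wpM2l; first by rewrite invr_ge0.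
rewrite mulrA; apply: ler_pM => //; [|exact: ltW|].
  by rewrite mulr_ge0 ?sqr_ge0// ltW.
apply: ler_pM => //; [exact: sqr_ge0|exact: ltW|].
by rewrite lerXn2r ?nnegrE ?(ltW th0)// theta_ge0.
Unshelve. all: by end_near. Qed.

End decay.

Unset Implicit Arguments.
Set Strict Implicit.

Theorem theorem4p2 (R : realType) (N : nat) (lambda p : R) (u : 'rV[R]_N -> R)
  (hN : (2 <= N)%N)
  (hlambda : lambda <= N%:R * (N%:R - 2) / 4)
  (hp : 1 < p)
  (hpN : (2 < N)%N -> p <= (N%:R + 2) / (N%:R - 2))
  (uC2 : Ck 2 (@hball R N) u)
  (uH1 : H1 u)
  (usol : weak_solution lambda p u) :
  exists C : R, 0 < C /\
    forall x : 'rV[R]_N, hball x ->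
      u x <= C * ((1 - enorm x ^+ 2) / 2) `^ ((N%:R - 2) / 2).
Proof.
have [g [wg ufin]] := uH1.
have [r0 r00 small] := vanishing hN hlambda hp hpN uC2 usol wg ufin.
have [M M0 fM] := conf_bounded hN hlambda hp uC2 usol wg ufin r00 small.
exists M; split => // x hx; have x0 := (hballE x).1 hx.
rewrite (confK u ((N%:R - 1) / 2) hx) mulrC -/(rho x).
apply: (@le_trans _ _ (M * rho x `^ ((N%:R - 1) / 2))).
  by apply: ler_wpM2r; [exact: powR_ge0|exact: fM].
apply: ler_wpM2l; first exact: ltW.
(* As rho <= 1 in the ball, the exponent (N-1)/2 may be lowered to (N-2)/2. *)
apply: ger_powR; last lra.
by rewrite x0 rhoE /=; have := sqd_ge0 0 x; lra.
Qed.
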